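(* Let $X$ be a second countable, locally compact, Hausdorff space, let $\Gamma$ be an amenable countable discrete group with identity $e$, and let $\mathcal{P}$ be a subsemigroup of $\Gamma$ containing $e$ and satisfying $\Gamma=\mathcal{P}\mathcal{P}^{-1}=\mathcal{P}^{-1}\mathcal{P}$. Let $\theta$ be an injective (right) action of $\mathcal{P}$ on $X$, let $\mathcal{G}$ be the associated transformation groupoid with its canonical cocycle $c:\mathcal{G}\to\Gamma$, and let $M$ be a diagonal bimodule of $C_r^*(\mathcal{G})$. Then $M$ is spectral if and only if $M$ is $\alpha^c$-invariant (respectively, $\delta_c$-invariant) when $\Gamma$ is abelian (respectively, nonabelian).
   Context: An injective (right) action $\theta$ of $\mathcal{P}$ on $X$ is a family $\{\theta_a\}_{a\in\mathcal{P}}$ of continuous, injective, open maps $\theta_a:X\to X$ with $\theta_a\theta_b=\theta_{ba}$ for all $a,b\in\mathcal{P}$ and $\theta_e=\mathrm{id}_X$. For $x\in X$ let $Q_x=\{g\in\Gamma:\exists a,b\in\mathcal{P},y\in X\text{ such that }g=ab^{-1}\text{ and }\theta_a(x)=\theta_b(y)\}$. For $g\in Q_x$ there is a unique element $u(x,g)\in X$ such that whenever $g=ab^{-1}$ with $a,b\in\mathcal{P}$, $\theta_a(x)=\theta_b(u(x,g))$. The transformation groupoid is $\mathcal{G}=\{(x,g)\in X\times\Gamma:g\in Q_x\}$ with $(x,g)(y,h)=(x,gh)$ if $y=u(x,g)$, $(x,g)^{-1}=(u(x,g),g^{-1})$, and the relative product topology from $X\times\Gamma$; it is an amenable \'etale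 groupoid (second countable, locally compact, Hausdorff, with range and source maps $r,s$ local homeomorphisms). The canonical continuous $1$-cocycle is $c(x,g)=g$. $C_c(\mathcal{G})$ is a $*$-algebra with $f^*(\gamma)=\overline{f(\gamma^{-1})}$ and $(fg)(\gamma)=\sum_{\gamma'\in s^{-1}(s(\gamma))}f(\gamma\gamma'^{-1})g(\gamma')$; $C_r^*(\mathcal{G})$ is its completion in the norm $\|f\|_{\mathrm{red}}=\sup_{u\in\mathcal{G}^{(0)}}\|\mathrm{Ind}_u(f)\|$, where $\mathrm{Ind}_u(f)\xi(\gamma)=\sum_{\gamma'\in s^{-1}(u)}f(\gamma\gamma'^{-1})\xi(\gamma')$ on $\ell^2(s^{-1}(u))$. The inclusion $C_c(\mathcal{G})\subseteq C_0(\mathcal{G})$ extends to a norm-decreasing injective linear map $C_r^*(\mathcal{G})\to C_0(\mathcal{G})$, by which each $a\in C_r^*(\mathcal{G})$ is identified with a function $\gamma\mapsto a(\gamma)$. $C_0(\mathcal{G}^{(0)})$ ($\mathcal{G}^{(0)}$ the unit space) is regarded as a $C^*$-subalgebra of $C_r^*(\mathcal{G})$. A diagonal bimodule is a norm closed subspace $M\subseteq C_r^*(\mathcal{G})$ with $ab,ba\in M$ for all $a\in M$, $b\in C_0(\mathcal{G}^{(0)})$. Put $\sigma(M)=\{\gamma\in\mathcal{G}:a(\gamma)\neq0\text{ for some }a\in M\}$ and, for open $P\subseteq\mathcal{G}$, $A(P)=\{a\in C_r^*(\mathcal{G}):a(\gamma)=0\ \forall\gamma\notin P\}$. $M$ is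 spectral if $M=A(\sigma(M))$. If $\Gamma$ is abelian, $\alpha^c$ is the action of the dual group $\widehat\Gamma$ on $C_r^*(\mathcal{G})$ by automorphisms with $\alpha^c_\chi(a)(\gamma)=\chi(c(\gamma))a(\gamma)$; $M$ is $\alpha^c$-invariant if $\alpha^c_\chi(M)\subseteq M$ for all $\chi\in\widehat\Gamma$. If $\Gamma$ is nonabelian, with left regular representation $\lambda$, $\delta_c:C_r^*(\mathcal{G})\to C_r^*(\mathcal{G})\otimes_{\min}C_r^*(\Gamma)$ is the coaction (nondegenerate $*$-homomorphism) determined by $\delta_c(f)=f\otimes\lambda_t$ for $f\in C_c(\mathcal{G})$ with $\mathrm{supp}(f)\subseteq c^{-1}(t)$, $t\in\Gamma$; $M$ is $\delta_c$-invariant if $\delta_c(M)\subseteq\overline{\mathrm{span}}\{a\otimes b:a\in M,b\in C_r^*(\Gamma)\}$. *)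

(* Defs.v *)
From HB Require Import structures.
From mathcomp Require Import all_boot all_order all_algebra finmap.
From mathcomp Require Import all_classical all_reals all_analysis.
From mathcomp Require Import complex ring.
From mathcomp Require summability.
Set Implicit Arguments.
Unset Strict Implicit.
Unset Printing Implicit Defensive.
Import Order.TTheory GRing.Theory Num.Theory.
Import numFieldNormedType.Exports.
Local Open Scope classical_set_scope.
Local Open Scope ring_scope.

(* R[i]^o is R[i] with its topology and norm and its left module structure over
   itself. *)
Notation Cplx R := (R[i]^o).

Section SquareModulus.
Variable R : realType.
Implicit Types z w : Cplx R.

(* A real number, whereas `|z| is an element of R[i]. *)
Definition sqmod z : R := complex.Re z ^+ 2 + complex.Im z ^+ 2.

Lemma sqmod_ge0 z : 0 <= sqmod z.
Proof. by rewrite addr_ge0 // sqr_ge0. Qed.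

Lemma sqmod0 : sqmod 0 = 0.
Proof. by rewrite /sqmod /= expr0n addr0. Qed.

Lemma sqmodM (z w : R[i]) : sqmod (z * w) = sqmod z * sqmod w.
Proof. by case: z w => [a b] [c d]; rewrite /sqmod /=; ring. Qed.

Lemma sqmodD z w : sqmod (z + w) <= 2 * sqmod z + 2 * sqmod w.
Proof.
case: z w => [a b] [c d]; rewrite /sqmod /= -subr_ge0.
have -> : 2 * (a ^+ 2 + b ^+ 2) + 2 * (c ^+ 2 + d ^+ 2) -
  ((a + c) ^+ 2 + (b + d) ^+ 2) = (a - c) ^+ 2 + (b - d) ^+ 2 :> R by ring.
by rewrite addr_ge0 // sqr_ge0.
Qed.

End SquareModulus.

Section HilbertSpace.
Variables (R : realType) (I : choiceType).
Local Notation C := (Cplx R).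

Definition sqsum (xi : I -> C) : \bar R :=
  (\esum_(i in [set: I]) (sqmod (xi i))%:E)%E.

Definition ell2_pred : {pred I -> C} := fun xi => `[< (sqsum xi < +oo)%E >].

Lemma sqsum_ge0 (xi : I -> C) : (0 <= sqsum xi)%E.
Proof. by apply: esum_ge0 => i _; rewrite lee_fin sqmod_ge0. Qed.

Lemma sqsumZ (c : C) (xi : I -> C) :
  (sqsum xi < +oo)%E -> (sqsum (c *: xi) < +oo)%E.
Proof.
move=> xioo; apply: (@le_lt_trans _ _ ((sqmod c)%:E * sqsum xi)%E); last first.
  by rewrite lte_mul_pinfty // lee_fin sqmod_ge0.
apply: ge_ereal_sup => _ [A finA <-].
rewrite (eq_fsbigr (fun i => (sqmod c)%:E * (sqmod (xi i))%:E)%E); last first.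
  by move=> i _; rewrite -EFinM -sqmodM.
rewrite -ge0_mule_fsumr; last by move=> i; rewrite lee_fin sqmod_ge0.
apply: lee_wpmul2l; first by rewrite lee_fin sqmod_ge0.
by apply: ereal_sup_ubound; exists A.
Qed.

Lemma sqsumD (xi eta : I -> C) :
  (sqsum xi < +oo)%E -> (sqsum eta < +oo)%E -> (sqsum (xi + eta)%R < +oo)%E.
Proof.
move=> xioo etaoo.
pose b i : \bar R := ((sqmod (xi i))%:E + (sqmod (xi i))%:E +
  ((sqmod (eta i))%:E + (sqmod (eta i))%:E))%E.
apply: (@le_lt_trans _ _ (\esum_(i in [set: I]) b i)%E).
  apply: le_esum => i _; rewrite lee_fin.
  apply: le_trans (sqmodD (xi i) (eta i)) _.
  by rewrite (mulr_natl (sqmod (xi i))) (mulr_natl (sqmod (eta i))) !mulr2n.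
rewrite /b !esumD; try by move=> i _; rewrite ?adde_ge0 ?lee_fin ?sqmod_ge0.
by rewrite !lte_add_pinfty.
Qed.

Lemma ell2_submod : submod_closed ell2_pred.
Proof.
split=> [|c xi eta /asboolP xioo /asboolP etaoo]; apply/asboolP.
  rewrite /sqsum esum1 // => i _; rewrite /= sqmod0 //.
by apply: sqsumD => //; exact: sqsumZ.
Qed.

HB.instance Definition _ := GRing.isSubmodClosed.Build _ _ ell2_pred ell2_submod.

Record ell2 := Ell2 { ell2_fun :> I -> C; _ : ell2_fun \in ell2_pred }.

HB.instance Definition _ := [isSub for ell2_fun].
HB.instance Definition _ := [Choice of ell2 by <:].
HB.instance Definition _ := [SubChoice_isSubLmodule of ell2 by <:].


Definition l2norm (xi : ell2) : R := Num.sqrt (fine (sqsum xi)).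

Definition inner (xi eta : ell2) : C :=
  summability.sum (fun i => (xi i : R[i]) * ((eta i : R[i])^*)%C : C).

Lemma sqsum_basis i : (sqsum (fun j => (j == i)%:R) < +oo)%E.
Proof.
rewrite /sqsum (esumID [set i]); last by move=> j _; rewrite lee_fin sqmod_ge0.
rewrite !setTI esum_set1 ?lee_fin ?sqmod_ge0// esum1 ?adde0 ?ltry//.
by move=> j /eqP /negPf ji; rewrite /= ji sqmod0.
Qed.

Definition basis_vec i : ell2 :=
  @Ell2 (fun j => (j == i)%:R) (asboolT (sqsum_basis i)).

End HilbertSpace.

Arguments inner {R I}.
Arguments basis_vec {R I}.

Lemma sqsum_tensor (R : realType) (I J : choiceType) (xi : ell2 R I)
    (eta : ell2 R J) :
  (sqsum (fun k : I * J => (xi k.1 : R[i]) * eta k.2 : Cplx R)%R < +oo)%E.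
Proof.
have /asboolP xioo : ell2_fun xi \in @ell2_pred R I by case: xi.
have /asboolP etaoo : ell2_fun eta \in @ell2_pred R J by case: eta.
have le0 (K : choiceType) (z : K -> Cplx R) k : (0 <= (sqmod (z k))%:E)%E.
  by rewrite lee_fin sqmod_ge0.
rewrite /sqsum.
have -> : [set: I * J] = [set: I] `*`` (fun=> [set: J]).
  by apply/seteqP; split.
under eq_esum do rewrite sqmodM EFinM.
rewrite -(@esum_esum _ _ _ [set: I] (fun=> [set: J])
  (fun i j => (sqmod (xi i))%:E * (sqmod (eta j))%:E)%E); last first.
  by move=> i j _ _; rewrite mule_ge0.
have fineta : sqsum eta \is a fin_num by rewrite ge0_fin_numE ?sqsum_ge0.
apply: (@le_lt_trans _ _ (\esum_(i in [set: I])
    ((fine (sqsum eta))%:E * (sqmod (xi i))%:E))%E).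
  apply: le_esum => i _; apply: ge_ereal_sup => _ [A finA <-].
  rewrite -ge0_mule_fsumr; last by move=> j; exact: le0.
  rewrite muleC fineK//; apply: lee_wpmul2r => //.
  by apply: ereal_sup_ubound; exists A.
apply: (@le_lt_trans _ _ (sqsum eta * sqsum xi)%E).
  apply: ge_ereal_sup => _ [A finA <-].
  rewrite -ge0_mule_fsumr; last by move=> j; exact: le0.
  rewrite fineK//; apply: lee_wpmul2l; first exact: sqsum_ge0.
  by apply: ereal_sup_ubound; exists A.
by rewrite lte_mul_pinfty// sqsum_ge0.
Qed.

Definition tensor_vec (R : realType) (I J : choiceType) (xi : ell2 R I)
    (eta : ell2 R J) : ell2 R (I * J)%type :=
  Ell2 (asboolT (sqsum_tensor xi eta)).

Section BoundedOperators.
Variables (R : realType) (I : choiceType).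
Local Notation H := (ell2 R I).
Implicit Types (S T : H -> H) (A B : set (H -> H)).

Definition bounded_op T :=
  linear T /\ exists K : R, forall xi, l2norm (T xi) <= K * l2norm xi.

Definition opnorm T : \bar R :=
  ereal_sup [set (l2norm (T xi))%:E | xi in [set xi | l2norm xi <= 1]].

Definition adjoint_ops S T := forall xi eta, inner (S xi) eta = inner xi (T eta).

Definition opclosure A : set (H -> H) := [set T | bounded_op T /\
  forall eps : R, 0 < eps -> exists2 S, A S & (opnorm (T - S)%R <= eps%:E)%E].

Definition opspan A : set (H -> H) := [set T |
  exists n (c : 'I_n -> Cplx R) (S : 'I_n -> H -> H),
    (forall k, A (S k)) /\ T = \sum_(k < n) c k *: S k].

End BoundedOperators.

Definition is_tensor (R : realType) (I J : choiceType)
    (S : ell2 R I -> ell2 R I) (T : ell2 R J -> ell2 R J)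
    (U : ell2 R (I * J)%type -> ell2 R (I * J)%type) :=
  bounded_op U /\
  forall xi eta, U (tensor_vec xi eta) = tensor_vec (S xi) (T eta).

(* For C*-algebras A and B acting on l^2(I) and l^2(J), this is the minimal
   tensor product of A and B, acting on the Hilbert space tensor product
   l^2(I x J). *)
Definition closed_tensor (R : realType) (I J : choiceType)
    (A : set (ell2 R I -> ell2 R I)) (B : set (ell2 R J -> ell2 R J)) :=
  opclosure (opspan [set U | exists S T, [/\ A S, B T & is_tensor S T U]]).

Section Groups.
Variables (R : realType) (Gam : groupType).
Local Open Scope group_scope.

Lemma sqsum_translate (t : Gam) (xi : ell2 R Gam) :
  (sqsum (fun s : Gam => xi (t^-1 * s)%g) < +oo)%E.
Proof.
have /asboolP : ell2_fun xi \in @ell2_pred R Gam by case: xi.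
rewrite /sqsum (reindex_esum [set: Gam] _ (fun s => t^-1 * s))//.
split => // [s r _ _ /mulgI //|s _].
by exists (t * s) => //; rewrite mulgA mulVg mul1g.
Qed.

Definition left_regular (t : Gam) (xi : ell2 R Gam) : ell2 R Gam :=
  Ell2 (asboolT (sqsum_translate t xi)).

Definition group_cstar : set (ell2 R Gam -> ell2 R Gam) :=
  opclosure (opspan (range left_regular)).

Definition commutative_group := forall g h : Gam, g * h = h * g.

Definition bounded_real (f : Gam -> R) := exists K : R, forall g, `|f g| <= K.

(* There is a left invariant mean on the bounded functions. *)
Definition amenable_group := exists m : (Gam -> R) -> R,
  [/\ forall (c : R) f h, bounded_real f -> bounded_real h ->
        m (fun g => c * f g + h g)%R = (c * m f + m h)%R,
      forall f, bounded_real f -> (forall g, 0 <= f g)%R -> (0 <= m f)%R,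
      m (fun=> 1%R) = 1%R &
      forall t f, bounded_real f -> m (fun g => f (t * g)) = m f].

Definition unitary_character (chi : Gam -> Cplx R) :=
  (forall g, `|chi g| = 1%R) /\
  forall g h, chi (g * h) = ((chi g : R[i]) * chi h)%R.

Definition ore_semigroup (P : set Gam) :=
  [/\ P 1, forall a b, P a -> P b -> P (a * b),
      forall g, exists a b, [/\ P a, P b & g = a * b^-1] &
      forall g, exists a b, [/\ P a, P b & g = a^-1 * b]].

End Groups.

Section TransformationGroupoid.
Variables (X : topologicalType) (Gam : groupType).
Variables (P : set Gam) (theta : Gam -> X -> X).
Local Open Scope group_scope.

(* Only the maps theta a with a in P matter. *)
Definition injective_action :=
  [/\ forall a, P a -> [/\ continuous (theta a), injective (theta a) &
        forall U : set X, open U -> open (theta a @` U)],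
      forall a b, P a -> P b -> theta a \o theta b = theta (b * a) &
      theta 1 = id].

Definition act_dom (x : X) (g : Gam) := exists a b y,
  [/\ P a, P b, g = a * b^-1 & theta a x = theta b y].

Definition act_spec (x : X) (g : Gam) : set X := [set y |
  forall a b, P a -> P b -> g = a * b^-1 -> theta a x = theta b y].

Definition act_pt (x : X) (g : Gam) : X := xget x (act_spec x g).

(* As a type, the set below carries the relative topology of the product of X
   and the discrete space Gam. *)
Definition tgpd : set (X * discrete_topology Gam)%type :=
  [set p | act_dom p.1 p.2].

Implicit Types gamma : tgpd.

Definition cocycle gamma : Gam := (\val gamma).2.

(* The default value of insubd is never reached under the hypotheses of
   val_ginv and val_gmul below. *)
Definition ginv gamma : tgpd :=
  insubd gamma (act_pt (\val gamma).1 (cocycle gamma), (cocycle gamma)^-1).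

(* Meaningful only when the source of gamma is the range of gamma'. *)
Definition gmul gamma gamma' : tgpd :=
  insubd gamma ((\val gamma).1, cocycle gamma * cocycle gamma').

Definition gsrc gamma := gmul (ginv gamma) gamma.
Definition grng gamma := gmul gamma (ginv gamma).
Definition gunits : set tgpd := range grng.

Hypothesis Pore : ore_semigroup P.
Hypothesis actP : injective_action.

Lemma act_comp a b z : P a -> P b -> theta b (theta a z) = theta (a * b) z.
Proof. by case: actP => _ thM _ Pa Pb; rewrite -thM. Qed.

Lemma act_inj b y z : P b -> theta b y = theta b z -> y = z.
Proof. by case: actP => thP _ _ /thP[_ inj _]; exact: inj. Qed.

Lemma oreM a b : P a -> P b -> P (a * b).
Proof. by case: Pore => _ + _ _; exact. Qed.

Lemma act_compat x y a b c d : P a -> P b -> P c -> P d ->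
  a * b^-1 = c * d^-1 -> theta a x = theta b y -> theta c x = theta d y.
Proof.
move=> Pa Pb Pc Pd abcd xy.
have [p [q [Pp Pq bdpq]]] : exists p q, [/\ P p, P q & b^-1 * d = p * q^-1].
  by case: Pore => _ _ + _; exact.
have dq : d * q = b * p by rewrite -(mulVKg b d) bdpq -!mulgA mulVg mulg1.
have cq : c * q = a * p.
  by rewrite -(mulgVK d c) -abcd -!mulgA dq mulKg.
by apply: (act_inj Pq); rewrite !act_comp// cq dq -!act_comp// xy.
Qed.

Lemma act_ptE x y a b : P a -> P b -> theta a x = theta b y ->
  act_pt x (a * b^-1) = y.
Proof.
move=> Pa Pb xy; apply: xget_unique => [c d Pc Pd abcd|z /(_ a b Pa Pb erefl)].
  exact: act_compat abcd xy.
by rewrite xy => /esym; exact: act_inj.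
Qed.

Lemma act_domP x g : act_dom x g ->
  exists a b, [/\ P a, P b, g = a * b^-1 & theta a x = theta b (act_pt x g)].
Proof.
by move=> [a [b [y [Pa Pb -> xy]]]]; exists a, b; rewrite (act_ptE Pa Pb xy).
Qed.

Lemma act_ptP x g a b : act_dom x g -> P a -> P b -> g = a * b^-1 ->
  theta a x = theta b (act_pt x g).
Proof.
move=> xg Pa Pb gab; have [c [d [Pc Pd gcd xy]]] := act_domP xg.
by apply: act_compat xy => //; rewrite -gcd.
Qed.

Lemma act_domV x g : act_dom x g ->
  act_dom (act_pt x g) g^-1 /\ act_pt (act_pt x g) g^-1 = x.
Proof.
move=> /act_domP[a [b [Pa Pb gab xy]]].
have -> : g^-1 = b * a^-1 by rewrite gab invgF.
by split; [exists b, a, x | exact: act_ptE].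
Qed.

Lemma act_domM x g h : act_dom x g -> act_dom (act_pt x g) h ->
  act_dom x (g * h) /\ act_pt x (g * h) = act_pt (act_pt x g) h.
Proof.
move=> xg yh; have [a [b [Pa Pb gab xy]]] := act_domP xg.
have [c [d [Pc Pd hcd yz]]] := act_domP yh.
move: (act_pt x g) (act_pt _ h) => y z in xy yz *.
have [p [q [Pp Pq bcpq]]] : exists p q, [/\ P p, P q & b^-1 * c = p * q^-1].
  by case: Pore => _ _ + _; exact.
have cq : c * q = b * p by rewrite -(mulVKg b c) bcpq -!mulgA mulVg mulg1.
have -> : g * h = (a * p) * (d * q)^-1.
  by rewrite gab hcd invgM -!mulgA (mulgA b^-1) bcpq -!mulgA.
have xz : theta (a * p) x = theta (d * q) z.
  by rewrite -!act_comp// xy -yz !act_comp// cq.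
have [Pap Pdq] := (oreM Pa Pp, oreM Pd Pq).
by split; [exists (a * p), (d * q), z | exact: act_ptE].
Qed.

Lemma tgpdP gamma : act_dom (\val gamma).1 (cocycle gamma).
Proof. exact: (set_mem (valP gamma)). Qed.

Lemma val_ginv gamma :
  \val (ginv gamma) = (act_pt (\val gamma).1 (cocycle gamma), (cocycle gamma)^-1).
Proof.
rewrite /ginv insubdK//; apply/mem_set; rewrite /tgpd /=.
exact: (act_domV (tgpdP gamma)).1.
Qed.

Lemma val_gmul gamma gamma' :
  (\val gamma').1 = act_pt (\val gamma).1 (cocycle gamma) ->
  \val (gmul gamma gamma') = ((\val gamma).1, cocycle gamma * cocycle gamma').
Proof.
move=> comp; rewrite /gmul insubdK//; apply/mem_set; rewrite /tgpd /=.
by apply: (act_domM (tgpdP gamma) _).1; rewrite -comp; exact: tgpdP.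
Qed.

Lemma val_gsrc gamma :
  \val (gsrc gamma) = (act_pt (\val gamma).1 (cocycle gamma), 1).
Proof.
rewrite val_gmul /cocycle val_ginv /= ?mulVg//.
by rewrite (act_domV (tgpdP gamma)).2.
Qed.

Lemma val_grng gamma : \val (grng gamma) = ((\val gamma).1, 1).
Proof. by rewrite val_gmul /cocycle val_ginv//= mulgV. Qed.

End TransformationGroupoid.

Arguments gunits {X Gam} P theta _.

Section GroupoidCstar.
Variables (R : realType) (X : topologicalType) (Gam : groupType).
Variables (P : set Gam) (theta : Gam -> X -> X).
Local Notation G := (tgpd P theta).
Local Notation C := (Cplx R).
Local Notation op := (ell2 R G -> ell2 R G).
Implicit Types (f b : G -> C) (S T : op) (M : set op) (chi : Gam -> C).

Definition supp f : set G := closure [set gamma | f gamma != 0].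

Definition Cc f := continuous f /\ compact (supp f).

(* C_0 of the unit space, whose elements are extended by zero to G. *)
Definition C0_units b :=
  [/\ {within gunits P theta, continuous b},
      forall gamma, ~ gunits P theta gamma -> b gamma = 0 &
      forall eps : R, 0 < eps -> exists K : set G,
        [/\ K `<=` gunits P theta, compact K &
            forall gamma, gunits P theta gamma -> ~ K gamma ->
              `|b gamma| < (eps%:C)%C]].

(* T is the direct sum of the operators Ind_u(f) over all units u, acting on
   l^2(G), the direct sum of the spaces l^2(s^-1(u)); its norm is the supremum
   of the norms of the Ind_u(f). The sum below has finitely many nonzero terms
   when f is in C_c(G), and at most one when f vanishes off the units. *)
Definition is_regular_rep f T := bounded_op T /\
  forall (xi : ell2 R G) gamma,
    T xi gamma = \sum_(gamma' \in [set gamma' | gsrc gamma' = gsrc gamma])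
      (f (gmul gamma (ginv gamma')) : R[i]) * xi gamma'.

(* The reduced C*-algebra of G: its product is composition. *)
Definition groupoid_cstar : set op :=
  opclosure [set T | exists2 f, Cc f & is_regular_rep f T].

Definition diagonal : set op :=
  [set T | exists2 b, C0_units b & is_regular_rep b T].

(* The function on G identified with T. If T represents f in C_c(G), the value
   at gamma is f(gamma s(gamma)^-1) = f(gamma); T |-> coef T gamma is linear
   and bounded by the norm, so this extends the inclusion of C_c(G) in C_0(G)
   to its completion. *)
Definition coef T (gamma : G) : C := T (basis_vec (gsrc gamma)) gamma.

Definition diagonal_bimodule M :=
  [/\ M `<=` groupoid_cstar,
      M 0 /\ (forall (c : C) S T, M S -> M T -> M (c *: S + T)),
      opclosure M `<=` M &
      forall S D, M S -> diagonal D -> M (S \o D) /\ M (D \o S)].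

Definition sigma M : set G := [set gamma | exists2 T, M T & coef T gamma != 0].

Definition spectral_subspace (Q : set G) : set op :=
  [set T | groupoid_cstar T /\ forall gamma, ~ Q gamma -> coef T gamma = 0].

Definition spectral M := M = spectral_subspace (sigma M).

(* An element of the reduced C*-algebra is determined by its function, so the
   T' below is the image of T under the automorphism given by chi. *)
Definition alpha_invariant M := forall chi, unitary_character chi ->
  forall T, M T -> exists2 T', M T' &
    forall gamma, coef T' gamma = (chi (cocycle gamma) : R[i]) * coef T gamma.

Local Notation op2 :=
  (ell2 R (G * Gam)%type -> ell2 R (G * Gam)%type).

Definition target_cstar : set op2 := closed_tensor groupoid_cstar (@group_cstar R Gam).

(* The values of delta outside the reduced C*-algebra of G are irrelevant. *)
Definition is_delta (delta : op -> op2) :=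
  [/\ (forall T, groupoid_cstar T -> target_cstar (delta T)) /\
      (forall (c : C) S T, groupoid_cstar S -> groupoid_cstar T ->
        delta (c *: S + T) = c *: delta S + delta T),
      forall S T, groupoid_cstar S -> groupoid_cstar T ->
        delta (S \o T) = delta S \o delta T,
      forall S T, groupoid_cstar S -> groupoid_cstar T ->
        adjoint_ops S T -> adjoint_ops (delta S) (delta T),
      opclosure (opspan [set U | exists S V,
        [/\ groupoid_cstar S, target_cstar V & U = delta S \o V]])
        = target_cstar &
      forall (t : Gam) f T, Cc f -> supp f `<=` [set gamma | cocycle gamma = t] ->
        is_regular_rep f T -> is_tensor T (@left_regular R Gam t) (delta T)].

Definition delta_invariant (delta : op -> op2) M :=
  forall T, M T -> closed_tensor M (@group_cstar R Gam) (delta T).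

End GroupoidCstar.

(* Main.v *)
Require Import Defs.
From HB Require Import structures.
From mathcomp Require Import all_boot all_order all_algebra finmap.
From mathcomp Require Import all_classical all_reals all_analysis.
From mathcomp Require Import complex ring lra.
From mathcomp Require summability.
Set Implicit Arguments.
Unset Strict Implicit.
Unset Printing Implicit Defensive.
Import Order.TTheory GRing.Theory Num.Theory.
Import numFieldNormedType.Exports.
Import ComplexField.Normc.
Local Open Scope classical_set_scope.
Local Open Scope ring_scope.

(** An operator on l^2(G) has a coefficient function on each slice c = t, which is
    an open subset of X. Cutting T down to the slice gives its Fourier component
    [Fourier t T], the weighted shift xi |-> ((x, g) |-> F x * xi (x.t, t^-1 g))
    with F the coefficient; its norm is at most the supremum of |F|. It is again
    in the C*-algebra, which is the closed span of the weighted shifts with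
    compactly supported coefficients ([groupoid_cstarE]). The theorem is reduced
    to one statement ([spectral_FourierP]): M is spectral if and only if M is
    stable under all the maps [Fourier t]. It rests on two facts.

    First, T is a limit of combinations of its Fourier components
    ([Fourier_approx]). Amenability gives finitely supported unit vectors w of
    l^2(Gam) that are almost invariant ([almost_invariant_vector], by Day's
    convexity argument). The Schur multiplier with symbol t |-> <lambda_t w, w> is
    a contraction ([Fejer_opb]) and tends to the identity as w becomes invariant.
    Second, on a single slice a diagonal bimodule is an ideal of functions, hence
    contains every C_0 function that vanishes where all its members do
    ([Fourier_in_bimodule]).

    It remains to compare stability under [Fourier t] with the invariance of M.
    In the abelian case the dual action multiplies the t-th component by chi t,
    which settles one direction. Conversely, characters separate points
    ([character_separates]), so averages of powers of characters yield contractive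
    multipliers that preserve M, are 1 at t and small on any finite set of other
    elements ([good_concentrate]); these multipliers tend to [Fourier t].
    In the nonabelian case delta, being a *-homomorphism between C*-algebras, is
    bounded ([delta_opb]), so delta sends [Fourier t T] to its tensor product with
    lambda_t ([delta_Fourier]). Hence a slice map of delta T is [Fourier t T]
    ([slice_map_delta]), which gives one direction, and the approximation of T by
    its components gives the other. *)

(** * The modulus and square-summable families *)

Section Modulus.
Variable R : realType.
Implicit Types z w : Cplx R.

Lemma sqmodE z : sqmod z = normc z ^+ 2.
Proof. by case: z => a b; rewrite /= sqr_sqrtr// addr_ge0 ?sqr_ge0. Qed.

Lemma normc_ge0 z : 0 <= normc z.
Proof. by case: z => a b; exact: sqrtr_ge0. Qed.

Lemma normcE_norm z : `|z| = (normc z)%:C%C.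
Proof. by []. Qed.

Lemma normcB z w : normc (z - w) = normc (w - z).
Proof. by rewrite -normcN opprB. Qed.

Lemma normc_real (x : R) : 0 <= x -> normc (x%:C)%C = x.
Proof. by move=> x0; rewrite /= expr0n addr0 sqrtr_sqr ger0_norm. Qed.

Lemma normc_sum (I : Type) (r : seq I) (P : pred I) (F : I -> Cplx R) :
  normc (\sum_(i <- r | P i) F i) <= \sum_(i <- r | P i) normc (F i).
Proof.
elim/big_ind2: _ => [|x y z w xy zw|//]; first by rewrite normc0.
by apply: le_trans (le_normcD _ _) _; exact: lerD.
Qed.

Lemma normcJ_eq z : normc (z^*)%C = normc z.
Proof. by case: z => a b; rewrite /= sqrrN. Qed.

Lemma normcX z n : normc ((z : R[i]) ^+ n) = normc z ^+ n.
Proof. by elim: n => [|n IH]; rewrite ?expr0 ?normc1// !exprS normcM IH. Qed.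

Lemma normc_root1 z n : (0 < n)%N -> normc ((z : R[i]) ^+ n) = 1 -> normc z = 1.
Proof.
move=> n0; rewrite normcX => e; have := @pexpIrn R n n0 (normc z) 1.
by rewrite !nnegrE normc_ge0 ler01 expr1n => /(_ isT isT e).
Qed.

End Modulus.

Section SquareSum.
Variables (R : realType) (I : choiceType).
Local Notation H := (ell2 R I).
Implicit Types xi eta : H.

Lemma ge0_esumZl (c : R) (a : I -> \bar R) : 0 <= c ->
  (forall i, (0 <= a i)%E) ->
  (\esum_(i in [set: I]) (c%:E * a i) = c%:E * \esum_(i in [set: I]) a i)%E.
Proof.
move=> c0 a0; have le_Z (d : R) (b : I -> \bar R) : 0 <= d ->
    (forall i, (0 <= b i)%E) ->
    (\esum_(i in [set: I]) (d%:E * b i) <= d%:E * \esum_(i in [set: I]) b i)%E.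
  move=> d0 b0; apply: ge_ereal_sup => _ [A finA <-].
  rewrite -ge0_mule_fsumr//; apply: lee_wpmul2l; first by rewrite lee_fin.
  by apply: ereal_sup_ubound; exists A.
have [->|cN0] := eqVneq c 0.
  rewrite mul0e esum1// => i _; exact: mul0e.
have {}c0 : 0 < c by rewrite lt_neqAle eq_sym cN0.
apply/eqP; rewrite eq_le le_Z ?(ltW c0)//=.
have := @le_Z c^-1 (fun i => (c%:E * a i)%E).
rewrite invr_ge0 (ltW c0) => /(_ isT).
have -> : (fun i => c^-1%:E * (c%:E * a i))%E = a.
  by apply/funext => i; rewrite muleA -EFinM mulVf// mul1e.
move=> h; have {}h := h (fun i => mule_ge0 (ltW c0 : (0 <= c%:E)%E) (a0 i)).
apply: le_trans (lee_wpmul2l _ h) _; first by rewrite lee_fin ltW.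
by rewrite muleA -EFinM mulfV// mul1e.
Qed.

Lemma sqmodE_ge0 (f : I -> Cplx R) i : (0 <= (sqmod (f i))%:E)%E.
Proof. by rewrite lee_fin sqmod_ge0. Qed.

Lemma ell2P xi : (sqsum xi < +oo)%E.
Proof. by case: xi => f /= /asboolP. Qed.

Lemma l2norm_ge0 xi : 0 <= l2norm xi.
Proof. exact: sqrtr_ge0. Qed.

Lemma l2norm_sqr xi : ((l2norm xi) ^+ 2)%:E = sqsum xi.
Proof.
rewrite /l2norm sqr_sqrtr ?fine_ge0 ?sqsum_ge0// fineK//.
by rewrite ge0_fin_numE ?sqsum_ge0 ?ell2P.
Qed.

Lemma l2norm_leP xi (K : R) : 0 <= K ->
  (l2norm xi <= K) = (sqsum xi <= (K ^+ 2)%:E)%E.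
Proof.
by move=> K0; rewrite -l2norm_sqr lee_fin ler_pXn2r ?nnegrE ?l2norm_ge0.
Qed.

Lemma ell2_eq xi eta : (forall i, xi i = eta i) -> xi = eta.
Proof. by move=> e; apply: val_inj; apply/funext => i; exact: e. Qed.

Lemma ell2D xi eta i : (xi + eta) i = xi i + eta i. Proof. by []. Qed.
Lemma ell2B xi eta i : (xi - eta) i = xi i - eta i. Proof. by []. Qed.
Lemma ell2Z (c : Cplx R) xi i : (c *: xi) i = (c : R[i]) * xi i.
Proof. by []. Qed.
Lemma ell2_sum (J : Type) (r : seq J) (P : pred J) (F : J -> H) i :
  (\sum_(j <- r | P j) F j) i = \sum_(j <- r | P j) F j i.
Proof. by elim/big_ind2: _ => // x1 x2 y1 y2 <- <-. Qed.

Lemma normc_le_l2norm xi i : normc (xi i) <= l2norm xi.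
Proof.
rewrite -(@ler_pXn2r _ 2)// ?nnegrE ?normc_ge0 ?l2norm_ge0//.
rewrite -sqmodE -lee_fin l2norm_sqr.
rewrite -(@esum_set1 _ _ i (fun j => (sqmod (xi j))%:E)) ?sqmodE_ge0//.
rewrite /sqsum (esumID [set i] [set: I]); last by move=> j _; exact: sqmodE_ge0.
rewrite setTI leeDl//; apply: esum_ge0 => j _; exact: sqmodE_ge0.
Qed.

Lemma l2norm0 : l2norm (0 : H) = 0.
Proof.
apply/eqP; rewrite eq_le l2norm_ge0 andbT l2norm_leP// /sqsum esum1.
  by rewrite lee_fin expr0n.
by move=> i _; rewrite /= sqmod0.
Qed.

Lemma l2norm_eq0 xi : l2norm xi = 0 -> xi = 0.
Proof.
move=> xi0; apply: ell2_eq => i; apply: eq0_normc.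
by apply/eqP; rewrite eq_le normc_ge0 andbT -xi0 normc_le_l2norm.
Qed.

Lemma l2normZ (c : Cplx R) xi : l2norm (c *: xi) = normc c * l2norm xi.
Proof.
have h : (l2norm (c *: xi)) ^+ 2 = (normc c * l2norm xi) ^+ 2.
  apply: EFin_inj; rewrite l2norm_sqr exprMn EFinM l2norm_sqr /sqsum -sqmodE.
  rewrite -ge0_esumZl ?sqmod_ge0//; last by move=> i; exact: sqmodE_ge0.
  by apply: eq_esum => i _; rewrite /= -EFinM -sqmodM.
by apply: (pexpIrn (n := 2)) h;
  rewrite ?nnegrE ?mulr_ge0 ?normc_ge0 ?l2norm_ge0.
Qed.

Lemma l2normN xi : l2norm (- xi) = l2norm xi.
Proof. by rewrite -scaleN1r l2normZ normcN normc1 mul1r. Qed.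

(** Minkowski's inequality, from the elementary bound
    (x + y)^2 <= (1 + b / a) x^2 + (1 + a / b) y^2 in which a and b are the
    two norms: summing it gives (a + b)^2. *)
Lemma l2norm_triangle xi eta : l2norm (xi + eta) <= l2norm xi + l2norm eta.
Proof.
have [xi0|xiN0] := eqVneq (l2norm xi) 0.
  by rewrite (l2norm_eq0 xi0) add0r l2norm0 add0r.
have [eta0|etaN0] := eqVneq (l2norm eta) 0.
  by rewrite (l2norm_eq0 eta0) addr0 l2norm0 addr0.
set a := l2norm xi in xiN0 *; set b := l2norm eta in etaN0 *.
have a0 : 0 < a by rewrite lt_neqAle eq_sym xiN0 l2norm_ge0.
have b0 : 0 < b by rewrite lt_neqAle eq_sym etaN0 l2norm_ge0.
rewrite l2norm_leP; last by rewrite addr_ge0 ?ltW.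
have -> : (a + b) ^+ 2 = (1 + b / a) * a ^+ 2 + (1 + a / b) * b ^+ 2.
  by field; rewrite xiN0 etaN0.
have ab0 : 0 <= 1 + b / a by rewrite addr_ge0// divr_ge0 ?ltW.
have ba0 : 0 <= 1 + a / b by rewrite addr_ge0// divr_ge0 ?ltW.
rewrite EFinD (EFinM (1 + b / a)) (EFinM (1 + a / b)) !l2norm_sqr /sqsum.
rewrite -!ge0_esumZl//; try by move=> i; exact: sqmodE_ge0.
rewrite -esumD; [|by move=> i _; rewrite mule_ge0 ?lee_fin ?sqmod_ge0..].
apply: le_esum => i _; rewrite -!EFinM -EFinD lee_fin ell2D !sqmodE.
set x := normc (xi i); set y := normc (eta i).
apply: (@le_trans _ _ ((x + y) ^+ 2)).
  by rewrite ler_pXn2r ?nnegrE ?addr_ge0 ?normc_ge0 ?le_normcD.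
rewrite -subr_ge0.
have -> : (1 + b / a) * x ^+ 2 + (1 + a / b) * y ^+ 2 - (x + y) ^+ 2 =
  a / b * (b / a * x - y) ^+ 2 by field; rewrite xiN0 etaN0.
by rewrite mulr_ge0 ?sqr_ge0// divr_ge0 ?ltW.
Qed.

Lemma sqsum_le (f : I -> Cplx R) (K : R) :
  (forall A : {fset I}, \sum_(i <- A) sqmod (f i) <= K) ->
  (sqsum f <= K%:E)%E.
Proof.
move=> h; apply: ge_ereal_sup => _ [A [finA _] <-].
by rewrite fsbig_finite//= sumEFin lee_fin.
Qed.

Lemma sum_sqmod_le xi (A : {fset I}) :
  \sum_(i <- A) sqmod (xi i) <= l2norm xi ^+ 2.
Proof.
rewrite -lee_fin l2norm_sqr -sumEFin.
apply: ereal_sup_ubound; exists [set` A] => //=.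
by rewrite fsbig_finite//= set_fsetK.
Qed.

Lemma insub_ell2 (f : I -> Cplx R) i : (sqsum f < +oo)%E ->
  insubd (0 : H) f i = f i.
Proof. by move=> foo; rewrite -[in LHS]/(\val _ i) insubdK//;
  exact/asboolP. Qed.

End SquareSum.

(** * Bounded operators on l^2 *)

Section Linear.
Variables (R : realType) (I J : choiceType).
Variables (T : ell2 R I -> ell2 R J) (linT : linear T).

Lemma lin0 : T 0 = 0.
Proof. by have := linT (-1) 0 0; rewrite scaler0 addr0 scaleN1r addNr. Qed.

Lemma linD u v : T (u + v) = T u + T v.
Proof. by have := linT 1 u v; rewrite !scale1r. Qed.

Lemma linZ c u : T (c *: u) = c *: T u.
Proof. by have := linT c u 0; rewrite !addr0 lin0 addr0. Qed.

Lemma linB u v : T (u - v) = T u - T v.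
Proof. by rewrite -scaleN1r addrC linT scaleN1r addrC. Qed.

End Linear.

Section Operators.
Variables (R : realType) (I : choiceType).
Local Notation H := (ell2 R I).
Implicit Types (S T : H -> H) (A B : set (H -> H)).

(** Bounds are handled as such: operator norms are extended reals, and only an
    upper bound is ever at stake. *)
Definition opb T (K : R) := forall xi, l2norm (T xi) <= K * l2norm xi.

Lemma opb_le T (K L : R) : K <= L -> opb T K -> opb T L.
Proof.
by move=> KL TK xi; apply: le_trans (TK xi) _; rewrite ler_wpM2r ?l2norm_ge0.
Qed.

Lemma opnorm_leP T (K : R) : linear T -> 0 <= K ->
  (opnorm T <= K%:E)%E <-> opb T K.
Proof.
move=> linT K0; split=> [TK xi|TK]; last first.
  apply: ge_ereal_sup => _ [xi xi1 <-]; rewrite lee_fin.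
  by apply: le_trans (TK xi) _; rewrite ler_piMr.
have [xi0|xiN0] := eqVneq (l2norm xi) 0.
  by rewrite (l2norm_eq0 xi0) lin0// l2norm0 mulr0.
have xi0 : 0 < l2norm xi by rewrite lt_neqAle eq_sym xiN0 l2norm_ge0.
pose c : Cplx R := ((l2norm xi)^-1)%:C%C.
have nc : normc c = (l2norm xi)^-1 by rewrite normc_real// invr_ge0 ltW.
have : l2norm (T (c *: xi)) <= K.
  rewrite -lee_fin; apply: le_trans TK; apply: ereal_sup_ubound.
  by exists (c *: xi) => //=; rewrite l2normZ nc mulVf.
by rewrite linZ// l2normZ nc mulrC ler_pdivrMr.
Qed.

Lemma bounded_linear T : bounded_op T -> linear T. Proof. by case. Qed.

Lemma bounded_opb T : bounded_op T -> exists2 K, 0 <= K & opb T K.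
Proof.
move=> [_ [K TK]]; exists (Num.max K 0); first by rewrite le_max lexx orbT.
by apply: (opb_le _ TK); rewrite le_max lexx.
Qed.

Lemma opb0 : opb (0 : H -> H) 0.
Proof. by move=> xi; rewrite mul0r /= l2norm0. Qed.

Lemma opbD S T K L : opb S K -> opb T L -> opb (S + T) (K + L).
Proof.
move=> SK TL xi; apply: le_trans (l2norm_triangle _ _) _.
by rewrite mulrDl lerD.
Qed.

Lemma opbZ (c : Cplx R) T K : opb T K -> opb (c *: T) (normc c * K).
Proof.
by move=> TK xi; rewrite [l2norm _]l2normZ -mulrA ler_wpM2l ?normc_ge0.
Qed.

Lemma opbN T K : opb T K -> opb (- T) K.
Proof. by move=> TK xi; rewrite [l2norm _]l2normN. Qed.

Lemma opbC S T K : opb (S - T) K -> opb (T - S) K.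
Proof. by rewrite -[T - S]opprB => /opbN. Qed.

Lemma opb_trans S T U K L : opb (S - T) K -> opb (T - U) L -> opb (S - U) (K + L).
Proof. by move=> ST TU; have := opbD ST TU; rewrite addrA subrK. Qed.

Lemma opb_comp S T K L : 0 <= K -> opb S K -> opb T L -> opb (S \o T) (K * L).
Proof.
by move=> K0 SK TL xi; apply: le_trans (SK _) _; rewrite -mulrA ler_wpM2l.
Qed.

Lemma opb_sum (J : Type) (r : seq J) (P : pred J) (F : J -> H -> H) (K : J -> R) :
  (forall j, P j -> opb (F j) (K j)) ->
  opb (\sum_(j <- r | P j) F j) (\sum_(j <- r | P j) K j).
Proof.
move=> FK; elim/big_rec2: _ => [|j S L Pj SL]; first exact: opb0.
by apply: opbD => //; exact: FK.
Qed.

Lemma opDE S T u : (S + T) u = S u + T u. Proof. by []. Qed.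
Lemma opBE S T u : (S - T) u = S u - T u. Proof. by []. Qed.
Lemma opZE (c : Cplx R) T u : (c *: T) u = c *: T u. Proof. by []. Qed.

Lemma opsumE (J : Type) (r : seq J) (P : pred J) (F : J -> H -> H) u :
  (\sum_(j <- r | P j) F j) u = \sum_(j <- r | P j) F j u.
Proof. by elim/big_ind2: _ => // x1 x2 y1 y2 <- <-. Qed.

Lemma linear0 : linear (0 : H -> H).
Proof. by move=> c u v /=; rewrite scaler0 addr0. Qed.

Lemma linearD S T : linear S -> linear T -> linear (S + T).
Proof.
move=> lS lT c u v.
change (S (c *: u + v) + T (c *: u + v) = c *: (S u + T u) + (S v + T v)).
by rewrite lS lT scalerDr addrACA.
Qed.

Lemma linearZ_op (d : Cplx R) T : linear T -> linear (d *: T).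
Proof.
move=> lT c u v.
change (d *: T (c *: u + v) = c *: (d *: T u) + d *: T v).
by rewrite lT scalerDr !scalerA mulrC.
Qed.

Lemma linearN T : linear T -> linear (- T).
Proof.
move=> lT c u v; change (- T (c *: u + v) = c *: (- T u) + - T v).
by rewrite lT scalerN opprD.
Qed.

Lemma linearB S T : linear S -> linear T -> linear (S - T).
Proof. by move=> lS lT; apply: linearD => //; exact: linearN. Qed.

Lemma linear_comp S T : linear S -> linear T -> linear (S \o T).
Proof. by move=> lS lT c u v; rewrite /= lT lS. Qed.

Lemma bounded0 : bounded_op (0 : H -> H).
Proof. by split; [exact: linear0 | exists 0; exact: opb0]. Qed.

Lemma boundedD S T : bounded_op S -> bounded_op T -> bounded_op (S + T).
Proof.
move=> [lS [K SK]] [lT [L TL]]; split; first exact: linearD.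
by exists (K + L); exact: opbD.
Qed.

Lemma boundedZ c T : bounded_op T -> bounded_op (c *: T).
Proof.
move=> [lT [L TL]]; split; first exact: linearZ_op.
by exists (normc c * L); exact: opbZ.
Qed.

Lemma boundedN T : bounded_op T -> bounded_op (- T).
Proof.
move=> [lT [L TL]]; split; first exact: linearN.
by exists L; exact: opbN.
Qed.

Lemma boundedB S T : bounded_op S -> bounded_op T -> bounded_op (S - T).
Proof. by move=> bS bT; apply: boundedD => //; exact: boundedN. Qed.

Lemma bounded_comp S T : bounded_op S -> bounded_op T -> bounded_op (S \o T).
Proof.
move=> /[dup] bS [lS _] [lT [L TL]]; split; first exact: linear_comp.
by have [K K0 SK] := bounded_opb bS; exists (K * L); exact: opb_comp.
Qed.

Lemma bounded_sum (J : Type) (r : seq J) (P : pred J) (F : J -> H -> H) :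
  (forall j, P j -> bounded_op (F j)) -> bounded_op (\sum_(j <- r | P j) F j).
Proof.
move=> bF; elim/big_rec: _ => [|j S Pj bS]; first exact: bounded0.
by apply: boundedD => //; exact: bF.
Qed.

Lemma opb_small_eq0 T : (forall eps : R, 0 < eps -> opb T eps) -> T = 0.
Proof.
move=> T0; apply/funext => xi; apply: l2norm_eq0; apply/eqP.
rewrite eq_le l2norm_ge0 andbT; apply/ler_addgt0Pr => e e0; rewrite add0r.
have xi1 : 0 < l2norm xi + 1 by rewrite ltr_wpDl ?l2norm_ge0.
apply: le_trans (T0 (e / (l2norm xi + 1)) _ xi) _; first exact: divr_gt0.
by rewrite mulrAC ler_pdivrMr// ler_wpM2l ?ltW// ltrDl.
Qed.

(** For a set of bounded operators, membership in the closure can be tested on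
    bounds instead of operator norms. *)
Lemma opclosureP A T : A `<=` @bounded_op R I ->
  opclosure A T <-> bounded_op T /\
    forall eps : R, 0 < eps -> exists2 S, A S & opb (T - S) eps.
Proof.
move=> bA; split=> -[bT clT]; split=> // e e0; have [S AS TS] := clT e e0;
  exists S => //; have lTS := linearB (bounded_linear bT)
    (bounded_linear (bA _ AS)); by apply/(opnorm_leP lTS (ltW e0)).
Qed.

Lemma opclosure_bounded A : opclosure A `<=` @bounded_op R I.
Proof. by move=> T []. Qed.

Lemma sub_opclosure A : A `<=` @bounded_op R I -> A `<=` opclosure A.
Proof.
move=> bA T AT; apply/(opclosureP _ bA); split; first exact: bA.
by move=> e e0; exists T => //; rewrite subrr; apply: opb_le opb0; exact: ltW.
Qed.

Lemma opclosureS A B : B `<=` @bounded_op R I -> A `<=` opclosure B ->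
  opclosure A `<=` opclosure B.
Proof.
move=> bB AB T; have bA : A `<=` @bounded_op R I by move=> S /AB[].
move=> /(opclosureP _ bA)[bT clT]; apply/(opclosureP _ bB); split=> // e e0.
have e20 : 0 < e / 2 by exact: divr_gt0.
have [S AS TS] := clT _ e20; have := AB _ AS => /(opclosureP _ bB)[_ clS].
have [U BU SU] := clS _ e20; exists U => //.
by rewrite [e in opb _ e]splitr; exact: opb_trans TS SU.
Qed.

Lemma opclosure_mono A B : A `<=` B -> opclosure A `<=` opclosure B.
Proof.
move=> AB T [bT h]; split=> // e e0; have [S AS TS] := h e e0.
by exists S => //; exact: AB.
Qed.

Lemma opclosureD A S T : A `<=` @bounded_op R I ->
  (forall S T, A S -> A T -> A (S + T)) ->
  opclosure A S -> opclosure A T -> opclosure A (S + T).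
Proof.
move=> bA AD /(opclosureP _ bA)[bS clS] /(opclosureP _ bA)[bT clT].
apply/(opclosureP _ bA); split=> [|e e0]; first exact: boundedD.
have e20 : 0 < e / 2 by exact: divr_gt0.
have [S' AS SS] := clS _ e20; have [T' AT TT] := clT _ e20.
exists (S' + T'); first exact: AD.
by rewrite [e in opb _ e]splitr opprD addrACA; exact: opbD.
Qed.

Lemma opclosureZ A c T : A `<=` @bounded_op R I ->
  (forall c T, A T -> A (c *: T)) -> opclosure A T -> opclosure A (c *: T).
Proof.
move=> bA AZ /(opclosureP _ bA)[bT clT].
apply/(opclosureP _ bA); split=> [|e e0]; first exact: boundedZ.
have c0 : 0 < normc c + 1 by rewrite ltr_wpDl ?normc_ge0.
have [T' AT TT] := clT _ (divr_gt0 e0 c0); exists (c *: T'); first exact: AZ.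
rewrite -scalerBr; apply: opb_le (opbZ c TT).
by rewrite mulrCA ler_piMr ?ltW// ltr_pdivrMr// mul1r ltrDl.
Qed.

End Operators.

(** ** Completeness *)

Section ScalarCauchy.
Variable R : realType.
Variable e : nat -> R.
Hypothesis e_small : forall d : R, 0 < d -> exists n, e n < d.

Lemma real_cauchy (x : nat -> R) :
  (forall n m, (n <= m)%N -> `|x m - x n| <= e n) ->
  exists l, forall n, `|l - x n| <= e n.
Proof.
move=> xe; pose E := [set x n - e n | n in [set: nat]].
have ub m : ubound E (x m + e m).
  move=> _ [n _ <-]; have := xe n _ (leq_maxl n m).
  have := xe m _ (leq_maxr n m); rewrite !ler_norml.
  by move=> /andP[_ h1] /andP[h2 _]; lra.
exists (sup E) => n; rewrite ler_norml; apply/andP; split.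
  rewrite lerBrDl; apply: sup_upper_bound; last by exists n.
  by split; [exists (x 0%N - e 0%N), 0%N | exists (x 0%N + e 0%N)].
rewrite lerBlDl; apply: ge_sup => //; by exists (x 0%N - e 0%N), 0%N.
Qed.

Lemma le_of_tail (a b : R) : (forall m, a <= b + 3 * e m) -> a <= b.
Proof.
move=> h; apply/ler_addgt0Pr => d d0.
have [m em] := e_small (divr_gt0 d0 (ltr0Sn R 2)).
by apply: le_trans (h m) _; rewrite lerD2l mulrC -ler_pdivlMr// ltW.
Qed.

Lemma complex_cauchy (z : nat -> Cplx R) :
  (forall n m, (n <= m)%N -> normc (z m - z n) <= e n) ->
  exists l : Cplx R, forall n, normc (l - z n) <= e n.
Proof.
move=> ze.
have Re_le (w : R[i]) : `|complex.Re w| <= normc w.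
  by case: w => a b /=; rewrite -sqrtr_sqr ler_wsqrtr// lerDl sqr_ge0.
have Im_le (w : R[i]) : `|complex.Im w| <= normc w.
  by case: w => a b /=; rewrite -sqrtr_sqr ler_wsqrtr// lerDr sqr_ge0.
have [|a aP] := @real_cauchy (fun n => complex.Re (z n : R[i])).
  move=> n m nm; apply: le_trans (ze n m nm); apply: le_trans (Re_le _).
  by case: (z m) (z n) => [? ?] [? ?].
have [|b bP] := @real_cauchy (fun n => complex.Im (z n : R[i])).
  move=> n m nm; apply: le_trans (ze n m nm); apply: le_trans (Im_le _).
  by case: (z m) (z n) => [? ?] [? ?].
have le2 (w : R[i]) : normc w <= `|complex.Re w| + `|complex.Im w|.
  case: w => x y /=; rewrite -(@ler_pXn2r _ 2)// ?nnegrE ?sqrtr_ge0 ?addr_ge0//.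
  rewrite sqr_sqrtr ?addr_ge0 ?sqr_ge0// sqrrD !real_normK ?num_real//.
  by rewrite lerD2r lerDl mulrn_wge0// mulr_ge0.
exists (Complex a b) => n; apply: le_of_tail => m.
pose k := maxn n m.
have l2 j : normc ((Complex a b : Cplx R) - z j) <= 2 * e j.
  apply: le_trans (le2 _) _; rewrite mulr_natl mulr2n; move: (aP j) (bP j).
  by case: (z j) => x y /=; exact: lerD.
have nk : (n <= k)%N by exact: leq_maxl.
have mk : (m <= k)%N by exact: leq_maxr.
have -> : (Complex a b : Cplx R) - z n =
  ((Complex a b : Cplx R) - z m) + (z m - z k) + (z k - z n).
  by rewrite !addrA !subrK.
apply: le_trans (le_normcD _ _) _; rewrite addrC lerD ?ze//.
apply: le_trans (le_normcD _ _) _.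
have -> : 3 * e m = 2 * e m + e m by ring.
by apply: lerD; [exact: l2 | rewrite normcB; exact: ze].
Qed.

End ScalarCauchy.

Section Completeness.
Variables (R : realType) (I : choiceType).
Local Notation H := (ell2 R I).
Variable e : nat -> R.
Hypothesis e_small : forall d : R, 0 < d -> exists n, e n < d.

(** Coordinatewise limits are enough: the bound on the distance to the limit
    survives on each finite set of coordinates, hence for the whole norm. *)
Lemma ell2_cauchy (v : nat -> H) (K : R) : 0 <= K ->
  (forall n, 0 <= e n) ->
  (forall n m, (n <= m)%N -> l2norm (v m - v n) <= K * e n) ->
  exists l : H, forall n, l2norm (l - v n) <= K * e n.
Proof.
move=> K0 e0 vK.
have small d : 0 < d -> exists n, K * e n < d.
  move=> d0; have K1 : 0 < K + 1 by rewrite ltr_wpDl.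
  have [n en] := e_small (divr_gt0 d0 K1); exists n.
  apply: (@le_lt_trans _ _ ((K + 1) * e n)); first by rewrite ler_wpM2r// lerDl.
  by rewrite mulrC -ltr_pdivlMr.
have /choice[f fP] i : exists l : Cplx R, forall n, normc (l - v n i) <= K * e n.
  apply: (@complex_cauchy _ (fun n => K * e n)) => // n m nm.
  exact: le_trans (normc_le_l2norm (v m - v n) i) (vK n m nm).
have fn n : (sqsum (fun i => f i - v n i : Cplx R)%R <= ((K * e n) ^+ 2)%:E)%E.
  apply: sqsum_le => A; apply/ler_addgt0Pr => d d0.
  pose N : R := #|`A|%:R + 1.
  have N0 : 0 < N by rewrite ltr_wpDl.
  pose E := K * e n; have E0 : 0 <= E by rewrite mulr_ge0.
  have D0 : 0 < N * (4 * (1 + E)) by rewrite !mulr_gt0// ltr_wpDr.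
  pose c := Num.min 1 (d / (N * (4 * (1 + E)))).
  have c0 : 0 < c by rewrite lt_min ltr01 divr_gt0.
  have c1 : c <= 1 by rewrite ge_min lexx.
  have cd : N * (4 * c * (1 + E)) <= d.
    rewrite (_ : N * _ = c * (N * (4 * (1 + E)))); last by ring.
    by rewrite -ler_pdivlMr// ge_min lexx orbT.
  have [m em] := small c c0; pose k := maxn n m.
  have fk i : normc (f i - v k i) <= 2 * c.
    rewrite (_ : f i - v k i = (f i - v m i) + (v m i - v k i)); last first.
      by rewrite addrA subrK.
    apply: le_trans (le_normcD _ _) _; rewrite mulr_natl mulr2n; apply: lerD.
      exact: le_trans (fP i m) (ltW em).
    rewrite normcB; apply: le_trans (normc_le_l2norm (v k - v m) i) _.
    by apply: le_trans _ (ltW em); apply: vK; exact: leq_maxr.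
  have vkn : l2norm (v k - v n) <= E by apply: vK; exact: leq_maxl.
  have term i : sqmod (f i - v n i : Cplx R) <=
      sqmod ((v k - v n) i) + 4 * c * (1 + E).
    rewrite !sqmodE; set y := normc ((v k - v n) i).
    have y0 : 0 <= y by exact: normc_ge0.
    have yE : y <= E by exact: le_trans (normc_le_l2norm _ _) vkn.
    apply: (@le_trans _ _ ((2 * c + y) ^+ 2)).
      rewrite ler_pXn2r ?nnegrE ?addr_ge0 ?mulr_ge0 ?normc_ge0 ?(ltW c0)//.
      rewrite (_ : f i - v n i = (f i - v k i) + (v k i - v n i)); last first.
        by rewrite addrA subrK.
      by apply: le_trans (le_normcD _ _) _; apply: lerD.
    have cc : c * c <= c by rewrite ler_piMr// ltW.
    have cy : c * y <= c * E by rewrite ler_wpM2l// ltW.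
    rewrite -subr_ge0 (_ : _ - _ = 4 * (c - c * c) + 4 * (c * E - c * y)).
      by rewrite addr_ge0// mulr_ge0// subr_ge0.
    by ring.
  apply: le_trans (ler_sum _ (fun i _ => term i)) _.
  rewrite big_split /=; apply: lerD.
    apply: le_trans (sum_sqmod_le (v k - v n) A) _.
    by rewrite ler_pXn2r ?nnegrE ?l2norm_ge0.
  rewrite big_const_seq count_predT iter_addr_0 -[X in X <= _]mulr_natl.
  apply: le_trans cd; apply: ler_wpM2r; last by rewrite lerDl.
  by rewrite !mulr_ge0 ?addr_ge0 ?(ltW c0).
have foo : (sqsum f < +oo)%E.
  have -> : f = (fun i => f i - v 0%N i : Cplx R) + (v 0%N : I -> Cplx R).
    by apply/funext => i /=; rewrite subrK.
  apply: sqsumD; last exact: ell2P.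
  by apply: le_lt_trans (fn 0%N) _; exact: ltry.
exists (insubd 0 f) => n; rewrite l2norm_leP ?mulr_ge0//.
apply: le_trans (fn n); rewrite le_eqVlt; apply/orP; left; apply/eqP.
by congr sqsum; apply/funext => i; rewrite ell2B insub_ell2.
Qed.

(** The limit is taken vector by vector; linearity and the rate e pass to each
    pointwise limit. *)
Lemma op_cauchy (T : nat -> H -> H) : (forall n, 0 <= e n) ->
  (forall n, bounded_op (T n)) ->
  (forall n m, (n <= m)%N -> opb (T m - T n) (e n)) ->
  exists2 S, bounded_op S & forall n, opb (S - T n) (e n).
Proof.
move=> e0 bT Te.
have /choice[S SP] xi : exists l : H, forall n,
    l2norm (l - T n xi) <= l2norm xi * e n.
  apply: (@ell2_cauchy (T ^~ xi)) => //; first exact: l2norm_ge0.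
  by move=> n m nm; rewrite mulrC; exact: Te.
have Se n : opb (S - T n) (e n) by move=> xi; rewrite mulrC; exact: SP.
have linS : linear S.
  move=> c u v; apply/eqP; rewrite -subr_eq0; apply/eqP/l2norm_eq0/eqP.
  rewrite eq_le l2norm_ge0 andbT; apply/ler_addgt0Pr => d d0; rewrite add0r.
  pose K := l2norm (c *: u + v) + normc c * l2norm u + l2norm v.
  have K0 : 0 <= K by rewrite !addr_ge0 ?mulr_ge0 ?normc_ge0 ?l2norm_ge0.
  have K1 : 0 < K + 1 by rewrite ltr_wpDl.
  have [n en] := e_small (divr_gt0 d0 K1).
  have -> : S (c *: u + v) - (c *: S u + S v) =
    (S (c *: u + v) - T n (c *: u + v)) -
      (c *: (S u - T n u) + (S v - T n v)).
    rewrite (bounded_linear (bT n)) scalerBr addrACA -opprD.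
    by rewrite [in RHS]opprB addrA subrK.
  apply: (@le_trans _ _ (K * e n)); last first.
    apply: (@le_trans _ _ ((K + 1) * e n)).
      by rewrite ler_wpM2r// lerDl.
    by rewrite mulrC -ler_pdivlMr// ltW.
  apply: le_trans (l2norm_triangle _ _) _; rewrite l2normN.
  rewrite /K -addrA mulrDl; apply: lerD; first exact: SP.
  apply: le_trans (l2norm_triangle _ _) _; rewrite l2normZ mulrDl -mulrA.
  by apply: lerD; [rewrite ler_wpM2l ?normc_ge0//; exact: SP | exact: SP].
exists S => //; split=> //; have [_ [K TK]] := bT 0%N.
exists (e 0%N + K) => xi; rewrite -[S xi](subrK (T 0%N xi)) mulrDl.
apply: le_trans (l2norm_triangle _ _) _.
by apply: lerD; [exact: Se | exact: TK].
Qed.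

End Completeness.

(** * The inner product of l^2 *)

Section UnconditionalSum.
Variables (R : realType) (I : choiceType).
Implicit Types (u v : I -> Cplx R) (l : Cplx R).

Definition has_sum u l := forall eps : R, 0 < eps ->
  exists A : {fset I}, forall B : {fset I}, (A `<=` B)%fset ->
    normc (\sum_(i <- B) u i - l) <= eps.

Lemma normc_small_eq0 (z : Cplx R) :
  (forall eps : R, 0 < eps -> normc z <= eps) -> z = 0.
Proof.
move=> h; apply: eq0_normc; apply/eqP; rewrite eq_le normc_ge0 andbT.
by apply/ler_addgt0Pr => d d0; rewrite add0r h.
Qed.

Lemma has_sum_uniq u l m : has_sum u l -> has_sum u m -> l = m.
Proof.
move=> ul um; apply/eqP; rewrite -subr_eq0; apply/eqP/normc_small_eq0 => e e0.
have e2 : 0 < e / 2 by exact: divr_gt0.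
have [A hA] := ul _ e2; have [B hB] := um _ e2.
have -> : l - m = (l - \sum_(i <- (A `|` B)%fset) u i) +
  (\sum_(i <- (A `|` B)%fset) u i - m) by rewrite addrA subrK.
apply: le_trans (le_normcD _ _) _; rewrite [e]splitr normcB.
by apply: lerD; [apply: hA; exact: fsubsetUl | apply: hB; exact: fsubsetUr].
Qed.

Lemma has_sumD u v l m : has_sum u l -> has_sum v m ->
  has_sum (fun i => u i + v i) (l + m).
Proof.
move=> ul um e e0; have e2 : 0 < e / 2 by exact: divr_gt0.
have [A hA] := ul _ e2; have [B hB] := um _ e2.
exists (A `|` B)%fset => D; rewrite fsubUset => /andP[AD BD].
rewrite big_split /= opprD addrACA; apply: le_trans (le_normcD _ _) _.
by rewrite [e]splitr lerD ?hA ?hB.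
Qed.

Lemma has_sumZ (c : Cplx R) u l : has_sum u l ->
  has_sum (fun i => (c : R[i]) * u i) ((c : R[i]) * l).
Proof.
move=> ul e e0; have c0 : 0 < normc c + 1 by rewrite ltr_wpDl ?normc_ge0.
have [A hA] := ul _ (divr_gt0 e0 c0); exists A => B AB.
rewrite -mulr_sumr -mulrBr normcM.
apply: (@le_trans _ _ (normc c * (e / (normc c + 1)))).
  by rewrite ler_wpM2l ?normc_ge0// hA.
by rewrite mulrCA ler_piMr ?ltW// ltr_pdivrMr// mul1r ltrDl.
Qed.

Lemma has_sum_conj u l : has_sum u l -> has_sum (fun i => (u i)^*%C) (l^*%C).
Proof.
move=> ul e e0; have [A hA] := ul _ e0; exists A => B AB.
by rewrite -(rmorph_sum (@conjc R)) -rmorphB normcJ_eq hA.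
Qed.

Lemma has_sum_le u l (K : R) : has_sum u l ->
  (forall A : {fset I}, \sum_(i <- A) normc (u i) <= K) -> normc l <= K.
Proof.
move=> ul uK; apply/ler_addgt0Pr => e e0; have [A hA] := ul _ e0.
rewrite -[l](subrK (\sum_(i <- A) u i)) addrC.
apply: le_trans (le_normcD _ _) _; apply: lerD; last by rewrite normcB hA.
by apply: le_trans (normc_sum _ _ _) _; exact: uK.
Qed.

Lemma fset_filter_sub (A B : {fset I}) : (A `<=` B)%fset ->
  [fset x | x in B & x \in A]%fset = A.
Proof.
move=> AB; apply/fsetP => x; rewrite !inE /= andbC.
by case: (boolP (x \in A)) => // /(fsubsetP AB) ->.
Qed.

(** Finite sets whose absolute sums come close to the supremum give a Cauchy
    sequence of partial sums. *)
Lemma has_sum_abs u (K : R) :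
  (forall A : {fset I}, \sum_(i <- A) normc (u i) <= K) ->
  exists l, has_sum u l.
Proof.
move=> uK; pose w (A : {fset I}) := \sum_(i <- A) normc (u i).
have supw : has_sup (range w).
  by split; [exists (w fset0), fset0 | exists K => _ [A _ <-]; exact: uK].
pose s := sup (range w).
have ws A : w A <= s by apply: sup_upper_bound => //; exists A.
pose e n : R := n.+1%:R^-1.
have e0 n : 0 < e n by rewrite invr_gt0.
have /choice[A hA] n : exists A, s - e n < w A.
  by have [_ [A _ <-] h] := sup_adherent (e0 n) supw; exists A.
have wB n B : (A n `<=` B)%fset ->
    normc (\sum_(i <- B) u i - \sum_(i <- A n) u i) <= e n.
  move=> AB; rewrite (big_fsetID _ (mem (A n)) B)/=.
  rewrite (fset_filter_sub AB).
  rewrite addrAC subrr add0r; apply: le_trans (normc_sum _ _ _) _.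
  have := ws B; rewrite {1}/w (big_fsetID _ (mem (A n)) B)/=.
  rewrite (fset_filter_sub AB).
  by have := hA n; rewrite /w => h1 h2; lra.
have e_small (d : R) : 0 < d -> exists n, 2 * e n < d.
  move=> d0; have d2 : 0 < 2 / d by exact: divr_gt0.
  exists (Num.trunc (2 / d)); rewrite /e ltr_pdivrMr// mulrC -ltr_pdivrMr//.
  by have := truncnS_gt (2 / d).
have [|l lP] := @complex_cauchy R (fun n => 2 * e n) e_small
  (fun n => \sum_(i <- A n) u i).
  move=> n m nm; pose B := (A n `|` A m)%fset.
  rewrite -[X in X - _](subrK (\sum_(i <- B) u i)) -addrA.
  apply: le_trans (le_normcD _ _) _; rewrite mulr_natl mulr2n; apply: lerD.
    rewrite normcB; apply: le_trans (wB m B (fsubsetUr _ _)) _.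
    by rewrite lef_pV2 ?posrE// ler_nat.
  exact: wB (fsubsetUl _ _).
exists l => d d0; have [n en] := e_small (d / 2) (divr_gt0 d0 (ltr0Sn R 1)).
exists (A n) => B AB; rewrite -[X in X - _](subrK (\sum_(i <- A n) u i)) -addrA.
apply: le_trans (le_normcD _ _) _; rewrite [d]splitr; apply: lerD.
  apply: le_trans (wB n B AB) _; apply: le_trans (ltW en).
  by rewrite ler_peMl ?(ltW (e0 n))// ler1n.
by rewrite normcB; apply: le_trans (lP n) (ltW en).
Qed.

Lemma has_sum_sum u l : has_sum u l -> summability.sum u = l.
Proof.
move=> ul; have totF := @summability.totally_filter I.
apply: norm_cvg_lim; apply/cvgrPdist_le => e e0.
have [d -> {e e0} d0] : exists2 d : R, e = (d%:C)%C & 0 < d.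
  by move: e0; case: e => a b; rewrite ltcE /= => /andP[/eqP -> a0]; exists a.
have [A hA] := ul d d0; exists A => // B /= AB.
rewrite normcE_norm lecR normcB /summability.partial_sum.
by rewrite -(big_seq_fsetE _ B xpredT u)/= ; exact: hA.
Qed.

End UnconditionalSum.

Section Inner.
Variables (R : realType) (I : choiceType).
Local Notation H := (ell2 R I).
Implicit Types xi eta zeta : H.

Lemma sum_normcM_le xi eta (t : R) (A : {fset I}) : 0 < t ->
  \sum_(i <- A) normc ((xi i : R[i]) * ((eta i : R[i])^*)%C) <=
  (t * l2norm xi ^+ 2 + t^-1 * l2norm eta ^+ 2) / 2.
Proof.
move=> t0; apply: (@le_trans _ _ (\sum_(i <- A)
    ((t * sqmod (xi i) + t^-1 * sqmod (eta i)) / 2))).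
  apply: ler_sum => i _; rewrite normcM normcJ_eq !sqmodE.
  set x := normc _; set y := normc _; rewrite ler_pdivlMr// -subr_ge0.
  have -> : t * x ^+ 2 + t^-1 * y ^+ 2 - x * y * 2 = t^-1 * (t * x - y) ^+ 2.
    by field; rewrite gt_eqF.
  by rewrite mulr_ge0 ?sqr_ge0// invr_ge0 ltW.
rewrite -mulr_suml ler_pM2r ?invr_gt0// big_split /= -!mulr_sumr.
by apply: lerD; rewrite ler_wpM2l ?invr_ge0 ?(ltW t0)// sum_sqmod_le.
Qed.

Lemma innerP xi eta :
  has_sum (fun i => (xi i : R[i]) * ((eta i : R[i])^*)%C : Cplx R) (inner xi eta).
Proof.
have [l hl] := has_sum_abs (fun A => @sum_normcM_le xi eta 1 A ltr01).
by rewrite /inner (has_sum_sum hl).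
Qed.

Lemma innerDl xi eta zeta : inner (xi + eta) zeta = inner xi zeta + inner eta zeta.
Proof.
apply: has_sum_uniq (innerP _ _) _.
have := has_sumD (innerP xi zeta) (innerP eta zeta).
by under eq_fun do rewrite -mulrDl.
Qed.

Lemma innerZl (c : Cplx R) xi zeta : inner (c *: xi) zeta = (c : R[i]) * inner xi zeta.
Proof.
apply: has_sum_uniq (innerP _ _) _.
have := has_sumZ c (innerP xi zeta).
by under eq_fun do rewrite mulrA.
Qed.

Lemma conjc_mulJ (z w : R[i]) : conjc (z * conjc w) = w * conjc z.
Proof. by case: z w => [a b] [c d]; congr Complex => /=; ring. Qed.

Lemma conjcD (z w : R[i]) : conjc (z + w) = conjc z + conjc w.
Proof. exact: rmorphD. Qed.
Lemma conjcM (z w : R[i]) : conjc (z * w) = conjc z * conjc w.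
Proof. exact: rmorphM. Qed.
Lemma conjcN (z : R[i]) : conjc (- z) = - conjc z.
Proof. exact: rmorphN. Qed.

Lemma innerC xi eta : inner eta xi = ((inner xi eta)^*)%C.
Proof.
apply: has_sum_uniq (innerP _ _) _.
have := has_sum_conj (innerP xi eta).
by under eq_fun do rewrite conjc_mulJ.
Qed.

Lemma innerDr xi eta zeta : inner zeta (xi + eta) = inner zeta xi + inner zeta eta.
Proof. by rewrite innerC innerDl conjcD -!innerC. Qed.

Lemma innerZr (c : Cplx R) xi zeta :
  inner zeta (c *: xi) = ((c : R[i])^*)%C * inner zeta xi.
Proof. by rewrite innerC innerZl conjcM -innerC. Qed.

Lemma innerNl xi zeta : inner (- xi) zeta = - inner xi zeta.
Proof. by rewrite -scaleN1r innerZl mulN1r. Qed.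

Lemma innerNr xi zeta : inner zeta (- xi) = - inner zeta xi.
Proof. by rewrite innerC innerNl conjcN -innerC. Qed.

Lemma innerxx xi : inner xi xi = ((l2norm xi ^+ 2)%:C)%C.
Proof.
apply: has_sum_uniq (innerP _ _) _ => e e0.
have : (sqsum xi - e%:E < sqsum xi)%E.
  by rewrite -l2norm_sqr -EFinD lte_fin gtrDl oppr_lt0.
move=> /ereal_sup_gt[_ [S [finS _] <-]].
rewrite fsbig_finite//= -l2norm_sqr sumEFin -EFinD lte_fin => hS.
exists (fset_set S) => B SB.
have -> : \sum_(i <- B) ((xi i : R[i]) * ((xi i : R[i])^*)%C) =
    ((\sum_(i <- B) sqmod (xi i))%:C)%C.
  rewrite rmorph_sum; apply: eq_bigr => i _.
  by rewrite -sqr_normc normcE_norm sqmodE rmorphXn.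
have -> (x y : R) : normc ((x%:C)%C - (y%:C)%C : Cplx R) = `|x - y|.
  by rewrite /= subrr expr0n addr0 sqrtr_sqr.
rewrite distrC ger0_norm ?subr_ge0 ?sum_sqmod_le//.
rewrite lerBlDr -lerBlDl; apply: le_trans (ltW hS) _.
rewrite (big_fsetID _ (mem (fset_set S)) B)/=.
by rewrite (fset_filter_sub SB) lerDl sumr_ge0// => i _; exact: sqmod_ge0.
Qed.

(** Cauchy-Schwarz: 2 |x y| <= t |x|^2 + t^-1 |y|^2 is summed over the
    coordinates, t being the ratio of the two norms. *)
Lemma inner_le xi eta : normc (inner xi eta) <= l2norm xi * l2norm eta.
Proof.
have [xi0|xiN0] := eqVneq (l2norm xi) 0.
  rewrite (l2norm_eq0 xi0) l2norm0 mul0r.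
  by rewrite -(scale0r (0 : H)) innerZl mul0r normc0.
have [eta0|etaN0] := eqVneq (l2norm eta) 0.
  rewrite (l2norm_eq0 eta0) l2norm0 mulr0.
  by rewrite -(scale0r (0 : H)) innerZr conjc0 mul0r normc0.
have x0 : 0 < l2norm xi by rewrite lt_neqAle eq_sym xiN0 l2norm_ge0.
have y0 : 0 < l2norm eta by rewrite lt_neqAle eq_sym etaN0 l2norm_ge0.
pose t := l2norm eta / l2norm xi; have t0 : 0 < t by exact: divr_gt0.
apply: le_trans (has_sum_le (innerP xi eta)
  (fun A => @sum_normcM_le xi eta t A t0)) _.
rewrite le_eqVlt; apply/orP; left; apply/eqP; rewrite /t.
by field; rewrite xiN0 etaN0.
Qed.

End Inner.

Section Adjoints.
Variables (R : realType) (I : choiceType).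
Local Notation H := (ell2 R I).
Implicit Types (S T : H -> H).

Lemma adjoint_opsC S T : adjoint_ops S T -> adjoint_ops T S.
Proof. by move=> ST xi eta; rewrite innerC -ST -innerC. Qed.

Lemma adjoint_opsD S T S' T' : adjoint_ops S T -> adjoint_ops S' T' ->
  adjoint_ops (S + S') (T + T').
Proof.
move=> ST ST' xi eta.
change (inner (S xi + S' xi) eta = inner xi (T eta + T' eta)).
by rewrite innerDl innerDr ST ST'.
Qed.

Lemma adjoint_opsZ (c : Cplx R) S T : adjoint_ops S T ->
  adjoint_ops (c *: S) ((c^*)%C *: T).
Proof.
move=> ST xi eta.
change (inner (c *: S xi) eta = inner xi ((c^*)%C *: T eta)).
by rewrite innerZl innerZr ST conjcK.
Qed.

Lemma adjoint_ops_comp S T S' T' : adjoint_ops S T -> adjoint_ops S' T' ->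
  adjoint_ops (S \o S') (T' \o T).
Proof. by move=> ST ST' xi eta; rewrite /= ST ST'. Qed.

Lemma adjoint_opb S T K : adjoint_ops S T -> 0 <= K -> opb S K -> opb T K.
Proof.
move=> ST K0 SK xi; have [T0|TN0] := eqVneq (l2norm (T xi)) 0.
  by rewrite T0 mulr_ge0 ?l2norm_ge0.
have T0 : 0 < l2norm (T xi) by rewrite lt_neqAle eq_sym TN0 l2norm_ge0.
rewrite -(ler_pM2l T0) -expr2.
have := innerxx (T xi); rewrite -ST => e.
have <- : normc (inner (S (T xi)) xi) = l2norm (T xi) ^+ 2.
  by rewrite e normc_real// sqr_ge0.
apply: le_trans (inner_le _ _) _; rewrite mulrA ler_wpM2r ?l2norm_ge0//.
by rewrite mulrC; exact: SK.
Qed.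

Lemma adjoint_ops_lim S T :
  (forall eps : R, 0 < eps -> exists S' T',
    [/\ adjoint_ops S' T', opb (S - S') eps & opb (T - T') eps]) ->
  adjoint_ops S T.
Proof.
move=> h xi eta; apply/eqP; rewrite -subr_eq0;
  apply/eqP/normc_small_eq0 => e e0.
pose K := 2 * (l2norm xi * l2norm eta) + 1.
have K0 : 0 < K by rewrite ltr_wpDl// !mulr_ge0 ?l2norm_ge0.
have [S' [T' [ST SS TT]]] := h _ (divr_gt0 e0 K0).
have -> : inner (S xi) eta - inner xi (T eta) =
  inner ((S - S') xi) eta - inner xi ((T - T') eta).
  change (inner (S xi) eta - inner xi (T eta) =
    inner (S xi - S' xi) eta - inner xi (T eta - T' eta)).
  by rewrite innerDl innerNl innerDr innerNr ST; ring.
apply: le_trans (le_normcD _ _) _; rewrite normcN.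
apply: (@le_trans _ _ (e / K * (2 * (l2norm xi * l2norm eta)))); last first.
  by rewrite mulrAC ler_pdivrMr// ler_wpM2l ?(ltW e0)// lerDl.
rewrite mulrCA mulr_natl mulr2n; apply: lerD.
  apply: le_trans (inner_le _ _) _; rewrite mulrA ler_wpM2r ?l2norm_ge0//.
apply: le_trans (inner_le _ _) _; rewrite mulrCA ler_wpM2l ?l2norm_ge0//.
Qed.

End Adjoints.

(** * Continuous complex functions *)

Section ComplexContinuity.
Variable R : realType.

Section Filters.
Variable Y : Type.
Implicit Types (f g : Y -> Cplx R).

(** Convergence is tested against real eps because `|z| is an element of
    R[i]. *)
Lemma cvg_complexP (F : set_system Y) (f : Y -> Cplx R) (l : Cplx R) : Filter F ->
  f @ F --> l <-> forall eps : R, 0 < eps -> F [set x | normc (l - f x) < eps].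
Proof.
move=> FF; split=> [/cvgrPdist_lt h e e0|h].
  have := h (e%:C)%C; rewrite ltcR => /(_ e0).
  by apply: filterS => x /=; rewrite normcE_norm ltcR.
apply/cvgrPdist_lt => e e0.
have [d -> {e e0} d0] : exists2 d : R, e = (d%:C)%C & 0 < d.
  by move: e0; case: e => a b; rewrite ltcE /= => /andP[/eqP -> a0]; exists a.
by apply: filterS (h d d0) => x /=; rewrite normcE_norm ltcR.
Qed.

Lemma cvgM_complex (F : set_system Y) f g (a b : Cplx R) : Filter F ->
  f @ F --> a -> g @ F --> b ->
  (fun x => (f x : R[i]) * g x : Cplx R) @ F --> ((a : R[i]) * b : Cplx R).
Proof. by move=> FF fa gb; exact: (@cvgZ R[i] R[i]^o _ F FF f g a b fa gb). Qed.

Lemma cvg_conjc (F : set_system Y) f (a : Cplx R) : Filter F ->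
  f @ F --> a -> (fun x => conjc (f x : R[i]) : Cplx R) @ F --> (conjc (a : R[i]) : Cplx R).
Proof.
move=> FF /cvg_complexP fa; apply/cvg_complexP => e e0.
apply: filterS (fa e e0) => x /=.
by rewrite -conjcN -conjcD normcJ_eq.
Qed.

Lemma cvgV_complex (F : set_system Y) f (a : Cplx R) : Filter F -> a != 0 ->
  f @ F --> a -> (fun x => ((f x : R[i])^-1) : Cplx R) @ F --> ((a : R[i])^-1 : Cplx R).
Proof. by move=> FF a0 fa; exact: (@cvgV R[i] _ F FF f a a0 fa). Qed.

End Filters.

Variable Y : topologicalType.
Implicit Types (f g : Y -> Cplx R) (y : Y).

Lemma near_normc_lt f y (e : R) : {for y, continuous f} -> normc (f y) < e ->
  nbhs y [set x | normc (f x) < e].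
Proof.
move=> cf fe; have e0 : 0 < e - normc (f y) by rewrite subr_gt0.
apply: filterS ((cvg_complexP _ _ _).1 cf _ e0) => x /=.
rewrite ltrBrDr; apply: le_lt_trans; rewrite normcB.
rewrite -{1}[f x](subrK (f y)); exact: le_normcD.
Qed.

Lemma near_normc_gt f y (e : R) : {for y, continuous f} -> e < normc (f y) ->
  nbhs y [set x | e < normc (f x)].
Proof.
move=> cf fe; have e0 : 0 < normc (f y) - e by rewrite subr_gt0.
apply: filterS ((cvg_complexP _ _ _).1 cf _ e0) => x /=.
rewrite ltrBrDr -ltrBrDl; move/lt_le_trans; apply.
rewrite lerBlDr -{1}[f y](subrK (f x)) addrC; exact: le_normcD.
Qed.

(** The complement of K is open because Y is Hausdorff, and f is 0 on it. *)
Lemma continuous_compact_support f (K : set Y) : hausdorff_space Y ->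
  compact K -> (forall y, ~ K y -> f y = 0) ->
  (forall y, K y -> {for y, continuous f}) -> continuous f.
Proof.
move=> hY cK f0 fK y; have [Ky|nKy] := pselect (K y); first exact: fK.
have oK : open (~` K) by rewrite openC; exact: compact_closed.
apply/cvg_complexP => e e0;
  apply: filterS (open_nbhs_nbhs (conj oK nKy)) => x nKx.
by rewrite /= !f0// subrr normc0.
Qed.

Lemma compact_bounded_complex f (K : set Y) : compact K -> continuous f ->
  exists2 B : R, 0 <= B & forall y, K y -> normc (f y) <= B.
Proof.
move=> /compact_near_coveringP cK cf.
have := cK nat \oo (fun n y => normc (f y) <= n%:R) _.
case=> [y Ky|n _ /(_ n) h].
  have [n hn] : exists n : nat, normc (f y) < n%:R.
    by have := truncnS_gt (normc (f y)); exists (Num.trunc (normc (f y))).+1.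
  exists ([set x | normc (f x) < n%:R], [set m | (n <= m)%N]) => /=.
    split; first exact: (near_normc_lt (cf y) hn).
    by exists n.
  move=> [x m] /= [fx nm]; apply: le_trans (ltW fx) _; by rewrite ler_nat.
by exists n%:R => // y Ky; apply: h => /=.
Qed.

End ComplexContinuity.

(** * Sums of nonnegative extended reals *)

Section ExtendedSums.
Variable R : realType.

Lemma esum_swap (I J : choiceType) (a : I -> J -> \bar R) :
  (forall i j, (0 <= a i j)%E) ->
  (\esum_(i in [set: I]) \esum_(j in [set: J]) a i j =
   \esum_(j in [set: J]) \esum_(i in [set: I]) a i j)%E.
Proof.
move=> a0; rewrite !esum_esum//.
rewrite (@reindex_esum R (J * I)%type (I * J)%type
  ([set: J] `*`` (fun=> [set: I])) _ (fun p => (p.2, p.1)))//.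
split=> [[j i] [_ _]//|[j i] [j' i'] _ _ [-> ->]//|[i j] _].
by exists (j, i).
Qed.

Lemma sum_le_esum (I : choiceType) (r : seq I) (a : I -> \bar R) : uniq r ->
  (forall i, (0 <= a i)%E) ->
  (\sum_(i <- r) a i <= \esum_(i in [set: I]) a i)%E.
Proof.
move=> ur a0; apply: ereal_sup_ubound; exists [set` r];
  last exact/esym/fsbig_seq.
by split=> //; exact: finite_seq.
Qed.

Lemma esum_fset_supp (I : choiceType) (B : {fset I}) (a : I -> \bar R) :
  (forall i, (0 <= a i)%E) -> (forall i, i \notin B -> a i = 0%E) ->
  (\esum_(i in [set: I]) a i = \sum_(i <- B) a i)%E.
Proof.
move=> a0 aB; apply/eqP; rewrite eq_le sum_le_esum ?fset_uniq// andbT.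
apply: ge_ereal_sup => _ [A [finA _] <-]; rewrite fsbig_finite//=.
rewrite (bigID (mem B)) /= [X in (_ + X)%E]big1 ?adde0; last by move=> i /aB.
rewrite -big_filter;
  apply: (@le_trans _ _ (\sum_(i <- [seq i <- B | i \in fset_set A]) a i)%E).
  rewrite le_eqVlt; apply/orP; left; apply/eqP; apply: perm_big.
  apply: uniq_perm; rewrite ?filter_uniq ?fset_uniq// => i.
  by rewrite !mem_filter andbC.
by rewrite big_filter [leRHS](bigID (mem (fset_set A))) /= leeDl// sume_ge0.
Qed.

End ExtendedSums.

(** * Tensor products of vectors and the group C*-algebra *)

Section Tensors.
Variables (R : realType) (I J : choiceType).
Implicit Types (xi : ell2 R I) (eta : ell2 R J).

Lemma tensor_vecE xi eta k : tensor_vec xi eta k = (xi k.1 : R[i]) * eta k.2.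
Proof. by []. Qed.

Lemma l2norm_tensor xi eta : l2norm (tensor_vec xi eta) = l2norm xi * l2norm eta.
Proof.
have h : l2norm (tensor_vec xi eta) ^+ 2 = (l2norm xi * l2norm eta) ^+ 2.
  apply: EFin_inj.
  have -> : ((l2norm xi * l2norm eta) ^+ 2)%:E = ((l2norm eta ^+ 2)%:E * sqsum xi)%E.
    by rewrite exprMn mulrC EFinM (l2norm_sqr xi).
  rewrite (l2norm_sqr (tensor_vec xi eta)) /sqsum.
  rewrite -ge0_esumZl ?sqr_ge0//; last by move=> i; exact: sqmodE_ge0.
  have -> : [set: I * J] = [set: I] `*`` (fun=> [set: J]) by apply/seteqP;
    split.
  under eq_esum do rewrite tensor_vecE sqmodM EFinM.
  rewrite -(@esum_esum _ _ _ [set: I] (fun=> [set: J])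
    (fun i j => (sqmod (xi i))%:E * (sqmod (eta j))%:E)%E); last first.
    by move=> i j _ _; rewrite mule_ge0 ?sqmodE_ge0.
  apply: eq_esum => i _; rewrite ge0_esumZl ?sqmod_ge0//; last first.
    by move=> j; exact: sqmodE_ge0.
  by rewrite -/(sqsum eta) -l2norm_sqr muleC.
by apply: (pexpIrn (n := 2)) h; rewrite ?nnegrE ?mulr_ge0 ?l2norm_ge0.
Qed.

End Tensors.

Section GroupCstar.
Variables (R : realType) (Gam : groupType).

Lemma left_regularE (t s : Gam) (xi : ell2 R Gam) : left_regular t xi s = xi (t^-1 * s)%g.
Proof. by []. Qed.

Lemma left_regular_bounded (t : Gam) : bounded_op (@left_regular R Gam t).
Proof.
split=> [c u v|]; first exact: ell2_eq.
exists 1 => xi; rewrite mul1r l2norm_leP ?l2norm_ge0// l2norm_sqr /sqsum.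
rewrite [leRHS](reindex_esum [set: Gam] _ (fun s => t^-1 * s)%g)//.
split => // [s r _ _ /mulgI //|s _].
by exists (t * s)%g => //; rewrite mulKg.
Qed.

Lemma opspan_bounded (I : choiceType) (A : set (ell2 R I -> ell2 R I)) :
  A `<=` @bounded_op R I -> opspan A `<=` @bounded_op R I.
Proof.
move=> bA _ [n [c [S [AS ->]]]]; apply: bounded_sum => k _.
by apply: boundedZ; apply: bA; exact: AS.
Qed.

Lemma opspan_sub (I : choiceType) (A : set (ell2 R I -> ell2 R I)) : A `<=` opspan A.
Proof.
move=> S AS; exists 1%N, (fun=> 1), (fun=> S); split=> //.
by rewrite big_ord1 scale1r.
Qed.

Lemma left_regular_cstar (t : Gam) : @group_cstar R Gam (left_regular t).
Proof.
apply: sub_opclosure; last by apply: opspan_sub; exists t.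
by apply: opspan_bounded => _ [s _ <-]; exact: left_regular_bounded.
Qed.

End GroupCstar.

(** * Amenability: Reiter's condition *)

Section Infima.
Variable R : realType.
Implicit Types (E : set R) (a : R).

Lemma inf_le E a b : lbound E b -> E a -> inf E <= a.
Proof. by move=> Eb; apply: inf_lbound; exists b. Qed.

End Infima.

Section HahnBanach.
Variables (R : realType) (V : lmodType R).
Implicit Types (p q : V -> R) (u v : V).

Definition sublinear p := (forall u v, p (u + v) <= p u + p v) /\
  forall (s : R) u, 0 <= s -> p (s *: u) = s * p u.

Lemma sublinear0 p : sublinear p -> p 0 = 0.
Proof. by move=> [_ pZ]; rewrite -(scale0r (0 : V)) pZ// mul0r. Qed.

Lemma sublinear_ge p u : sublinear p -> - p (- u) <= p u.
Proof.
move=> sp; have := sp.1 u (- u); rewrite subrr sublinear0// => h.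
by rewrite -subr_ge0 opprK.
Qed.

(** Homogeneity follows from one inequality, by rescaling back. *)
Lemma sublinearP p : (forall u v, p (u + v) <= p u + p v) -> p 0 = 0 ->
  (forall (s : R) u, 0 < s -> p (s *: u) <= s * p u) -> sublinear p.
Proof.
move=> pD p0 pZ; split=> // s u; rewrite le_eqVlt => /orP[/eqP <-|s0].
  by rewrite scale0r mul0r.
apply/eqP; rewrite eq_le pZ//= -ler_pdivlMl//.
have := pZ s^-1 (s *: u); rewrite invr_gt0 => /(_ s0).
by rewrite scalerA mulVf ?gt_eqF// scale1r.
Qed.

(** A minimal sublinear functional p is linear: for each v the functional
    u |-> inf_(s >= 0) (p (u + s v) - s p v) is sublinear and below p, hence
    equal to p, so that p u <= p (u + v) - p v. *)
Lemma sublinear_minimal_linear p : sublinear p ->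
  (forall p', sublinear p' -> (forall u, p' u <= p u) -> p' = p) ->
  forall u v, p (u + v) = p u + p v.
Proof.
move=> sp minp u v; have [pD pZ] := sp.
pose E u := [set p (u + s *: v) - s * p v | s in [set s : R | 0 <= s]].
have lbE u' : lbound (E u') (- p (- u')).
  move=> _ [s /= s0 <-]; rewrite -pZ//.
  have := pD (u' + s *: v) (- u'); rewrite addrAC subrr add0r.
  by lra.
have E0 u' : E u' !=set0 by exists (p (u' + 0 *: v) - 0 * p v), 0 => /=.
pose p' u := inf (E u).
have p'_le u' s : 0 <= s -> p' u' <= p (u' + s *: v) - s * p v.
  by move=> s0; apply: inf_le (lbE u') _; exists s.
have sp' : sublinear p'.
  apply: sublinearP => [a b||s a s0].
  - rewrite -lerBlDr; apply: lb_le_inf => // _ [s /= s0 <-].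
    rewrite lerBlDr -lerBlDl; apply: lb_le_inf => // _ [r /= r0 <-].
    rewrite lerBlDl; apply: le_trans (p'_le _ (s + r) _) _;
      first exact: addr_ge0.
    rewrite scalerDl addrACA; have := pD (a + s *: v) (b + r *: v); lra.
  - apply/eqP; rewrite eq_le; apply/andP; split.
      have := p'_le 0 0 (lexx _);
        by rewrite scale0r addr0 (sublinear0 sp) mul0r subr0.
    apply: lb_le_inf => // _ [s /= s0 <-]; by rewrite add0r pZ// subrr.
  rewrite -ler_pdivrMl//; apply: lb_le_inf => // _ [r /= r0 <-].
  rewrite ler_pdivrMl//; apply: le_trans (p'_le _ (s * r) _) _.
    by rewrite mulr_ge0// ltW.
  by rewrite -scalerA -scalerDr pZ ?(ltW s0)// mulrBr mulrA.
have p'p : p' = p.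
  apply: minp => // u'; have := p'_le u' 0 (lexx _).
  by rewrite scale0r addr0 mul0r subr0.
apply/eqP; rewrite eq_le pD /= -lerBrDr -{1}p'p.
by have := p'_le u 1 ler01; rewrite scale1r mul1r.
Qed.

(** The sublinear functionals below q have lower bounds of chains, so that a
    minimal one exists by Zorn's lemma. *)
Lemma hahn_banach q : sublinear q -> exists f : V -> R,
  [/\ forall u v, f (u + v) = f u + f v,
      forall (s : R) u, f (s *: u) = s * f u & forall u, f u <= q u].
Proof.
move=> sq; pose S := {p : V -> R | sublinear p /\ forall u, p u <= q u}.
pose le (p p' : S) := `[< forall u, sval p' u <= sval p u >].
have q0 : S by exists q.
have [||||[p [sp pq]] minp] := @Zorn S le.
- by move=> p; apply/asboolP.
- move=> a b c /asboolP ab /asboolP bc; apply/asboolP => u.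
  exact: le_trans (bc u) (ab u).
- move=> [a Pa] [b Pb] /asboolP /= ab /asboolP /= ba.
  have e : a = b by apply/funext => u; apply/eqP; rewrite eq_le ab ba.
  by move: Pa Pb ab ba; rewrite e => Pa Pb _ _; congr exist;
    exact: Prop_irrelevance.
- move=> A totA; have [[p1 Ap1]|nA] := pselect (A !=set0); last first.
    by exists q0 => s As; case: nA; exists s.
  pose E u := [set sval p u | p in A].
  have E0 u : E u !=set0 by exists (sval p1 u), p1.
  have lbE u : lbound (E u) (- q (- u)).
    move=> _ [[p [sp pq]] _ <-] /=.
    by apply: le_trans (sublinear_ge u sp); rewrite lerN2.
  pose p0 u := inf (E u).
  have p0_le (p : S) u : A p -> p0 u <= sval p u.
    by move=> Ap; apply: inf_le (lbE u) _; exists p.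
  have sp0 : sublinear p0.
    apply: sublinearP => [a b||s a s0].
    + rewrite -lerBlDr; apply: lb_le_inf => // _ [p Ap <-].
      rewrite lerBlDr -lerBlDl; apply: lb_le_inf => // _ [p' Ap' <-].
      rewrite lerBlDl; have [/asboolP h|/asboolP h] := totA _ _ Ap Ap'.
        apply: le_trans (p0_le p' _ Ap') _.
        apply: le_trans ((svalP p').1.1 a b) _; by rewrite lerD2r.
      apply: le_trans (p0_le p _ Ap) _.
      apply: le_trans ((svalP p).1.1 a b) _; by rewrite lerD2l.
    + apply/eqP; rewrite eq_le; apply/andP; split.
        by apply: le_trans (p0_le p1 _ Ap1) _; rewrite sublinear0//;
          exact: (svalP p1).1.
      by apply: lb_le_inf => // _ [p Ap <-]; rewrite sublinear0//;
        exact: (svalP p).1.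
    rewrite -ler_pdivrMl//; apply: lb_le_inf => // _ [p Ap <-].
    rewrite ler_pdivrMl//; apply: le_trans (p0_le p _ Ap) _.
    by rewrite (svalP p).1.2// ltW.
  have p0q u : p0 u <= q u by apply: le_trans (p0_le p1 u Ap1) _;
    exact: (svalP p1).2.
  by exists (exist _ p0 (conj sp0 p0q)) => p Ap; apply/asboolP => u;
    exact: p0_le.
have addp : forall u v, p (u + v) = p u + p v.
  apply: sublinear_minimal_linear => // p' sp' p'p.
  have p'q u : p' u <= q u by apply: le_trans (p'p u) (pq u).
  have e : (exist _ p' (conj sp' p'q) : S) = exist _ p (conj sp pq).
    by apply: minp; exact/asboolP.
  exact: (congr1 (fun s : S => sval s) e).
have oppp u : p (- u) = - p u.
  apply/eqP; rewrite -subr_eq0 opprK addrC -addp subrr; exact/eqP/sublinear0.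
exists p; split=> // s u; have [s0|s0] := leP 0 s; first exact: sp.2.
by rewrite -[s]opprK scaleNr oppp sp.2 ?mulNr// oppr_ge0 ltW.
Qed.

End HahnBanach.

(** ** The free real vector space on a set *)

Section FreeSpace.
Variables (R : realType) (J : choiceType).

Definition fspt_pred : {pred J -> R^o} := fun v => `[< finite_set [set j | v j != 0] >].

Lemma fspt_submod : submod_closed fspt_pred.
Proof.
split=> [|c u v /asboolP fu /asboolP fv]; apply/asboolP.
  by rewrite (_ : [set _ | _] = set0)//; apply/seteqP; split=> j //=;
    rewrite eqxx.
have fuv : finite_set ([set j | u j != 0] `|` [set j | v j != 0]).
  by rewrite finite_setU.
apply: sub_finite_set fuv.
move=> j /= nz; apply: contrapT => /not_orP[/negP + /negP].
rewrite !negbK => /eqP u0 /eqP v0; case/eqP: nz.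
by change (c * u j + v j = 0 :> R); rewrite u0 v0 mulr0 addr0.
Qed.

HB.instance Definition _ := GRing.isSubmodClosed.Build _ _ fspt_pred fspt_submod.

Record fspt := Fspt { fspt_fun :> J -> R^o; _ : fspt_fun \in fspt_pred }.

HB.instance Definition _ := [isSub for fspt_fun].
HB.instance Definition _ := [Choice of fspt by <:].
HB.instance Definition _ := [SubChoice_isSubLmodule of fspt by <:].

Implicit Types u v : fspt.

Definition fsupp v : {fset J} := fset_set [set j | v j != 0].

Lemma mem_fsupp v j : (j \in fsupp v) = (v j != 0).
Proof.
have /asboolP fv : fspt_fun v \in fspt_pred by case: v.
by rewrite /fsupp in_fset_set//; apply/idP/idP; rewrite inE.
Qed.

Definition l1 v : R := \sum_(j <- fsupp v) `|v j|.

Lemma l1E v (A : {fset J}) : (forall j, v j != 0 -> j \in A) ->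
  l1 v = \sum_(j <- A) `|v j|.
Proof.
move=> vA; rewrite [RHS](bigID (fun j => v j != 0)) /=.
rewrite [X in _ + X]big1 ?addr0; last by move=> j; rewrite negbK => /eqP ->;
  rewrite normr0.
rewrite -big_filter; apply: perm_big; apply: uniq_perm;
  rewrite ?filter_uniq ?fset_uniq//.
move=> j; rewrite mem_filter mem_fsupp.
by apply/idP/andP => [nz|[]//]; split=> //; exact: vA.
Qed.

Lemma l1_ge0 v : 0 <= l1 v. Proof. exact: sumr_ge0. Qed.

Lemma l1D u v : l1 (u + v) <= l1 u + l1 v.
Proof.
pose A := (fsupp u `|` fsupp v)%fset.
have uA j : u j != 0 -> j \in A by move=> h; rewrite inE mem_fsupp h.
have vA j : v j != 0 -> j \in A by move=> h; rewrite inE !mem_fsupp h orbT.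
have uvA j : (u + v) j != 0 -> j \in A.
  rewrite inE !mem_fsupp -negb_and; apply: contra => /andP[/eqP u0 /eqP v0].
  by apply/eqP; change (u j + v j = 0 :> R); rewrite u0 v0 addr0.
rewrite (l1E uA) (l1E vA) (l1E uvA) -big_split /=; apply: ler_sum => j _.
exact: ler_normD.
Qed.

Lemma l1Z (c : R) v : l1 (c *: v) = `|c| * l1 v.
Proof.
have vA j : (c *: v) j != 0 -> j \in fsupp v.
  rewrite mem_fsupp; apply: contra => /eqP v0.
  by apply/eqP; change (c * v j = 0 :> R); rewrite v0 mulr0.
rewrite (l1E vA) mulr_sumr; apply: eq_bigr => j _.
by change (`|c * v j| = `|c| * `|v j : R|); rewrite normrM.
Qed.

Lemma l1N v : l1 (- v) = l1 v.
Proof. by rewrite -scaleN1r l1Z normrN1 mul1r. Qed.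

Lemma fspt_basisP (i : J) : (fun j => (j == i)%:R : R^o) \in fspt_pred.
Proof.
apply/asboolP; rewrite (_ : [set _ | _] = [set i]); first exact: finite_set1.
apply/seteqP; split=> j /=; last by move=> ->; rewrite eqxx oner_neq0.
by have [//|ne] := eqVneq j i; rewrite eqxx.
Qed.

Definition fspt_basis i : fspt := Fspt (fspt_basisP i).

Lemma l1_basis i : l1 (fspt_basis i) = 1.
Proof.
rewrite (@l1E _ [fset i]%fset) => [|j /=]; last first.
  by rewrite inE; have [//|ne] := eqVneq j i; rewrite eqxx.
by rewrite big_seq_fset1 /= eqxx normr1.
Qed.

Lemma fspt_sumE (I : Type) (r : seq I) (F : I -> fspt) j :
  (\sum_(i <- r) F i) j = \sum_(i <- r) F i j.
Proof. by elim/big_ind2: _ => // x1 x2 y1 y2 <- <-. Qed.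

End FreeSpace.

Section Reiter.
Variables (R : realType) (Gam : groupType).
Hypothesis amen : amenable_group R Gam.
Variable T0 : {fset Gam}.
Local Notation V := (fspt R (Gam * Gam)%type).

(** The family of the vectors t.mu - mu of l^1(Gam) for t in T0, for mu the point
    mass at g. *)
Definition displacement (g : Gam) : V :=
  \sum_(t <- T0) (fspt_basis R (t, (t * g)%g) - fspt_basis R (t, g)).

Definition total_displacement (mu : seq (R * Gam)) : V :=
  \sum_(x <- mu) x.1 *: displacement x.2.

Definition mass (mu : seq (R * Gam)) : R := \sum_(x <- mu) x.1.

Definition nonneg (mu : seq (R * Gam)) := all (fun x => 0 <= x.1) mu.

Lemma nonneg_mass mu : nonneg mu -> 0 <= mass mu.
Proof.
by move=> /allP h; rewrite /mass big_seq sumr_ge0// => x /h.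
Qed.

(** Day's convexity argument. If no finitely supported density were almost
    invariant, the Hahn-Banach theorem would give bounded functions phi_t with
    sum_t (phi_t (t g) - phi_t g) >= eps for all g, which an invariant mean
    excludes. *)
Lemma almost_invariant_density (eps : R) : 0 < eps -> exists mu,
  [/\ nonneg mu, 0 < mass mu & l1 (total_displacement mu) < eps * mass mu].
Proof.
move=> eps0; apply: contrapT => none.
have large mu : nonneg mu -> eps * mass mu <= l1 (total_displacement mu).
  move=> pmu; have := nonneg_mass pmu; rewrite le_eqVlt => /orP[/eqP <-|mu0].
    by rewrite mulr0 l1_ge0.
  by rewrite leNgt; apply/negP => h; apply: none; exists mu.
pose E (v : V) := [set l1 (v + total_displacement mu) - eps * mass mu |
  mu in [set mu | nonneg mu]].
have E0 v : E v !=set0.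
  by exists (l1 (v + total_displacement [::]) - eps * mass [::]), [::].
have lbE v : lbound (E v) (- l1 v).
  move=> _ [mu pmu <-]; have := large mu pmu.
  have := l1D (v + total_displacement mu) (- v).
  by rewrite addrAC subrr add0r l1N; lra.
pose q v := inf (E v).
have q_le v mu : nonneg mu -> q v <= l1 (v + total_displacement mu) - eps * mass mu.
  by move=> pmu; apply: inf_le (lbE v) _; exists mu.
have q_l1 v : q v <= l1 v.
  have := q_le v [::] isT.
  by rewrite /total_displacement /mass !big_nil addr0 mulr0 subr0.
have sq : sublinear q.
  apply: sublinearP => [a b||s a s0].
  - rewrite -lerBlDr; apply: lb_le_inf => // _ [mu pmu <-].
    rewrite lerBlDr -lerBlDl; apply: lb_le_inf => // _ [nu pnu <-].
    rewrite lerBlDl; apply: le_trans (q_le _ (mu ++ nu) _) _.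
      by rewrite /nonneg all_cat; apply/andP.
    rewrite /total_displacement /mass !big_cat /= addrACA mulrDr.
    have := l1D (a + total_displacement mu) (b + total_displacement nu).
    by rewrite /total_displacement; lra.
  - apply/eqP; rewrite eq_le; apply/andP; split.
      apply: le_trans (q_l1 0) _.
      by rewrite -(scale0r (0 : V)) l1Z normr0 mul0r.
    apply: lb_le_inf => //; have := lbE 0.
    by rewrite -(scale0r (0 : V)) l1Z normr0 mul0r oppr0.
  rewrite -ler_pdivrMl//; apply: lb_le_inf => // _ [mu pmu <-].
  rewrite ler_pdivrMl//; pose nu := [seq (s * x.1, x.2) | x <- mu].
  apply: le_trans (q_le _ nu _) _.
    rewrite /nonneg all_map; apply: sub_all pmu => x /= x0.
    by rewrite mulr_ge0// ltW.
  have -> : total_displacement nu = s *: total_displacement mu.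
    rewrite /total_displacement big_map scaler_sumr; apply: eq_bigr => x _.
    by rewrite /= scalerA.
  have -> : mass nu = s * mass mu by rewrite /mass big_map mulr_sumr.
  by rewrite -scalerDr l1Z gtr0_norm// mulrBr (mulrCA s).
have [f [fD fZ fq]] := hahn_banach sq.
have fN v : f (- v) = - f v by rewrite -scaleN1r fZ mulN1r.
have f0 : f 0 = 0 by rewrite -(scale0r (0 : V)) fZ mul0r.
have f_le v : `|f v| <= l1 v.
  rewrite ler_norml; apply/andP; split.
    by rewrite lerNl -fN -l1N; exact: le_trans (fq _) (q_l1 _).
  exact: le_trans (fq _) (q_l1 _).
pose phi t g := f (fspt_basis R (t, g)).
have phi1 t g : `|phi t g| <= 1 by rewrite -(l1_basis R (t, g)); exact: f_le.
have bphi t : bounded_real (phi t) by exists 1 => g; exact: phi1.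
have bphiM t u : bounded_real (fun g => phi t (u * g)%g) by exists 1 => g;
  exact: phi1.
have fdisp g : eps <= f (displacement g).
  rewrite -lerN2 -fN; apply: le_trans (fq _) _.
  have := q_le (- displacement g) [:: (1, g)] _.
  rewrite /total_displacement /mass !big_seq1 /= scale1r addNr mulr1 ler01.
  rewrite -(scale0r (0 : V)) l1Z normr0 mul0r sub0r; exact.
have [m [mL mpos m1 minv]] := amen.
pose h (s : seq Gam) g := \sum_(t <- s) (phi t (t * g)%g - phi t g).
have fh g : f (displacement g) = h T0 g.
  rewrite /displacement /h.
  elim: (enum_fset T0) => [|t s IH]; first by rewrite !big_nil f0.
  by rewrite !big_cons fD IH fD fN.
have b1 (c : R) : bounded_real (fun _ : Gam => c) by exists `|c|.
have hs (s : seq Gam) : bounded_real (h s) /\ m (h s) = 0.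
  elim: s => [|t s [[K hK] mh]].
    have -> : h [::] = fun=> 0 by apply/funext => g; rewrite /h big_nil.
    split; first exact: b1.
    have e : (fun _ : Gam => 1 * 0 + 0 : R) = fun=> 0.
      by apply/funext => g; rewrite mulr0 addr0.
    by have := mL 1 (fun=> 0) (fun=> 0) (b1 0) (b1 0); rewrite e; lra.
  have hE : h (t :: s) = fun g => (-1) * phi t g + (1 * phi t (t * g)%g + h s g).
    by apply/funext => g; rewrite /h big_cons; ring.
  have bth : bounded_real (fun g => 1 * phi t (t * g)%g + h s g).
    exists (1 + K) => g; apply: le_trans (ler_normD _ _) _.
    by rewrite mul1r lerD.
  split.
    exists (1 + (1 + K)) => g; rewrite /h big_cons;
      apply: le_trans (ler_normD _ _) _.
    have := phi1 t (t * g)%g; have := phi1 t g; have := hK g.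
    by have := ler_normB (phi t (t * g)%g) (phi t g); rewrite -/(h s g); lra.
  rewrite hE mL// mL//; last by exists K.
  by rewrite mh (minv t (phi t))//; ring.
have [bh mh] := hs T0; have [K hK] := bh.
have := mpos (fun g => (- eps) * 1 + h T0 g).
rewrite mL// m1 mh => contra.
suff : 0 <= - eps * 1 + 0 by lra.
apply: contra => [|g]; last by have := fdisp g; rewrite fh; lra.
exists (eps + K) => g; apply: le_trans (ler_normD _ _) _.
by rewrite mulr1 normrN (ger0_norm (ltW eps0)) lerD.
Qed.

Lemma displacementE g t h : t \in T0 ->
  displacement g (t, h) = (h == (t * g)%g)%:R - (h == g)%:R.
Proof.
move=> tT; rewrite /displacement fspt_sumE (bigD1_seq t) ?fset_uniq//=.
rewrite big1 => [|u ut].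
  change (((t, h) == (t, (t * g)%g))%:R - ((t, h) == (t, g))%:R + 0 =
    (h == (t * g)%g)%:R - (h == g)%:R :> R).
  by rewrite addr0 !xpair_eqE eqxx.
change (((t, h) == (u, (u * g)%g))%:R - ((t, h) == (u, g))%:R = 0 :> R).
by rewrite !xpair_eqE eq_sym (negPf ut) subrr.
Qed.

Lemma l1_ge (v : V) (s : seq (Gam * Gam)) : uniq s -> \sum_(j <- s) `|v j| <= l1 v.
Proof.
move=> us; pose A := (fsupp v `|` [fset j | j in s])%fset.
have vA j : v j != 0 -> j \in A by move=> h; rewrite inE mem_fsupp h.
rewrite (l1E vA) [leRHS](bigID (mem s)) /= -[X in _ <= X + _]big_filter.
rewrite (perm_big [seq j <- A | j \in s]) /=; first by rewrite lerDl sumr_ge0.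
apply: uniq_perm; rewrite ?filter_uniq ?fset_uniq// => j.
by rewrite mem_filter !inE /=; case: (j \in s); rewrite ?orbT.
Qed.

(** The square root of an almost invariant density is an almost invariant unit
    vector, by (a - b)^2 <= |a^2 - b^2| for nonnegative reals. *)
Lemma almost_invariant_vector (e : R) : 0 < e -> exists (B : {fset Gam}) (w : Gam -> R),
  [/\ forall r, 0 <= w r, forall r, r \notin B -> w r = 0,
      \sum_(r <- B) w r ^+ 2 = 1 &
      forall t, t \in T0 -> `|\sum_(r <- B) w r * w (t^-1 * r)%g - 1| <= e].
Proof.
move=> e0; have [mu [pmu mu0 hmu]] := almost_invariant_density e0.
pose p g := (\sum_(x <- mu | x.2 == g) x.1) / mass mu.
have p0 g : 0 <= p g.
  rewrite divr_ge0 ?(ltW mu0)// big_seq_cond sumr_ge0// => x /andP[xmu _].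
  by move/allP: pmu => /(_ x xmu).
pose B : {fset Gam} := [fset g | g in [seq x.2 | x <- mu]]%fset.
have BP x : x \in mu -> x.2 \in B by move=> xmu; rewrite !inE /=; apply: map_f.
have pB g : g \notin B -> p g = 0.
  move=> gB; rewrite /p big1_seq ?mul0r// => x /andP[/eqP xg xmu].
  by move: gB; rewrite -xg BP.
have sump (D : {fset Gam}) : {subset B <= D} -> \sum_(g <- D) p g = 1.
  move=> BD; rewrite /p -mulr_suml (exchange_big_dep xpredT)//=.
  rewrite (_ : \sum_(x <- mu) _ = mass mu) ?divff ?gt_eqF//.
  rewrite /mass !big_seq; apply: eq_bigr => x xmu.
  rewrite big_mkcond (bigD1_seq x.2) ?eqxx ?fset_uniq//=; last by apply: BD;
    exact: BP.
  by rewrite big1 ?addr0// => g /negPf gx; rewrite eq_sym gx.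
pose w g := Num.sqrt (p g).
have w0 g : 0 <= w g by exact: sqrtr_ge0.
have w2 g : w g ^+ 2 = p g by rewrite sqr_sqrtr.
exists B, w; split=> //.
- by move=> r rB; rewrite /w pB// sqrtr0.
- by under eq_bigr do rewrite w2; exact: sump.
move=> t tT.
pose D : {fset Gam} := (B `|` [fset (t * g)%g | g in B])%fset.
have BD : {subset B <= D} by move=> g gB; rewrite inE gB.
have sumtp : \sum_(g <- D) p (t^-1 * g)%g = 1.
  rewrite -(sump [fset (t^-1 * g)%g | g in D]%fset).
    by rewrite [RHS]big_imfset // => g h _ _; exact: mulgI.
  move=> g gB; apply/imfsetP; exists (t * g)%g; last by rewrite mulKg.
  by rewrite inE; apply/orP; right; apply/imfsetP; exists g.
have -> : \sum_(r <- B) w r * w (t^-1 * r)%g = \sum_(r <- D) w r * w (t^-1 * r)%g.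
  rewrite [RHS](bigID (mem B)) /= [X in _ + X]big1 ?addr0; last first.
    by move=> r rB; rewrite {1}/w pB// sqrtr0 mul0r.
  rewrite -[RHS]big_filter; apply: perm_big; apply: uniq_perm;
    rewrite ?filter_uniq ?fset_uniq// => r.
  by rewrite mem_filter; apply/idP/andP => [rB|[]//]; split=> //; exact: BD.
have twice : \sum_(r <- D) (w r - w (t^-1 * r)%g) ^+ 2 =
    2 * (1 - \sum_(r <- D) w r * w (t^-1 * r)%g).
  transitivity (\sum_(r <- D) (p r + p (t^-1 * r)%g - 2 * (w r * w (t^-1 * r)%g))).
    by apply: eq_bigr => r _; rewrite -!w2; ring.
  by rewrite sumrB big_split /= -mulr_sumr sumtp (sump D BD); ring.
have sq_le : \sum_(r <- D) (w r - w (t^-1 * r)%g) ^+ 2 <= e.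
  apply: (@le_trans _ _ (\sum_(r <- D) `|p r - p (t^-1 * r)%g|)).
    apply: ler_sum => r _; rewrite -!w2 subr_sqr normrM -real_normK ?num_real//.
    rewrite expr2 ler_wpM2l ?normr_ge0// [leRHS]ger0_norm ?addr_ge0//.
    by rewrite ler_norml; have := w0 r; have := w0 (t^-1 * r)%g; lra.
  have tot g : total_displacement mu (t, g) = mass mu * (p (t^-1 * g)%g - p g).
    rewrite /total_displacement fspt_sumE /p mulrBr !(mulrC (mass mu)).
    rewrite !divfK ?gt_eqF// !(big_mkcond (fun x => x.2 == _)) -sumrB.
    apply: eq_bigr => x _.
    change (x.1 * displacement x.2 (t, g) =
      (if x.2 == (t^-1 * g)%g then x.1 else 0) - (if x.2 == g then x.1 else 0)).
    rewrite displacementE// (eq_sym g x.2) (_ : (g == _) = (x.2 == (t^-1 * g)%g)).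
      by rewrite mulrBr !mulr_natr !mulrb.
    by apply/eqP/eqP => [->|->]; rewrite ?mulKg ?mulVKg.
  rewrite -(ler_pM2l mu0) [leRHS]mulrC; apply: le_trans _ (ltW hmu).
  apply: le_trans _ (@l1_ge _ [seq (t, g) | g <- D] _); last first.
    by rewrite map_inj_uniq ?fset_uniq// => g h [].
  rewrite big_map mulr_sumr; apply: ler_sum => g _.
  by rewrite tot normrM (gtr0_norm mu0) distrC.
have pos : 0 <= \sum_(r <- D) (w r - w (t^-1 * r)%g) ^+ 2.
  by apply: sumr_ge0 => r _; exact: sqr_ge0.
rewrite twice in sq_le pos; rewrite ler_norml; lra.
Qed.

End Reiter.

(** * Characters separate the points of an abelian group *)

Section Characters.
Variables (R : realType) (Gam : groupType).
Hypothesis comm : commutative_group Gam.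
Local Notation C := (R[i]).
Implicit Types (K : set (Gam * C)) (g h a : Gam) (z w : C).

(** The graph of a unitary character on a subgroup. *)
Definition partial_character K :=
  [/\ K (1%g, 1), forall g h z w, K (g, z) -> K (h, w) -> K ((g * h)%g, z * w),
      forall g z, K (g, z) -> K (g^-1%g, z^-1),
      forall g z, K (g, z) -> normc z = 1 &
      forall z, K (1%g, z) -> z = 1].

Lemma pchar_fun K g z w : partial_character K -> K (g, z) -> K (g, w) -> z = w.
Proof.
move=> [K1 KM KV Kn Kf] gz gw; have := KM _ _ _ _ gz (KV _ _ gw).
rewrite mulgV => /Kf e; have w0 : w != 0.
  by apply/eqP => w0; have := Kn _ _ gw; rewrite w0 normc0; lra.
by rewrite -[z]mulr1 -(mulVf w0) mulrA e mul1r.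
Qed.

Lemma pcharX K g z n : partial_character K -> K (g, z) -> K ((g ^+ n)%g, z ^+ n).
Proof.
move=> [K1 KM _ _ _] gz; elim: n => [|n IH]; first by rewrite expg0 expr0.
by rewrite expgS exprS; exact: KM.
Qed.

(** The pairs (h a^(m - n), z w^(m - n)), with natural exponents only. *)
Definition extend_character K a w : set (Gam * C) := [set p |
  exists n m h z, [/\ K (h, z), (p.1 * a ^+ n = h * a ^+ m)%g &
    p.2 * w ^+ n = z * w ^+ m]].

Lemma mulgACA_comm : forall x y z t : Gam, ((x * y) * (z * t) = (x * z) * (y * t))%g.
Proof. by move=> x y z t; rewrite -!mulgA; congr (_ * _)%g;
  rewrite !mulgA (comm y z). Qed.

Lemma extend_characterP K a w : partial_character K -> normc w = 1 ->
  (forall n z, K ((a ^+ n)%g, z) -> w ^+ n = z) ->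
  [/\ partial_character (extend_character K a w),
      K `<=` extend_character K a w & extend_character K a w (a, w)].
Proof.
move=> /[dup] pK [K1 KM KV Kn Kf] w1 wa.
have w0 : w != 0 by apply/eqP => w0; move: w1; rewrite w0 normc0; lra.
have wn n : w ^+ n != 0 by rewrite expf_neq0.
have nw n : normc (w ^+ n) = 1 by rewrite (normcX (w : Cplx R)) w1 expr1n.
split; first split.
- by exists 0%N, 0%N, 1%g, 1; split.
- move=> g h y y' [n [m [k [z [kz /= e1 e2]]]]] [n' [m' [k' [z' [kz' /= e1' e2']]]]].
  exists (n + n')%N, (m + m')%N, (k * k')%g, (z * z'); split=> /=;
    first exact: KM.
    by rewrite !expgnDr mulgACA_comm e1 e1' mulgACA_comm.
  by rewrite !exprD mulrACA e2 e2' mulrACA.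
- move=> g y [n [m [k [z [kz /= e1 e2]]]]].
  have z0 : z != 0 by apply/eqP => z0; have := Kn _ _ kz; rewrite z0 normc0;
    lra.
  have y0 : y != 0.
    by apply: contraNneq (mulf_neq0 z0 (wn m)) => y0; rewrite -e2 y0 mul0r.
  exists m, n, k^-1%g, z^-1; split=> /=; first exact: KV.
    have -> : (a ^+ n)%g = (k * a ^+ m * g^-1)%g by rewrite -e1 (comm g) mulgK.
    by rewrite (mulgA k^-1%g) (mulgA k^-1%g) mulVg mul1g comm.
  have -> : w ^+ n = z * w ^+ m / y by rewrite -e2 mulrAC mulfV// mul1r.
  by field; rewrite ?y0 ?z0.
- move=> g y [n [m [k [z [kz /= e1 e2]]]]].
  by have := congr1 (@normc R) e2; rewrite !normcM !nw !mulr1 (Kn _ _ kz).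
- move=> y [n [m [k [z [kz /= e1 e2]]]]]; rewrite mul1g in e1.
  have [mn|nm] := leqP m n.
    have ek : (a ^+ (n - m))%g = k.
      by apply: (mulIg (a ^+ m)%g); rewrite -expgnDr subnK.
    have ez : w ^+ (n - m) = z by apply: wa; rewrite ek.
    by apply: (mulIf (wn n)); rewrite e2 -ez -exprD subnK// mul1r.
  have ek : (a ^+ (m - n))%g = k^-1%g.
    apply: (mulIg (a ^+ n)%g); rewrite -expgnDr subnK 1?ltnW// e1.
    by rewrite mulgA mulVg mul1g.
  have ez : w ^+ (m - n) = z^-1 by apply: wa; rewrite ek; exact: KV.
  have z0 : z != 0 by apply/eqP => z0; have := Kn _ _ kz; rewrite z0 normc0;
    lra.
  apply: (mulIf (wn n)); rewrite e2 mul1r -(subnK (ltnW nm)) exprD ez.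
  by rewrite mulrA mulfV// mul1r.
- by move=> [g z] kz; exists 0%N, 0%N, g, z; split.
by exists 0%N, 1%N, 1%g, 1; split;
  rewrite //= ?expg0 ?mulg1 ?mul1g// ?expr0 ?expr1 ?mul1r ?mulr1.
Qed.

(** Roots of complex numbers let a partial character be extended by any further
    element a: if some power of a lies in the domain, the value at a is a root
    of the value at the least such power. *)
Lemma extension_value K a : partial_character K -> exists w, normc w = 1 /\
  forall n z, K ((a ^+ n)%g, z) -> w ^+ n = z.
Proof.
move=> /[dup] pK [K1 KM KV Kn Kf].
have [[n n0 [z nz]]|none] := pselect (exists2 n, (0 < n)%N & exists z, K ((a ^+ n)%g, z)).
  pose Q n := (0 < n)%N && `[< exists z, K ((a ^+ n)%g, z) >].
  have Qn : exists n, Q n by exists n; rewrite /Q n0; apply/asboolP; exists z.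
  pose p := ex_minn Qn.
  have [p0 [zp kzp] pmin] : [/\ (0 < p)%N, exists z, K ((a ^+ p)%g, z) &
      forall m, (0 < m)%N -> (exists z, K ((a ^+ m)%g, z)) -> (p <= m)%N].
    rewrite /p; case: ex_minnP => m /andP[m0 /asboolP hm] mmin;
      split=> // k k0 hk.
    by apply: mmin; rewrite /Q k0; exact/asboolP.
  pose w : C := nthroot p (zp : C).
  have wp : w ^+ p = zp by exact: rootCK.
  have w1 : normc w = 1.
    by apply: (normc_root1 (z := w : Cplx R) p0); rewrite wp; exact: Kn kzp.
  exists w; split=> // m y ky; pose r := (m %% p)%N; pose q := (m %/ p)%N.
  have em : m = (q * p + r)%N by exact: divn_eq.
  have kq : K ((a ^+ (q * p))%g, zp ^+ q).
    by rewrite mulnC expgnA; exact: pcharX.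
  have kr : K ((a ^+ r)%g, y / zp ^+ q).
    have -> : (a ^+ r = a ^+ m * (a ^+ (q * p))^-1)%g.
      by rewrite {1}em addnC expgnDr mulgK.
    by apply: KM => //; exact: KV.
  have r0 : r = 0%N.
    apply/eqP; rewrite -leqn0 leqNgt; apply/negP => r0.
    have := pmin r r0 (ex_intro _ _ kr); by rewrite leqNgt ltn_pmod.
  rewrite r0 addn0 in em; rewrite em mulnC exprM wp.
  by apply: (pchar_fun pK kq); rewrite -em.
exists 1; split=> [|n z kz]; first exact: normc1.
have [n0|n0] := posnP n; last by case: none; exists n => //; exists z.
by rewrite expr1n; apply/esym/Kf; rewrite n0 expg0 in kz.
Qed.

Lemma trivial_partial_character : partial_character [set (1%g, 1)].
Proof.
split=> //.
- by move=> g h z w [-> ->] [-> ->] /=; rewrite mulg1 mulr1.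
- by move=> g z [-> ->] /=; rewrite invg1 invr1.
- by move=> g z [_ ->]; exact: normc1.
- by move=> z [].
Qed.

(** A nontrivial value at g can be chosen on the cyclic group of g: -1 when g has
    infinite order, and otherwise a root of 1 + X + ... + X^(n-1). *)
Lemma nontrivial_value g : g <> 1%g -> exists w, [/\ normc w = 1, w != 1 &
  forall n, (g ^+ n = 1)%g -> w ^+ n = 1].
Proof.
move=> g1.
have [[n n0 gn]|none] := pselect (exists2 n, (0 < n)%N & (g ^+ n = 1)%g);
  last first.
  exists (-1); split=> [||n gn].
  - by rewrite -normc1 -[in RHS](normcN (1 : Rcomplex R)).
  - by rewrite eqr_oppLR; apply/eqP => /eqP;
    rewrite -subr_eq0 opprK -mulr2n mulrn_eq0 oner_eq0.
  have [->|n0] := posnP n; first by rewrite expr0.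
  by case: none; exists n.
pose Q n := (0 < n)%N && `[< (g ^+ n = 1)%g >].
have Qn : exists n, Q n by exists n; rewrite /Q n0; exact/asboolP.
pose p := ex_minn Qn.
have [p0 gp pmin] : [/\ (0 < p)%N, (g ^+ p = 1)%g &
    forall m, (0 < m)%N -> (g ^+ m = 1)%g -> (p <= m)%N].
  rewrite /p; case: ex_minnP => m /andP[m0 /asboolP hm] mmin;
    split=> // k k0 hk.
  by apply: mmin; rewrite /Q k0; exact/asboolP.
have p1 : (1 < p)%N.
  by rewrite ltn_neqAle p0 andbT; apply/eqP => e; apply: g1;
    rewrite -gp -e expg1.
pose f : {poly C} := \poly_(i < p) 1.
have sf : size f = p.
  by rewrite size_poly_eq// oner_neq0.
have /closed_rootP[w /eqP fw] : size f != 1%N by rewrite sf neq_ltn p1 orbT.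
have fwE : \sum_(i < p) w ^+ i = 0.
  by move: fw; rewrite horner_poly; under eq_bigr do rewrite mul1r.
have wp : w ^+ p = 1.
  by apply/eqP; rewrite -subr_eq0 subrX1 fwE mulr0.
exists w; split.
- by apply: (normc_root1 (z := w : Cplx R) p0); rewrite wp normc1.
- apply/eqP => w1; move: fwE; rewrite w1.
  under eq_bigr do rewrite expr1n.
  rewrite sumr_const card_ord => /eqP; rewrite mulrn_eq0 oner_eq0 orbF.
  by rewrite -leqn0 leqNgt p0.
move=> m gm; rewrite (divn_eq m p) exprD mulnC exprM wp expr1n mul1r.
have -> : (m %% p)%N = 0%N; last by rewrite expr0.
apply/eqP; rewrite -leqn0 leqNgt; apply/negP => r0.
have gr : (g ^+ (m %% p) = 1)%g.
  by have := gm; rewrite {1}(divn_eq m p) expgnDr mulnC expgnA gp expg1n mul1g.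
by have := pmin _ r0 gr; rewrite leqNgt ltn_pmod.
Qed.

(** A character that is nontrivial at g on the cyclic group of g lies below a
    maximal partial character, which is total by [extension_value]. *)
Lemma character_separates g : g <> 1%g ->
  exists2 chi : Gam -> Cplx R, unitary_character chi & chi g != 1.
Proof.
move=> g1; have [w0 [w01 w0N1 w0g]] := nontrivial_value g1.
have [|pK0 _ K0g] := extend_characterP trivial_partial_character w01 (a := g).
  by move=> n z [e ->]; exact: w0g.
set K0 := extend_character _ _ _ in pK0 K0g.
pose Q (K : set (Gam * C)) := K = set0 \/ partial_character K /\ K0 `<=` K.
have [F FQ totF|K [QK maxK]] := @Zorn_bigcup _ Q.
  have [[K FK KN0]|none] := pselect (exists2 K, F K & K <> set0); last first.
    left; apply/seteqP; split=> // p [K FK Kp]; apply: none; exists K => // K0e.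
    by rewrite K0e in Kp.
  have big L : F L -> L <> set0 -> partial_character L /\ K0 `<=` L.
    by move=> /FQ[->|//].
  have [pK K0K] := big K FK KN0.
  have sub p : (\bigcup_(L in F) L) p ->
      exists L, [/\ F L, L p, partial_character L & K0 `<=` L].
    move=> [L FL Lp]; have LN0 : L <> set0 by move=> e; rewrite e in Lp.
    by have [pL K0L] := big L FL LN0; exists L.
  right; split; last by move=> p /K0K Kp; exists K.
  split.
  - by exists K => //; case: pK.
  - move=> h1 h2 z1 z2 /sub[L1 [F1 L1p p1 _]] /sub[L2 [F2 L2p p2 _]].
    have [s|s] := totF _ _ F1 F2.
      by exists L2 => //; case: p2 => _ KM _ _ _; apply: KM => //; exact: s.
    by exists L1 => //; case: p1 => _ KM _ _ _; apply: KM => //; exact: s.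
  - by move=> h z /sub[L [FL Lp [_ _ KV _ _] _]]; exists L => //; exact: KV.
  - by move=> h z /sub[L [FL Lp [_ _ _ Kn _] _]]; exact: Kn Lp.
  - by move=> z /sub[L [FL Lp [_ _ _ _ Kf] _]]; exact: Kf.
have {QK} [pK K0K] : partial_character K /\ K0 `<=` K.
  case: QK => // K0e; exfalso; apply: (maxK K0); last by right; split.
  by rewrite K0e; split=> // /(_ _ K0g).
have total a : exists z, K (a, z).
  apply: contrapT => none; have [w [w1 wa]] := extension_value a pK.
  have [pK' KK' K'a] := extend_characterP pK w1 wa.
  apply: (maxK (extend_character K a w)).
    by split=> // /(_ _ K'a) Ka; apply: none; exists w.
  by right; split=> //; apply: subset_trans KK'.
have [chi chiP] := choice total.
exists chi; first split.
- by move=> h; have [_ _ _ Kn _] := pK; rewrite normcE_norm (Kn _ _ (chiP h)).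
- move=> h k; apply: (pchar_fun pK (chiP _)).
  by have [_ KM _ _ _] := pK; apply: KM.
by rewrite (pchar_fun pK (chiP g) (K0K _ K0g)).
Qed.

End Characters.

(** * The partial action on X and the topology of the groupoid *)

Section Groupoid.
Variables (R : realType) (X : topologicalType) (Gam : groupType).
Variables (P : set Gam) (theta : Gam -> X -> X).
Hypothesis hX : hausdorff_space X.
Hypothesis Pore : ore_semigroup P.
Hypothesis actP : injective_action P theta.
Hypothesis amen : amenable_group R Gam.
Local Notation G := (tgpd P theta).
Local Notation C := (Cplx R).
Local Notation H := (ell2 R G).
Local Notation op := (ell2 R G -> ell2 R G).
Local Notation cstar := (@groupoid_cstar R X Gam P theta).
Local Notation dom t := [set x | act_dom P theta x t].
Local Notation th t x := (act_pt P theta x t).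
Implicit Types (gamma : G) (F E : X -> C) (t u : Gam) (x y : X) (xi eta : H).
Implicit Types (S T : op) (f : G -> C).

Definition pt gamma : X := (\val gamma).1.
Definition src gamma : X := th (cocycle gamma) (pt gamma).

Lemma gpd_eq gamma gamma' :
  pt gamma = pt gamma' -> cocycle gamma = cocycle gamma' -> gamma = gamma'.
Proof.
move=> e1 e2; apply: val_inj; move: e1 e2; rewrite /pt /cocycle.
by case: (\val gamma) (\val gamma') => [x g] [x' g'] /= -> ->.
Qed.

Lemma gpdP gamma : dom (cocycle gamma) (pt gamma).
Proof. exact: tgpdP. Qed.

Definition mkG x t (h : dom t x) : G :=
  exist _ ((x, t) : X * discrete_topology Gam) (mem_set (h : tgpd P theta (x, t))).

Lemma dom1 x : dom 1%g x.
Proof.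
case: Pore => P1 _ _ _; exists 1%g, 1%g, x; split => //.
by rewrite mulgV.
Qed.

Lemma th1 x : th 1%g x = x.
Proof.
case: Pore => P1 _ _ _; have := act_ptE Pore actP P1 P1 (erefl (theta 1%g x)).
by rewrite mulgV.
Qed.

Lemma domM t u x : dom t x -> dom u (th t x) -> dom (t * u)%g x.
Proof. by move=> h1 h2; case: (act_domM Pore actP h1 h2). Qed.

Lemma thM t u x : dom t x -> dom u (th t x) -> th (t * u)%g x = th u (th t x).
Proof. by move=> h1 h2; case: (act_domM Pore actP h1 h2). Qed.

Lemma domV t x : dom t x -> dom t^-1%g (th t x).
Proof. by move=> h1; case: (act_domV Pore actP h1). Qed.

Lemma thV t x : dom t x -> th t^-1%g (th t x) = x.
Proof. by move=> h1; case: (act_domV Pore actP h1). Qed.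

Lemma gsrcE gamma gamma' : gsrc gamma = gsrc gamma' <-> src gamma = src gamma'.
Proof.
split=> [/(congr1 val)|e]; first by rewrite !val_gsrc// => -[].
by apply: val_inj; rewrite !val_gsrc//; congr pair.
Qed.

Lemma src_cocycle_inj gamma gamma' :
  src gamma = src gamma' -> cocycle gamma = cocycle gamma' -> gamma = gamma'.
Proof.
move=> e1 e2; apply: gpd_eq => //.
by rewrite -(thV (gpdP gamma)) -(thV (gpdP gamma')) -/(src _) e1 e2.
Qed.

Lemma pt_gmul gamma gamma' : pt gamma' = src gamma -> pt (gmul gamma gamma') = pt gamma.
Proof. by move=> e; rewrite /pt (val_gmul Pore actP). Qed.

Lemma cocycle_gmul gamma gamma' : pt gamma' = src gamma ->
  cocycle (gmul gamma gamma') = (cocycle gamma * cocycle gamma')%g.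
Proof. by move=> e; rewrite /cocycle (val_gmul Pore actP). Qed.

Lemma pt_ginv gamma : pt (ginv gamma) = src gamma.
Proof. by rewrite /pt (val_ginv Pore actP). Qed.

Lemma cocycle_ginv gamma : cocycle (ginv gamma) = (cocycle gamma)^-1%g.
Proof. by rewrite /cocycle (val_ginv Pore actP). Qed.

(** The element (x, t)^-1 gamma, for x the range of gamma and t in the domain
    at x. *)
Definition gshift t gamma : G :=
  insubd gamma ((th t (pt gamma), (t^-1 * cocycle gamma)%g) :
    X * discrete_topology Gam).

Lemma val_gshift t gamma : dom t (pt gamma) ->
  \val (gshift t gamma) = (th t (pt gamma), (t^-1 * cocycle gamma)%g).
Proof.
move=> h; rewrite /gshift insubdK//; apply/mem_set; rewrite /tgpd /=.
by apply: domM; [exact: domV | rewrite thV//; exact: gpdP].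
Qed.

Lemma pt_gshift t gamma : dom t (pt gamma) -> pt (gshift t gamma) = th t (pt gamma).
Proof. by move=> h; rewrite /pt val_gshift. Qed.

Lemma cocycle_gshift t gamma : dom t (pt gamma) ->
  cocycle (gshift t gamma) = (t^-1 * cocycle gamma)%g.
Proof. by move=> h; rewrite /cocycle val_gshift. Qed.

Lemma src_gshift t gamma : dom t (pt gamma) -> src (gshift t gamma) = src gamma.
Proof.
move=> h; rewrite /src pt_gshift// cocycle_gshift//.
by rewrite thM ?thV//; [exact: domV | exact: gpdP].
Qed.

Lemma gshift_inj t : set_inj [set gamma | dom t (pt gamma)] (gshift t).
Proof.
move=> g1 g2 /set_mem h1 /set_mem h2 e.
have e1 := congr1 pt e; rewrite !pt_gshift// in e1.
have e2 := congr1 (@cocycle _ _ _ _) e; rewrite !cocycle_gshift// in e2.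
apply: gpd_eq; first by rewrite -(thV h1) -(thV h2) e1.
exact: mulgI e2.
Qed.

Lemma gshift1 gamma : gshift 1%g gamma = gamma.
Proof.
apply: gpd_eq; rewrite ?pt_gshift ?cocycle_gshift ?th1 ?invg1 ?mul1g//;
  exact: dom1.
Qed.

Lemma gshiftM t u gamma : dom t (pt gamma) -> dom u (th t (pt gamma)) ->
  gshift u (gshift t gamma) = gshift (t * u)%g gamma.
Proof.
move=> h1 h2; have h3 := domM h1 h2;
  have h4 : dom u (pt (gshift t gamma)) by rewrite pt_gshift.
apply: gpd_eq; first by rewrite !pt_gshift// thM.
by rewrite !cocycle_gshift// invgM mulgA.
Qed.

(** gshift reaches every element with the source of gamma, so that sums over these
    elements become sums over t. *)
Lemma gshift_divg gamma gamma' : src gamma = src gamma' ->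
  let t := (cocycle gamma * (cocycle gamma')^-1)%g in
  dom t (pt gamma) /\ gshift t gamma = gamma'.
Proof.
move=> e t; have h : dom t (pt gamma).
  apply: domM; first exact: gpdP.
  by rewrite -/(src gamma) e; apply: domV; exact: gpdP.
split=> //; apply: src_cocycle_inj; first by rewrite src_gshift.
by rewrite cocycle_gshift// /t invgM invgK -mulgA mulVg mulg1.
Qed.

(** As Gam is discrete, near gamma the cocycle is constant and only the range
    varies. *)
Lemma nbhs_gpd gamma (B : set G) : nbhs gamma B <->
  exists2 V, nbhs (pt gamma) V & forall gamma', V (pt gamma') ->
    cocycle gamma' = cocycle gamma -> B gamma'.
Proof.
split=> [|[V nV VB]].
  move=> nB; have [U [oU Ug] UB] : exists2 U, open_nbhs gamma U & U `<=` B.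
    by move: nB; rewrite nbhsE.
  case: oU => W oW WU.
  have nW : nbhs (\val gamma) W.
    by apply: open_nbhs_nbhs; split => //;
      have : (set_val @^-1` W) gamma by rewrite WU.
  case: nW => -[V1 V2] /= [nV1 nV2] VW; exists V1; first exact: nV1.
  move=> g' V1g' e.
  apply: UB; rewrite -WU /=; apply: VW; split => //=.
  have := nbhs_singleton nV2; rewrite -[(\val g').2]/(cocycle g') e.
  by [].
have cval : continuous (set_val : G -> _) by exact: initial_continuous.
have nVG : nbhs (\val gamma) (V `*` [set cocycle gamma : discrete_topology Gam]).
  exists (V, [set cocycle gamma]) => //=; split => //.
have nB : nbhs gamma (set_val @^-1` (V `*` [set cocycle gamma : discrete_topology Gam])).
  exact: cval.
apply: filterS nB => g' [/= Vg' e]; exact: VB.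
Qed.

Lemma pt_continuous : continuous pt.
Proof. by move=> gamma V nV; apply/nbhs_gpd; exists V. Qed.

Lemma near_cocycle gamma : nbhs gamma [set gamma' | cocycle gamma' = cocycle gamma].
Proof. by apply/nbhs_gpd; exists setT => //; exact: filterT. Qed.

Lemma dom_open t x : dom t x -> nbhs x (dom t).
Proof.
move=> [a [b [y [Pa Pb e xy]]]]; case: actP => thP _ _.
have [ca _ _] := thP a Pa; have [_ _ ob] := thP b Pb.
have oR : nbhs (theta a x) (theta b @` setT).
  by apply: open_nbhs_nbhs; split; [apply: ob; exact: openT | exists y].
have nx : nbhs x (theta a @^-1` (theta b @` setT)) by exact: ca.
apply: filterS nx => z [w _ zw].
by exists a, b, w.
Qed.

Lemma th_continuous t x : dom t x -> {for x, continuous (fun z => th t z)}.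
Proof.
move=> /[dup] tx [a [b [y [Pa Pb e xy]]]]; case: actP => thP _ _.
have [ca _ _] := thP a Pa; have [_ ib ob] := thP b Pb.
have ey : th t x = y by rewrite e (act_ptE Pore actP Pa Pb xy).
move=> V; rewrite /= ey nbhsE => -[W [oW Wy] WV].
have oR : nbhs (theta a x) (theta b @` W).
  by apply: open_nbhs_nbhs; split; [exact: ob | exists y].
have nx : nbhs x (theta a @^-1` (theta b @` W)) by exact: ca.
apply: filterS nx => z [w Ww zw].
by apply: WV; rewrite /= e (act_ptE Pore actP Pa Pb (esym zw)).
Qed.

(** * Weighted shifts *)

Definition weight t F :=
  (forall x, ~ dom t x -> F x = 0) /\ exists K : R, forall x, normc (F x) <= K.

(** The regular representation of the function F placed on the slice c = t, as
    long as F is a weight; the default value 0 is then not reached. *)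
Definition wshift t F xi : H :=
  insubd (0 : H) (fun gamma => (F (pt gamma) : R[i]) * xi (gshift t gamma) : C).

Lemma sqsum_shift t F (K : R) xi : (forall x, ~ dom t x -> F x = 0) ->
  (forall x, normc (F x) <= K) ->
  (sqsum (fun gamma => (F (pt gamma) : R[i]) * xi (gshift t gamma) : C)%R <=
    ((K ^+ 2)%:E * sqsum xi))%E.
Proof.
move=> F0 FK; pose D : set G := [set gamma | dom t (pt gamma)].
apply: (@le_trans _ _
  (\esum_(gamma in [set: G]) ((K ^+ 2)%:E *
    (if gamma \in D then (sqmod (xi (gshift t gamma)))%:E else 0)))%E).
  apply: le_esum => gamma _; case: ifPn => [_|/negP nD].
    rewrite sqmodM EFinM lee_wpmul2r ?sqmodE_ge0// lee_fin sqmodE.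
    have K0 : 0 <= K by exact: le_trans (normc_ge0 _) (FK (pt gamma)).
    by rewrite ler_pXn2r ?nnegrE ?normc_ge0.
  rewrite F0 ?mul0r ?sqmod0 ?mule0//.
  by move=> h; apply: nD; exact/mem_set.
rewrite ge0_esumZl ?sqr_ge0//; last first.
  by move=> gamma; case: ifP => // _; exact: sqmodE_ge0.
apply: lee_wpmul2l; first by rewrite lee_fin sqr_ge0.
rewrite -(@esum_mkcond _ _ D (fun gamma => (sqmod (xi (gshift t gamma)))%:E)).
rewrite -(@esum_image _ _ _ D (gshift t) (fun gamma => (sqmod (xi gamma))%:E)).
  rewrite esum_mkcond; apply: le_esum => gamma _.
  by case: ifP => // _; exact: sqmodE_ge0.
exact: gshift_inj.
Qed.

Lemma wshiftE t F xi gamma : weight t F ->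
  wshift t F xi gamma = (F (pt gamma) : R[i]) * xi (gshift t gamma).
Proof.
move=> [F0 [K FK]]; rewrite /wshift insub_ell2//.
apply: le_lt_trans (sqsum_shift xi F0 FK) _.
by rewrite lte_mul_pinfty ?ell2P// lee_fin sqr_ge0.
Qed.

Lemma wshift_opb t F (K : R) : weight t F -> 0 <= K ->
  (forall x, normc (F x) <= K) -> opb (wshift t F) K.
Proof.
move=> /[dup] wF [F0 _] K0 FK xi.
rewrite l2norm_leP ?mulr_ge0 ?l2norm_ge0// exprMn EFinM l2norm_sqr.
apply: le_trans (sqsum_shift xi F0 FK).
rewrite le_eqVlt; apply/orP; left; apply/eqP; congr sqsum.
by apply/funext => gamma; exact: wshiftE.
Qed.

Lemma wshift_linear t F : weight t F -> linear (wshift t F).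
Proof.
move=> wF c u v; apply: ell2_eq => gamma.
rewrite wshiftE// !ell2D !ell2Z !wshiftE// mulrDr; congr (_ + _).
by rewrite mulrCA.
Qed.

Lemma wshift_bounded t F : weight t F -> bounded_op (wshift t F).
Proof.
move=> /[dup] wF [F0 [K FK]]; split; first exact: wshift_linear.
exists (Num.max K 0); apply: wshift_opb => //.
  by rewrite le_max lexx orbT.
by move=> x; rewrite le_max FK.
Qed.

Lemma weight0 t : weight t (fun=> 0).
Proof. by split=> //; exists 0 => x; rewrite normc0. Qed.

Lemma weightD t F E : weight t F -> weight t E -> weight t (fun x => F x + E x : C).
Proof.
move=> [F0 [K FK]] [E0 [L EL]]; split=> [x nx|];
  first by rewrite F0// E0// addr0.
by exists (K + L) => x; apply: le_trans (le_normcD _ _) _; exact: lerD.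
Qed.

Lemma weightMl t F (E : X -> C) (K : R) : weight t F -> (forall x, normc (E x) <= K) ->
  weight t (fun x => (E x : R[i]) * F x : C).
Proof.
move=> [F0 [L FL]] EK; split=> [x nx|]; first by rewrite F0// mulr0.
exists (K * L) => x; rewrite normcM; apply: ler_pM => //; exact: normc_ge0.
Qed.

Lemma weightZ t F (c : C) : weight t F -> weight t (fun x => (c : R[i]) * F x : C).
Proof. by move=> wF; exact: (weightMl (E := fun=> c) (K := normc c) wF). Qed.

Lemma weightM t u F E : weight t F -> weight u E ->
  weight (t * u)%g (fun x => (F x : R[i]) * E (th t x) : C).
Proof.
move=> [F0 [K FK]] [E0 [L EL]]; split=> [x nx|].
  have [tx|ntx] := pselect (dom t x); last by rewrite F0// mul0r.
  by rewrite E0 ?mulr0// => ux; apply: nx; exact: domM.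
by exists (K * L) => x; rewrite normcM ler_pM ?normc_ge0.
Qed.

Lemma wshift0 t : wshift t (fun=> 0) = 0.
Proof.
apply/funext => xi; apply: ell2_eq => gamma.
by rewrite wshiftE ?mul0r//; exact: weight0.
Qed.

Lemma wshiftD t F E : weight t F -> weight t E ->
  wshift t (fun x => F x + E x) = wshift t F + wshift t E.
Proof.
move=> wF wE; apply/funext => xi; apply: ell2_eq => gamma.
by rewrite opDE ell2D !wshiftE ?mulrDl//; exact: weightD.
Qed.

Lemma wshiftZ t F (c : C) : weight t F ->
  wshift t (fun x => (c : R[i]) * F x) = c *: wshift t F.
Proof.
move=> wF; apply/funext => xi; apply: ell2_eq => gamma.
by rewrite opZE ell2Z !wshiftE ?mulrA//; exact: weightZ.
Qed.

Lemma wshiftB t F E : weight t F -> weight t E ->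
  wshift t (fun x => F x - E x) = wshift t F - wshift t E.
Proof.
move=> wF wE; rewrite -scaleN1r -wshiftZ// -wshiftD//; last exact: weightZ.
by congr wshift; apply/funext => x; rewrite mulN1r.
Qed.

Lemma wshiftM t u F E : weight t F -> weight u E ->
  wshift t F \o wshift u E =
  wshift (t * u)%g (fun x => (F x : R[i]) * E (th t x)).
Proof.
move=> wF wE; apply/funext => xi; apply: ell2_eq => gamma.
rewrite [LHS]wshiftE// !wshiftE//; last exact: weightM.
have [tx|ntx] := pselect (dom t (pt gamma)); last by rewrite wF.1// !mul0r.
rewrite pt_gshift//.
have [ux|nux] := pselect (dom u (th t (pt gamma))); last first.
  by rewrite wE.1// mul0r mulr0 mul0r.
by rewrite gshiftM// mulrA.
Qed.

(** ** Adjoints of weighted shifts *)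

Lemma has_sum_reindex (I J : choiceType) (u : I -> C) (v : J -> C)
  (e : I -> J) (e' : J -> I) (l : C) :
  (forall i, u i != 0 -> e' (e i) = i /\ v (e i) = u i) ->
  (forall j, v j != 0 -> e (e' j) = j /\ u (e' j) = v j) ->
  has_sum u l -> has_sum v l.
Proof.
move=> uv vu ul eps eps0; have [A hA] := ul _ eps0.
exists [fset e i | i in A]%fset => B AB.
pose B' := ([fset e' j | j in B & v j != 0] `|` A)%fset.
suff -> : \sum_(j <- B) v j = \sum_(i <- B') u i by apply: hA; exact: fsubsetUr.
rewrite (bigID (fun j => v j == 0)) /= big1 ?add0r; last by move=> j /eqP.
rewrite [RHS](bigID (fun i => u i == 0)) /= [X in _ = X + _]big1 ?add0r;
  last by move=> i /eqP.
rewrite -big_filter -[RHS]big_filter.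
rewrite [LHS](eq_big_seq (fun j => u (e' j))); last first.
  by move=> j; rewrite mem_filter => /andP[vj _]; rewrite (vu j vj).2.
rewrite -(big_map e' xpredT u); apply: perm_big; apply: uniq_perm.
- rewrite map_inj_in_uniq ?filter_uniq ?fset_uniq// => j k.
  rewrite !mem_filter => /andP[vj _] /andP[vk _] jk.
  by rewrite -(vu j vj).1 -(vu k vk).1 jk.
- by rewrite filter_uniq ?fset_uniq.
move=> i; apply/mapP/idP => [[j]|].
  rewrite !mem_filter => /andP[vj jB] ->; rewrite (vu j vj).2 vj /= in_fsetU.
  by apply/orP; left; apply/imfsetP; exists j => //=; rewrite inE /= jB vj.
rewrite mem_filter => /andP[ui]; rewrite in_fsetU => /orP[/imfsetP[j /=]|iA].
  by rewrite inE /= => /andP[jB vj] ->; exists j => //; rewrite mem_filter vj.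
have [ei vi] := uv i ui; exists (e i); last by rewrite ei.
rewrite mem_filter vi ui /=; apply: (fsubsetP AB); apply/imfsetP; by exists i.
Qed.

Definition adjweight t F x : C :=
  if pselect (dom t^-1%g x) then conjc (F (th t^-1%g x) : R[i]) else 0.

Lemma weight_adj t F : weight t F -> weight t^-1%g (adjweight t F).
Proof.
move=> [F0 [K FK]]; split=> [x nx|]; first by rewrite /adjweight; case: pselect.
exists K => x; rewrite /adjweight; case: pselect => h;
  first by rewrite normcJ_eq.
by rewrite normc0; exact: le_trans (normc_ge0 _) (FK x).
Qed.

Lemma adjoint_wshift t F : weight t F ->
  adjoint_ops (wshift t F) (wshift t^-1%g (adjweight t F)).
Proof.
move=> wF xi eta; apply: has_sum_uniq (innerP _ _).
have wF' := weight_adj wF.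
apply: (has_sum_reindex (e := gshift t) (e' := gshift t^-1%g)) (innerP _ _) => gamma.
  rewrite (wshiftE _ _ wF) (wshiftE _ _ wF').
  have [h|h] := pselect (dom t (pt gamma)); last by rewrite wF.1// !mul0r eqxx.
  move=> _; have h' := domV h.
  have e : gshift t^-1%g (gshift t gamma) = gamma.
    by rewrite gshiftM// mulgV gshift1.
  split=> //; rewrite e pt_gshift// /adjweight; case: pselect => //= _.
  by rewrite thV// conjcM conjcK mulrCA mulrA.
rewrite (wshiftE _ _ wF') (wshiftE _ _ wF) /adjweight; case: pselect => h;
  last first.
  by rewrite mul0r conjc0 mulr0 eqxx.
move=> _; have h' := domV h; rewrite invgK in h'.
have e : gshift t (gshift t^-1%g gamma) = gamma.
  by rewrite gshiftM// mulVg gshift1.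
split=> //; rewrite e pt_gshift// conjcM conjcK.
by rewrite mulrCA mulrA.
Qed.

(** * Compactly supported slices *)

(** F is the restriction to the slice c = t of an element of C_c(G): the slice is
    the open set dom t of X, and F is extended by zero. *)
Definition Cc_on t F := continuous F /\
  exists K : set X, [/\ compact K, K `<=` dom t & forall x, ~ K x -> F x = 0].

Lemma Cc_on_weight t F : Cc_on t F -> weight t F.
Proof.
move=> [cF [K [cK Kt F0]]]; split=> [x nx|]; first by apply: F0 => /Kt.
have [B B0 FB] := compact_bounded_complex cK cF; exists B => x.
by have [/FB//|/F0 ->] := pselect (K x); rewrite normc0.
Qed.

Lemma Cc_onD t F E : Cc_on t F -> Cc_on t E -> Cc_on t (fun x => F x + E x : C).
Proof.
move=> [cF [K [cK Kt F0]]] [cE [L [cL Lt E0]]]; split.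
  by move=> x; exact: cvgD (cF x) (cE x).
exists (K `|` L); split; first exact: compactU.
  by move=> x [/Kt|/Lt].
by move=> x /not_orP[nK nL]; rewrite F0// E0// addr0.
Qed.

Lemma Cc_onZ t F (c : C) : Cc_on t F -> Cc_on t (fun x => (c : R[i]) * F x : C).
Proof.
move=> [cF [K [cK Kt F0]]]; split.
  by move=> x; apply: cvgM_complex (cF x); exact: cvg_cst.
by exists K; split=> // x nK; rewrite F0// mulr0.
Qed.

Lemma Cc_onM t u F E : Cc_on t F -> Cc_on u E ->
  Cc_on (t * u)%g (fun x => (F x : R[i]) * E (th t x) : C).
Proof.
move=> [cF [K [cK Kt F0]]] [cE [L [cL Lu E0]]].
have nF x : ~ K x -> (F x : R[i]) * E (th t x) = 0 by move=> /F0 ->;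
  rewrite mul0r.
split.
  apply: (continuous_compact_support hX cK nF) => x Kx.
  apply: cvgM_complex (cF x) _.
  exact: continuous_comp (th_continuous (Kt x Kx)) (cE _).
exists (K `&` [set x | L (th t x)]); split.
- apply: (subclosed_compact _ cK); last by move=> x [].
  move=> x clx; have Kx : K x.
    by apply: (compact_closed hX cK) => B /clx[y [[Ky _] By]]; exists y.
  split=> //; apply: (compact_closed hX cL) => B nB.
  have [y [[_ Ly] By]] := clx _ (th_continuous (Kt x Kx) nB).
  by exists (th t y).
- by move=> x [/Kt tx /Lu ux]; exact: domM.
move=> x /not_andP[|nL]; first exact: nF.
by rewrite E0// mulr0.
Qed.

Lemma Cc_on_adj t F : Cc_on t F -> Cc_on t^-1%g (adjweight t F).
Proof.
move=> [cF [K [cK Kt F0]]]; pose K' := (fun x => th t x) @` K.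
have cK' : compact K'.
  apply: continuous_compact cK; apply: continuous_in_subspaceT => x /set_mem Kx.
  exact: th_continuous (Kt x Kx).
have K't : K' `<=` dom t^-1%g by move=> _ [x Kx <-]; apply: domV => //;
  exact: Kt.
have nF x : ~ K' x -> adjweight t F x = 0.
  move=> nK; rewrite /adjweight; case: pselect => // h.
  rewrite F0 ?conjc0// => Kx; apply: nK; exists (th t^-1%g x) => //.
  by have := thV h; rewrite invgK.
split; last by exists K'.
apply: (continuous_compact_support hX cK' nF) => x /K't tx.
have ex : adjweight t F x = conjc (F (th t^-1%g x)).
  by rewrite /adjweight; case: pselect.
rewrite /prop_for /continuous_at ex; apply: cvg_trans; last first.
  have h : {for x, continuous (F \o (fun y => th t^-1%g y))}.
    exact: continuous_comp (th_continuous tx) (cF _).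
  exact: cvg_conjc h.
apply: near_eq_cvg; apply: filterS (dom_open tx) => y ty.
by rewrite /adjweight; case: pselect.
Qed.

Inductive slice_span : op -> Prop :=
| slice_span0 : slice_span 0
| slice_span_add t F T : Cc_on t F -> slice_span T ->
    slice_span (wshift t F + T).

Lemma slice_span1 t F : Cc_on t F -> slice_span (wshift t F).
Proof.
by move=> cF; rewrite -[wshift t F]addr0; apply: slice_span_add => //;
  exact: slice_span0.
Qed.

Lemma slice_spanD S T : slice_span S -> slice_span T -> slice_span (S + T).
Proof.
elim=> [|t F S' cF _ IH] sT; first by rewrite add0r.
by rewrite -addrA; apply: slice_span_add => //; exact: IH.
Qed.

Lemma slice_spanZ (c : C) T : slice_span T -> slice_span (c *: T).
Proof.
elim=> [|t F S' cF _ IH]; first by rewrite scaler0; exact: slice_span0.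
rewrite scalerDr -wshiftZ//; last exact: Cc_on_weight.
by apply: slice_span_add => //; exact: Cc_onZ.
Qed.

Lemma slice_span_bounded : slice_span `<=` @bounded_op R G.
Proof.
move=> T; elim=> [|t F S cF _ IH]; first exact: bounded0.
by apply: boundedD IH; apply: wshift_bounded => //; exact: Cc_on_weight.
Qed.

Lemma slice_span_comp S T : slice_span S -> slice_span T -> slice_span (S \o T).
Proof.
elim=> [|t F S' cF sS' IH] sT; first exact: slice_span0.
have -> : (wshift t F + S') \o T = (wshift t F \o T) + (S' \o T) by [].
apply: slice_spanD; last exact: IH.
have wF := Cc_on_weight cF.
elim: sT => [|u E T' cE _ IHT].
  have -> : wshift t F \o (0 : op) = 0.
    by apply/funext => xi; rewrite /= (lin0 (wshift_linear wF)).
  exact: slice_span0.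
have -> : wshift t F \o (wshift u E + T') =
    (wshift t F \o wshift u E) + (wshift t F \o T').
  by apply/funext => xi; exact: (linD (wshift_linear wF)).
apply: slice_spanD IHT; rewrite wshiftM//; last exact: Cc_on_weight.
by apply: slice_span1; exact: Cc_onM.
Qed.

Lemma slice_span_adjoint T : slice_span T ->
  exists2 T', slice_span T' & adjoint_ops T T'.
Proof.
elim=> [|t F S cF _ [S' sS' SS']].
  exists 0; first exact: slice_span0.
  move=> xi eta; change (inner (0 : H) eta = inner xi 0).
  by rewrite -(scale0r (0 : H)) innerZl innerZr conjc0 !mul0r.
exists (wshift t^-1%g (adjweight t F) + S').
  by apply: slice_span_add => //; exact: Cc_on_adj.
by apply: adjoint_opsD => //; apply: adjoint_wshift => //; exact: Cc_on_weight.
Qed.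

(** ** Comparison with C_c(G) *)

Definition slice (f : G -> C) t x : C :=
  if pselect (dom t x) is left h then f (mkG h) else 0.

Lemma sliceE f gamma : slice f (cocycle gamma) (pt gamma) = f gamma.
Proof.
rewrite /slice; case: pselect => [h|nh]; last by have := gpdP gamma.
by congr f; apply: gpd_eq.
Qed.

Lemma slice_out f t x : ~ dom t x -> slice f t x = 0.
Proof. by rewrite /slice; case: pselect. Qed.

Definition unslice t F gamma : C := if cocycle gamma == t then F (pt gamma) else 0.

Lemma slice_unslice t u F x : (forall x, ~ dom t x -> F x = 0) ->
  slice (unslice t F) u x = if u == t then F x else 0.
Proof.
move=> F0; rewrite /slice /unslice; case: pselect => [h|nh] /=; first by [].
by case: eqP => // e; rewrite F0// -e.
Qed.

Lemma unslice_continuous t F : continuous F -> continuous (unslice t F).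
Proof.
move=> cF gamma;
  apply/(@cvg_complexP _ _ (nbhs gamma) _ _ (nbhs_filter gamma)) => e e0.
have near_eq : nbhs gamma [set g' | cocycle g' = cocycle gamma].
  exact: near_cocycle.
have [et|nt] := eqVneq (cocycle gamma) t; last first.
  move: near_eq; apply: filterS => g' /= eg.
  by rewrite /unslice eg (negPf nt) subrr normc0.
have h : {for gamma, continuous (F \o pt)}.
  exact: continuous_comp (@pt_continuous gamma) (cF _).
have hF : nbhs gamma [set g' | normc (F (pt gamma) - F (pt g')) < e].
  exact: (cvg_complexP _ _ _).1 h e e0.
apply: filterS (filterI near_eq hF).
by move=> g' [/= eg Fg]; rewrite /unslice eg et eqxx.
Qed.

Lemma slice_compact t (K : set X) : compact K -> K `<=` dom t ->
  compact [set gamma : G | cocycle gamma = t /\ K (pt gamma)].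
Proof.
move=> cK Kt; set S := [set gamma | _] => W PW WS.
have WK : (pt @ W) K by apply: (@filterS _ W _ S) WS => gamma [_ Kg].
have [x [Kx clx]] := cK (pt @ W) _ WK.
exists (mkG (Kt x Kx)); split; first by split.
move=> A B WA /nbhs_gpd[V nV VB].
have WAS : W (pt @^-1` (pt @` (A `&` S))).
  by apply: (@filterS _ W _ (A `&` S)) (filterI WA WS) => gamma ?; exists gamma.
have [_ [[gamma [Ag [e _]] <-] Vg]] := clx _ _ WAS nV.
by exists gamma; split=> //; exact: VB.
Qed.

Lemma Cc_unslice t F : Cc_on t F -> Cc (unslice t F).
Proof.
move=> [cF [K [cK Kt F0]]]; split; first exact: unslice_continuous.
have near_eq gamma : nbhs gamma [set g' | cocycle g' = cocycle gamma].
  exact: near_cocycle.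
have cS := slice_compact cK Kt.
apply: (subclosed_compact (@closed_closure _ _) cS) => gamma clg.
have [e Kg] : cocycle gamma = t /\ closure K (pt gamma); last first.
  by split=> //; exact: (compact_closed hX cK).
split.
  have [g' [/= nz e]] := clg _ (near_eq gamma).
  rewrite -e; apply/eqP; apply: contraNT nz => nt.
  by rewrite /unslice (negPf nt).
move=> B nB; have nB' : nbhs gamma (pt @^-1` B) by exact: pt_continuous.
have [g' [/= nz Bg]] := clg _ nB'; exists (pt g'); split=> //.
apply: contrapT => nK; move: nz.
by rewrite /unslice F0// if_same eqxx.
Qed.

Lemma Cc_on_slice f t : Cc f -> Cc_on t (slice f t).
Proof.
move=> [cf cK0].
pose K := pt @` (supp f `&` [set gamma | cocycle gamma = t]).
have clt : closed [set gamma : G | cocycle gamma = t].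
  by move=> gamma clg; have [g' [/= <- e]] := clg _ (near_cocycle gamma).
have cK : compact K.
  apply: continuous_compact; last exact: compact_closedI.
  by apply: continuous_subspaceT; exact: pt_continuous.
have Kt : K `<=` dom t by move=> _ [gamma [_ /= <-] <-]; exact: gpdP.
have nF x : ~ K x -> slice f t x = 0.
  move=> nK; rewrite /slice; case: pselect => // h.
  apply/eqP; apply: contrapT => /negP fN0; apply: nK.
  by exists (mkG h) => //; split=> //; exact: subset_closure.
split; last by exists K.
apply: (continuous_compact_support hX cK nF) => x /Kt tx.
apply/cvg_complexP => e e0.
have /nbhs_gpd[V nV VB] : nbhs (mkG tx) [set g | normc (f (mkG tx) - f g) < e].
  exact: (@cvg_complexP _ _ _ _ _ (nbhs_filter (mkG tx))).1 (cf (mkG tx)) e e0.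
apply: filterS (filterI nV (dom_open tx)) => y [Vy ty] /=.
rewrite -(sliceE f (mkG tx)) in VB.
have /= := VB (mkG ty) Vy erefl.
by rewrite -(sliceE f (mkG ty)).
Qed.

Lemma Cc_finite f : Cc f -> exists A : {fset Gam},
  forall gamma, f gamma != 0 -> cocycle gamma \in A.
Proof.
move=> [_ /compact_near_coveringP cK].
have totF := @summability.totally_filter Gam.
have := cK {fset Gam} summability.totally
  (fun A gamma => cocycle gamma \in A) _.
case=> [gamma _|A _ /(_ A) h].
  exists ([set g' | cocycle g' = cocycle gamma],
      [set B | [fset cocycle gamma]%fset `<=` B]%fset).
    split; first exact: near_cocycle.
    by exists [fset cocycle gamma]%fset.
  by move=> [g' B] /= [-> /fsubsetP]; apply; rewrite inE.
exists A => gamma nz; apply: h; first exact: fsubset_refl.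
exact: subset_closure.
Qed.

Lemma CcD f (g : G -> C) : Cc f -> Cc g -> Cc (fun gamma => f gamma + g gamma : C).
Proof.
move=> [cf kf] [cg kg]; split; first by move=> gamma; exact: cvgD (cf _) (cg _).
apply: (subclosed_compact (@closed_closure _ _) (compactU kf kg)).
rewrite /supp -closureU; apply: closureS => gamma /= nz.
apply: contrapT => /not_orP[/negP + /negP].
by rewrite !negbK => /eqP f0 /eqP g0; move: nz; rewrite f0 g0 addr0 eqxx.
Qed.

Lemma Cc0 : Cc ((fun=> 0) : G -> C).
Proof.
split; first exact: cst_continuous.
rewrite /supp (_ : [set _ | _] = set0) ?closure0; first exact: compact0.
by apply/seteqP; split=> gamma //=; rewrite eqxx.
Qed.

(** The substitution gamma' = gshift t gamma turns the sum over the elements with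
    the source of gamma into a sum over t, so that f is represented by the sum of
    the weighted shifts given by its slices. *)
Lemma regular_rep_sum (f : G -> C) (A : {fset Gam}) xi gamma :
  (forall gamma, f gamma != 0 -> cocycle gamma \in A) ->
  \sum_(gamma' \in [set gamma' | gsrc gamma' = gsrc gamma])
      (f (gmul gamma (ginv gamma')) : R[i]) * xi gamma' =
  \sum_(t <- A) (slice f t (pt gamma) : R[i]) * xi (gshift t gamma).
Proof.
move=> fA; pose B := [seq t <- A | `[< dom t (pt gamma) >]].
have domB t : t \in B -> dom t (pt gamma).
  by rewrite mem_filter => /andP[/asboolP].
have quot t : dom t (pt gamma) ->
    f (gmul gamma (ginv (gshift t gamma))) = slice f t (pt gamma).
  move=> tg; have e : pt (ginv (gshift t gamma)) = src gamma.
    by rewrite pt_ginv// src_gshift.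
  rewrite -sliceE pt_gmul// cocycle_gmul//; congr slice.
  by rewrite cocycle_ginv// cocycle_gshift// invgM invgK mulgA mulgV mul1g.
rewrite (fsbigE [seq gshift t gamma | t <- B]); first last.
- move=> g' /= /gsrcE e nB; apply/eqP; rewrite mulf_eq0; apply/orP; left.
  apply: contraNT nB => nz; have := fA _ nz.
  have [tg sg] := gshift_divg (esym e).
  rewrite cocycle_gmul ?pt_ginv ?cocycle_ginv//.
  move=> tA; apply/mapP; exists (cocycle gamma * (cocycle g')^-1)%g => //.
  by rewrite mem_filter tA andbT; exact/asboolP.
- move=> _ /= /mapP[t /domB tg ->]; apply/gsrcE => //.
  exact: src_gshift.
- rewrite map_inj_in_uniq ?filter_uniq ?fset_uniq// => t u /domB tg /domB ug.
  move=> /(congr1 (@cocycle _ _ _ _)); rewrite !cocycle_gshift//.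
  by move=> /mulIg /invg_inj.
rewrite big_map big_mkcond /= big_seq [RHS](bigID (fun t => `[< dom t (pt gamma) >])) /=.
rewrite [X in _ = _ + X]big1 ?addr0 => [|t /asboolP nt]; last first.
  by rewrite slice_out// mul0r.
rewrite -[RHS]big_filter -/B [RHS]big_seq; apply: eq_bigr => t tB.
rewrite ifT ?quot//; first exact: domB.
by rewrite inE; apply/gsrcE => //; apply: src_gshift => //; exact: domB.
Qed.

(** * The reduced C*-algebra as the closed span of weighted shifts *)

Lemma slice_span_sum (I : Type) (r : seq I) (t : I -> Gam) (F : I -> X -> C) :
  (forall i, Cc_on (t i) (F i)) -> slice_span (\sum_(i <- r) wshift (t i) (F i)).
Proof.
move=> cF; elim: r => [|i r IH]; first by rewrite big_nil; exact: slice_span0.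
by rewrite big_cons; apply: slice_span_add.
Qed.

Lemma regular_rep_slice_span f T : Cc f -> is_regular_rep f T -> slice_span T.
Proof.
move=> cf [bT TE]; have [A fA] := Cc_finite cf.
have -> : T = \sum_(t <- A) wshift t (slice f t).
  apply/funext => xi; apply: ell2_eq => gamma;
    rewrite TE (regular_rep_sum _ _ fA).
  rewrite opsumE ell2_sum; apply: eq_bigr => t _.
  by rewrite wshiftE//; apply: Cc_on_weight; exact: Cc_on_slice.
by apply: slice_span_sum => t; exact: Cc_on_slice.
Qed.

Lemma slice_span_regular_rep T : slice_span T -> exists2 f, Cc f & is_regular_rep f T.
Proof.
elim=> [|t F S cF _ [f cf [bS SE]]].
  exists (fun=> 0); first exact: Cc0.
  split=> [|xi gamma]; first exact: bounded0.
  by rewrite fsbig1// => g' _; rewrite mul0r.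
have wF := Cc_on_weight cF.
exists (fun gamma => unslice t F gamma + f gamma).
  by apply: CcD cf; exact: Cc_unslice.
split=> [|xi gamma]; first by apply: boundedD => //; exact: wshift_bounded.
have [A fA] := Cc_finite cf; pose B := (t |` A)%fset.
have fB g' : f g' != 0 -> cocycle g' \in B by move=> /fA h; rewrite inE h orbT.
have fB' g' : unslice t F g' + f g' != 0 -> cocycle g' \in B.
  have [->|f0] := eqVneq (f g') 0; last by move=> _; exact: fB.
  rewrite addr0 /unslice !inE; have [//|ne] := eqVneq (cocycle g') t.
  by rewrite eqxx.
rewrite opDE ell2D SE (regular_rep_sum _ _ fB').
rewrite (regular_rep_sum _ _ fB) wshiftE//.
have -> : (F (pt gamma) : R[i]) * xi (gshift t gamma) =
    \sum_(u <- B) (slice (unslice t F) u (pt gamma) : R[i]) * xi (gshift u gamma).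
  rewrite (bigD1_seq t) ?fset_uniq//=; last by rewrite inE in_fset1 eqxx.
  rewrite big1 ?addr0 => [|u /negPf ut].
    by rewrite slice_unslice ?eqxx//; exact: wF.1.
  by rewrite slice_unslice ?ut ?mul0r//; exact: wF.1.
rewrite -big_split /=; apply: eq_bigr => u _; rewrite -mulrDl; congr (_ * _).
by rewrite /slice; case: pselect => h; rewrite ?addr0.
Qed.

Lemma regular_rep_wshift t F : weight t F -> is_regular_rep (unslice t F) (wshift t F).
Proof.
move=> wF; split=> [|xi gamma]; first exact: wshift_bounded.
rewrite (regular_rep_sum (A := [fset t]%fset)); last first.
  move=> g'; rewrite /unslice inE; have [//|ne] := eqVneq (cocycle g') t.
  by rewrite eqxx.
rewrite big_seq_fset1 slice_unslice ?eqxx; last exact: wF.1.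
by rewrite wshiftE.
Qed.

Lemma groupoid_cstarE : cstar = opclosure slice_span.
Proof.
apply/seteqP; split; apply: opclosure_mono => T.
  by move=> [f cf]; exact: regular_rep_slice_span.
by move=> /slice_span_regular_rep[f cf Tf]; exists f.
Qed.

Let bspan : slice_span `<=` @bounded_op R G.
Proof. exact: slice_span_bounded. Qed.

Lemma cstarP T : cstar T <-> bounded_op T /\
  forall eps : R, 0 < eps -> exists2 S, slice_span S & opb (T - S) eps.
Proof. by rewrite groupoid_cstarE; exact: opclosureP. Qed.

Lemma cstar_bounded : cstar `<=` @bounded_op R G.
Proof. exact: opclosure_bounded. Qed.

Lemma slice_span_cstar : slice_span `<=` cstar.
Proof. by rewrite groupoid_cstarE; exact: sub_opclosure. Qed.

Lemma cstar0 : cstar 0.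
Proof. by apply: slice_span_cstar; exact: slice_span0. Qed.

Lemma cstarD S T : cstar S -> cstar T -> cstar (S + T).
Proof. by rewrite groupoid_cstarE; apply: opclosureD => // *;
  exact: slice_spanD. Qed.

Lemma cstarZ (c : C) T : cstar T -> cstar (c *: T).
Proof. by rewrite groupoid_cstarE; apply: opclosureZ => // *;
  exact: slice_spanZ. Qed.

Lemma cstarN T : cstar T -> cstar (- T).
Proof. by rewrite -scaleN1r; exact: cstarZ. Qed.

Lemma cstarB S T : cstar S -> cstar T -> cstar (S - T).
Proof. by move=> cS cT; exact: (cstarD cS (cstarN cT)). Qed.

Lemma cstar_sum (I : Type) (r : seq I) (S : I -> op) :
  (forall i, cstar (S i)) -> cstar (\sum_(i <- r) S i).
Proof.
move=> cS; elim: r => [|i r IH]; first by rewrite big_nil; exact: cstar0.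
by rewrite big_cons; exact: (cstarD (cS i) IH).
Qed.

Lemma cstar_closed : opclosure cstar `<=` cstar.
Proof.
rewrite {2}groupoid_cstarE; apply: opclosureS => //.
by rewrite groupoid_cstarE.
Qed.

Lemma cstar_comp S T : cstar S -> cstar T -> cstar (S \o T).
Proof.
move=> /[dup] cS /cstarP[bS clS] /[dup] cT /cstarP[bT clT]; apply/cstarP.
split=> [|e e0]; first exact: bounded_comp.
have [K K0 SK] := bounded_opb bS; have [L L0 TL] := bounded_opb bT.
pose d := Num.min 1 (e / (K + 1 + L)).
have KL0 : 0 < K + 1 + L by rewrite ltr_wpDr// ltr_wpDl.
have d0 : 0 < d by rewrite lt_min ltr01 divr_gt0.
have [S' sS' SS] := clS d d0; have [T' sT' TT] := clT d d0.
exists (S' \o T'); first exact: slice_span_comp.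
have S'K : opb S' (K + 1).
  have := opbD SK (opbC SS); rewrite addrC subrK.
  by apply: opb_le; rewrite lerD2l ge_min lexx.
have -> : (S \o T) - (S' \o T') = ((S - S') \o T) + (S' \o (T - T')).
  apply/funext => xi.
  change (S (T xi) - S' (T' xi) = S (T xi) - S' (T xi) + S' (T xi - T' xi)).
  by rewrite (linB (bounded_linear (bspan sS'))) addrA subrK.
have := opbD (opb_comp (ltW d0) SS TL) (opb_comp _ S'K TT).
rewrite addr_ge0// => /(_ isT); apply: opb_le.
rewrite (mulrC _ d) -mulrDr -(@ler_pdivlMr _ (L + (K + 1)))//;
  last by rewrite addrC.
by rewrite [X in _ / X]addrC ge_min lexx orbT.
Qed.

Lemma cstar_cauchy (e : nat -> R) (T : nat -> op) :
  (forall d : R, 0 < d -> exists n, e n < d) -> (forall n, 0 <= e n) ->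
  (forall n, cstar (T n)) ->
  (forall n m, (n <= m)%N -> opb (T m - T n) (e n)) ->
  exists2 S, cstar S & forall n, opb (S - T n) (e n).
Proof.
move=> e_small e0 cT Te.
have [|S bS SP] := op_cauchy e_small e0 _ Te.
  by move=> n; exact: cstar_bounded.
exists S => //; apply: cstar_closed; apply/(opclosureP _ cstar_bounded).
split=> // d /e_small[n en]; exists (T n) => //.
exact: opb_le (ltW en) (SP n).
Qed.

Lemma inv_small (d : R) : 0 < d -> exists n, (n.+1%:R^-1 : R) < d.
Proof.
move=> d0; exists (Num.trunc (d^-1)); rewrite -[ltRHS]invrK.
by rewrite ltf_pV2 ?posrE ?invr_gt0//; exact: truncnS_gt.
Qed.

(** Passing to the adjoint preserves bounds, so that the adjoints of a sequence
    of finite sums of slices that tends to T form a Cauchy sequence. *)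
Lemma cstar_adjoint T : cstar T -> exists2 T', cstar T' & adjoint_ops T T'.
Proof.
move=> /[dup] cT /cstarP[bT clT].
pose e n : R := 2 * n.+1%:R^-1.
have e0 n : 0 <= e n by rewrite mulr_ge0.
have e_small d : 0 < d -> exists n, e n < d.
  move=> d0; have [n en] := inv_small (divr_gt0 d0 (ltr0Sn R 1)); exists n.
  by rewrite /e mulrC -ltr_pdivlMr.
have /choice[S SP] n : exists S, slice_span S /\ opb (T - S) n.+1%:R^-1.
  by have [|S ? ?] := clT n.+1%:R^-1; [rewrite invr_gt0 | exists S].
have /choice[S' S'P] n : exists S', slice_span S' /\ adjoint_ops (S n) S'.
  by have [S' ? ?] := slice_span_adjoint (SP n).1; exists S'.
have Se n m : (n <= m)%N -> opb (S' m - S' n) (e n).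
  move=> nm; apply: (@adjoint_opb _ _ (S m - S n)) => //.
    rewrite -scaleN1r -[S' m - S' n]/(S' m + - S' n) -[- S' n]scaleN1r.
    apply: adjoint_opsD; first exact: (S'P m).2.
    have := adjoint_opsZ (-1) (S'P n).2.
    by rewrite conjcN conjc1.
  have := opb_trans (opbC (SP m).2) (SP n).2; apply: opb_le.
  rewrite /e mulr_natl mulr2n lerD2r lef_pV2 ?posrE//.
  by rewrite ler_nat.
have [|T' cT' T'S] := cstar_cauchy e_small e0 _ Se.
  by move=> n; apply: slice_span_cstar; exact: (S'P n).1.
exists T' => //; apply: adjoint_ops_lim => d /e_small[n en].
exists (S n), (S' n); split; first exact: (S'P n).2.
  apply: opb_le (SP n).2; apply: le_trans (ltW en).
  by rewrite /e ler_peMl// ler1n.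
exact: opb_le (ltW en) (T'S n).
Qed.

(** * Fourier coefficients *)

Lemma l2norm_basis (I : choiceType) (i : I) : l2norm (basis_vec i : ell2 R I) = 1.
Proof.
rewrite /l2norm (_ : sqsum _ = 1%E) ?sqrtr1//.
rewrite /sqsum (esumID [set i]) /=; last by move=> j _; exact: sqmodE_ge0.
rewrite !setTI esum_set1 ?sqmodE_ge0// esum1 ?adde0.
  by rewrite /= eqxx /sqmod /= expr1n expr0n addr0.
by move=> j /eqP /negPf ji; rewrite /= ji sqmod0.
Qed.

Lemma coef_le T (K : R) gamma : opb T K -> normc (coef T gamma) <= K.
Proof.
move=> TK; apply: le_trans (normc_le_l2norm _ _) _.
by apply: le_trans (TK _) _; rewrite l2norm_basis mulr1.
Qed.

Lemma coef_wshift t F gamma : weight t F -> coef (wshift t F) gamma = unslice t F gamma.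
Proof.
move=> wF; rewrite /coef wshiftE//= /unslice.
have [tg|ntg] := pselect (dom t (pt gamma)); last first.
  by rewrite wF.1// mul0r if_same.
have [et|nt] := eqVneq (cocycle gamma) t.
  rewrite (_ : gshift t gamma == gsrc gamma) ?mulr1//; apply/eqP.
  have es : pt (gsrc gamma) = src gamma by rewrite /pt val_gsrc.
  apply: gpd_eq; first by rewrite pt_gshift// es /src et.
  by rewrite cocycle_gshift// et mulVg /cocycle val_gsrc.
rewrite (_ : gshift t gamma == gsrc gamma = false) ?mulr0//;
  apply/negP => /eqP e.
move: (congr1 (@cocycle _ _ _ _) e); rewrite cocycle_gshift//.
rewrite {2}/cocycle val_gsrc//= => e1.
by case/eqP: nt; rewrite -[LHS](mulVKg t) e1 mulg1.
Qed.

(** The function of T on the slice c = t, extended by zero to X. *)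
Definition scoef T t : X -> C := slice (coef T) t.

Lemma scoefE T gamma : scoef T (cocycle gamma) (pt gamma) = coef T gamma.
Proof. exact: sliceE. Qed.

Lemma scoef_out T t x : ~ dom t x -> scoef T t x = 0.
Proof. exact: slice_out. Qed.

Lemma scoefD S T t x : scoef (S + T) t x = scoef S t x + scoef T t x.
Proof. by rewrite /scoef /slice; case: pselect => // h; rewrite addr0. Qed.

Lemma scoefZ (c : C) T t x : scoef (c *: T) t x = (c : R[i]) * scoef T t x.
Proof. by rewrite /scoef /slice; case: pselect => // h; rewrite mulr0. Qed.

Lemma scoefB S T t x : scoef (S - T) t x = scoef S t x - scoef T t x.
Proof. by rewrite scoefD -scaleN1r scoefZ mulN1r. Qed.

Lemma scoef_le T (K : R) t x : 0 <= K -> opb T K -> normc (scoef T t x) <= K.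
Proof.
move=> K0 TK; rewrite /scoef /slice; case: pselect => [h|_];
  last by rewrite normc0.
exact: coef_le.
Qed.

Lemma weight_scoef T t : bounded_op T -> weight t (scoef T t).
Proof.
move=> /bounded_opb[K K0 TK]; split; first by move=> x; exact: scoef_out.
by exists K => x; exact: scoef_le.
Qed.

Lemma scoef_wshift t u F x : weight t F ->
  scoef (wshift t F) u x = if u == t then F x else 0.
Proof.
move=> wF; rewrite -slice_unslice ?wF.1//; last by case: wF.
by rewrite /scoef; congr slice; apply/funext => gamma; exact: coef_wshift.
Qed.

(** The projection onto the t-th spectral subspace, T |-> T_t. *)
Definition Fourier t T : op := wshift t (scoef T t).

Lemma Fourier_opb t T (K : R) : 0 <= K -> bounded_op T -> opb T K -> opb (Fourier t T) K.
Proof.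
move=> K0 bT TK; apply: wshift_opb => //; first exact: weight_scoef.
by move=> x; exact: scoef_le.
Qed.

Lemma Fourier_bounded t T : bounded_op T -> bounded_op (Fourier t T).
Proof. by move=> bT; apply: wshift_bounded => //; exact: weight_scoef. Qed.

Lemma FourierD t S T : bounded_op S -> bounded_op T ->
  Fourier t (S + T) = Fourier t S + Fourier t T.
Proof.
move=> bS bT; rewrite /Fourier -wshiftD//; try exact: weight_scoef.
by congr wshift; apply/funext => x; exact: scoefD.
Qed.

Lemma FourierZ t (c : C) T : bounded_op T -> Fourier t (c *: T) = c *: Fourier t T.
Proof.
move=> bT; rewrite /Fourier -wshiftZ//; last exact: weight_scoef.
by congr wshift; apply/funext => x; exact: scoefZ.
Qed.

Lemma FourierB t S T : bounded_op S -> bounded_op T ->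
  Fourier t (S - T) = Fourier t S - Fourier t T.
Proof.
move=> bS bT; rewrite -scaleN1r FourierD ?FourierZ ?scaleN1r//.
by rewrite -scaleN1r; exact: boundedZ.
Qed.

Lemma Fourier_wshift t u F : weight u F ->
  Fourier t (wshift u F) = if t == u then wshift u F else 0.
Proof.
move=> wF; rewrite /Fourier; have [->|/negPf tu] := eqVneq t u.
  by congr wshift; apply/funext => x; rewrite scoef_wshift// eqxx.
rewrite -(wshift0 t); congr wshift; apply/funext => x.
by rewrite scoef_wshift// tu.
Qed.

Lemma Fourier0 t : Fourier t 0 = 0.
Proof.
rewrite -[in LHS](scale0r (0 : op)) FourierZ ?scale0r//; exact: bounded0.
Qed.

Lemma Cc_on_scoef S t : slice_span S -> Cc_on t (scoef S t).
Proof.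
have zero : Cc_on t (fun=> 0).
  split; first exact: cst_continuous.
  by exists set0; split => //; exact: compact0.
elim=> [|u F T cF sT IH].
  rewrite (_ : scoef 0 t = fun=> 0)//; apply/funext => x.
  by rewrite /scoef /slice; case: pselect.
have wF := Cc_on_weight cF.
rewrite (_ : scoef _ t = fun x => (if t == u then F x else 0) + scoef T t x).
  apply: Cc_onD => //; have [->|] := eqVneq t u; last by [].
  exact: cF.
by apply/funext => x; rewrite scoefD scoef_wshift.
Qed.

Lemma Fourier_slice_span t S : slice_span S -> slice_span (Fourier t S).
Proof. by move=> sS; apply: slice_span1; exact: Cc_on_scoef. Qed.

Lemma Fourier_cstar t T : cstar T -> cstar (Fourier t T).
Proof.
move=> /cstarP[bT clT]; apply/cstarP.
split=> [|e e0]; first exact: Fourier_bounded.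
have [S sS TS] := clT e e0; exists (Fourier t S);
  first exact: Fourier_slice_span.
have bS : bounded_op S by apply: slice_span_bounded sS.
by rewrite -FourierB//; apply: Fourier_opb (ltW e0) _ TS; exact: boundedB.
Qed.

Lemma coef_Fourier t T gamma : bounded_op T ->
  coef (Fourier t T) gamma = if cocycle gamma == t then coef T gamma else 0.
Proof.
move=> bT; rewrite coef_wshift; last exact: weight_scoef.
by rewrite /unslice; case: eqP => // <-; rewrite scoefE.
Qed.

(** Coefficients of elements of the C*-algebra are uniform limits of compactly
    supported ones, hence in C_0 of the slice. *)
Lemma scoef_C0 T t (e : R) : cstar T -> 0 < e ->
  continuous (scoef T t) /\
  exists K : set X, [/\ compact K, K `<=` dom t &
    forall x, ~ K x -> normc (scoef T t x) < e].
Proof.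
move=> /cstarP[bT clT] e0; split.
  move=> x; apply/cvg_complexP => d d0.
  have d4 : 0 < d / 4 by exact: divr_gt0.
  have [S sS TS] := clT _ d4; have [cS _] := Cc_on_scoef t sS.
  have near y : normc (scoef T t y - scoef S t y) <= d / 4.
    by rewrite -scoefB; apply: scoef_le TS; exact: ltW.
  have d2 : 0 < d / 2 by exact: divr_gt0.
  apply: filterS ((cvg_complexP _ _ _).1 (cS x) _ d2) => y /= Sxy.
  have -> : scoef T t x - scoef T t y = (scoef T t x - scoef S t x) +
     (scoef S t x - scoef S t y) + (scoef S t y - scoef T t y).
    by rewrite !addrA !subrK.
  apply: le_lt_trans (le_normcD _ _) _.
  have := le_normcD (scoef T t x - scoef S t x) (scoef S t x - scoef S t y).
  have := near x; have := near y; rewrite [normc (_ - scoef T t y)]normcB.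
  by move: Sxy; lra.
have e2 : 0 < e / 2 by exact: divr_gt0.
have [S sS TS] := clT _ e2; have [_ [K [cK Kt K0]]] := Cc_on_scoef t sS.
exists K; split=> // x /K0 Sx; have := scoef_le t x (ltW e2) TS.
by rewrite scoefB Sx subr0; move: e0; lra.
Qed.

(** * Fejer operators *)

Section Fejer.

Variables (B : {fset Gam}) (w : Gam -> R).
Hypothesis w_out : forall r, r \notin B -> w r = 0.
Hypothesis w_ge0 : forall r, 0 <= w r.
Hypothesis w_norm : \sum_(r <- B) w r ^+ 2 = 1.

Let wc (r : Gam) : C := ((w r)%:C)%C.

(** The Cauchy-Schwarz inequality against the unit vector w. *)
Lemma sqmod_wsum_le (b : Gam -> C) :
  sqmod (\sum_(r <- B) (wc r : R[i]) * b r : C) <= \sum_(r <- B) sqmod (b r).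
Proof.
pose m := \sum_(r <- B) w r * normc (b r).
apply: (@le_trans _ _ (m ^+ 2)).
  rewrite sqmodE ler_pXn2r ?nnegrE ?normc_ge0//; last first.
    by apply: sumr_ge0 => r _; rewrite mulr_ge0 ?normc_ge0.
  apply: le_trans (normc_sum _ _ _) _; apply: ler_sum => r _.
  by rewrite normcM normc_real.
have : 0 <= \sum_(r <- B) (normc (b r) - m * w r) ^+ 2.
  by apply: sumr_ge0 => r _; exact: sqr_ge0.
have -> : \sum_(r <- B) (normc (b r) - m * w r) ^+ 2 =
    \sum_(r <- B) sqmod (b r) - m ^+ 2.
  transitivity (\sum_(r <- B) (sqmod (b r) - 2 * m * (w r * normc (b r)) +
      m ^+ 2 * w r ^+ 2)).
    by apply: eq_bigr => r _; rewrite sqmodE; ring.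
  rewrite big_split sumrB /= -!mulr_sumr w_norm -/m; ring.
by rewrite subr_ge0.
Qed.

(** For a finitely supported unit vector w of l^2(Gam) this is the Schur
    multiplier with symbol t |-> <lambda_t w, w>. *)
Definition Fejer T : op := \sum_(r <- B) \sum_(q <- B)
  ((wc r : R[i]) * wc q : C) *: Fourier (r * q^-1)%g T.

Definition damp (s : Gam) xi : H :=
  insubd (0 : H) (fun gamma => (wc (cocycle gamma * s)%g : R[i]) * xi gamma : C).

Lemma sqmod_wc r : sqmod (wc r) = w r ^+ 2.
Proof. by rewrite /sqmod /= expr0n addr0. Qed.

Lemma w_sqr_le1 r : w r ^+ 2 <= 1.
Proof.
have [rB|/w_out ->] := boolP (r \in B); last by rewrite expr0n.
rewrite -w_norm (bigD1_seq r) ?fset_uniq//= lerDl sumr_ge0// => q _.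
exact: sqr_ge0.
Qed.

Lemma dampE s xi gamma : damp s xi gamma = (wc (cocycle gamma * s)%g : R[i]) * xi gamma.
Proof.
rewrite /damp insub_ell2//; apply: le_lt_trans (ell2P xi).
apply: le_esum => g' _; rewrite lee_fin sqmodM sqmod_wc.
by rewrite ler_piMl ?sqmod_ge0// w_sqr_le1.
Qed.

(** The factor w q goes from the coefficients of S to the vector that S is applied
    to; what is left is S itself, whose bound is known. *)
Lemma FejerE S xi gamma : slice_span S ->
  Fejer S xi gamma =
  \sum_(r <- B) (wc r : R[i]) * S (damp ((cocycle gamma)^-1 * r)%g xi) gamma.
Proof.
elim=> [|t F T cF sT IH].
  rewrite /Fejer big1 => [|r _]; last first.
    by rewrite big1// => q _; rewrite Fourier0// scaler0.
  by rewrite big1// => r _; rewrite mulr0.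
have wF := Cc_on_weight cF; have bT := slice_span_bounded sT.
have bw : bounded_op (wshift t F) by exact: wshift_bounded.
have -> : Fejer (wshift t F + T) = Fejer (wshift t F) + Fejer T.
  rewrite /Fejer -big_split /=; apply: eq_bigr => r _.
  rewrite -big_split /=; apply: eq_bigr => q _.
  by rewrite FourierD// scalerDr.
rewrite opDE ell2D IH -[RHS]/(\sum_(r <- B) _).
under [RHS]eq_bigr => r _ do rewrite opDE ell2D mulrDr.
rewrite big_split /=; congr (_ + _).
rewrite /Fejer opsumE ell2_sum; apply: eq_bigr => r _.
rewrite opsumE ell2_sum.
have -> : \sum_(q <- B)
      (((wc r : R[i]) * wc q : C) *: Fourier (r * q^-1)%g (wshift t F)) xi gamma =
    \sum_(q <- B) (if q == (t^-1 * r)%g then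
      (wc r : R[i]) * wc q * wshift t F xi gamma else 0).
  apply: eq_bigr => q _; rewrite Fourier_wshift//.
  have -> : ((r * q^-1)%g == t) = (q == (t^-1 * r)%g).
    apply/eqP/eqP => [<-|->]; first by rewrite invgM invgK -mulgA mulVg mulg1.
    by rewrite invgM invgK mulgA mulgV mul1g.
  by case: ifP => // _; rewrite scaler0.
rewrite -big_mkcond /= (wshiftE xi gamma wF)
  (wshiftE (damp _ xi) gamma wF).
have [tg|ntg] := pselect (dom t (pt gamma)); last first.
  by rewrite wF.1// !mul0r mulr0 big1// => q _; rewrite mulr0.
rewrite dampE cocycle_gshift// !mulgA.
have -> : (t^-1 * cocycle gamma * (cocycle gamma)^-1 * r)%g = (t^-1 * r)%g.
  by rewrite -(mulgA t^-1%g) mulgV mulg1.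
have [trB|trB] := boolP ((t^-1 * r)%g \in B).
  rewrite -big_filter (_ : [seq _ <- _ | _] = [:: (t^-1 * r)%g]); last first.
    apply: perm_small_eq => //; apply: uniq_perm;
      rewrite ?filter_uniq ?fset_uniq// => q.
    by rewrite mem_filter !inE; case: eqP => // ->.
  by rewrite big_seq1; ring.
rewrite big1_seq => [|q /andP[/eqP -> qB]]; last by rewrite qB in trB.
have -> : wc (t^-1 * r)%g = 0 by rewrite /wc w_out.
by rewrite mul0r !mulr0.
Qed.

(** Fejer operators are contractions: at each point the Cauchy-Schwarz
    inequality in l^2(Gam) bounds the square by a sum over the damped copies of
    xi, and the squared norms of these copies add up to that of xi. *)
Lemma Fejer_opb_span S (K : R) : slice_span S -> 0 <= K -> opb S K -> opb (Fejer S) K.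
Proof.
move=> sS K0 SK xi.
rewrite l2norm_leP ?mulr_ge0 ?l2norm_ge0// exprMn EFinM l2norm_sqr.
pose a gamma s : \bar R := (sqmod (S (damp s xi) gamma))%:E.
have a0 gamma s : (0 <= a gamma s)%E by rewrite lee_fin sqmod_ge0.
have pointwise gamma : ((sqmod (Fejer S xi gamma))%:E <=
    \esum_(s in [set: Gam]) a gamma s)%E.
  pose b r := S (damp ((cocycle gamma)^-1 * r)%g xi) gamma.
  apply: (@le_trans _ _ (\sum_(r <- B) (sqmod (b r))%:E)%E).
    by rewrite sumEFin lee_fin FejerE//; exact: sqmod_wsum_le.
  rewrite -(big_map (fun r => (cocycle gamma)^-1 * r)%g xpredT (a gamma)).
  apply: sum_le_esum => //.
  by rewrite map_inj_uniq ?fset_uniq//; exact: mulgI.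
apply: (@le_trans _ _ (\esum_(gamma in [set: G]) \esum_(s in [set: Gam]) a gamma s)%E).
  by apply: le_esum => gamma _; exact: pointwise.
rewrite esum_swap//.
apply: (@le_trans _ _ (\esum_(s in [set: Gam])
    ((K ^+ 2)%:E * \esum_(gamma in [set: G]) (sqmod (damp s xi gamma))%:E))%E).
  apply: le_esum => s _; rewrite -/(sqsum (S (damp s xi))) -l2norm_sqr.
  rewrite -/(sqsum (damp s xi)) -l2norm_sqr -EFinM lee_fin -exprMn.
  by rewrite ler_pXn2r ?nnegrE ?mulr_ge0 ?l2norm_ge0//; exact: SK.
rewrite ge0_esumZl ?sqr_ge0//; last first.
  by move=> s; apply: esum_ge0 => gamma _; exact: sqmodE_ge0.
apply: lee_wpmul2l; first by rewrite lee_fin sqr_ge0.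
rewrite esum_swap; last by move=> s gamma; exact: sqmodE_ge0.
apply: le_esum => gamma _.
have -> : (fun s => (sqmod (damp s xi gamma))%:E) =
    (fun s => (sqmod (xi gamma))%:E * (w (cocycle gamma * s)%g ^+ 2)%:E)%E.
  by apply/funext => s; rewrite dampE sqmodM sqmod_wc mulrC EFinM.
rewrite ge0_esumZl ?sqmod_ge0//; last by move=> s; rewrite lee_fin sqr_ge0.
rewrite -(@reindex_esum _ _ _ [set: Gam] [set: Gam] (fun s => cocycle gamma * s)%g
  (fun r => (w r ^+ 2)%:E)); last first.
  split => // [s r _ _ /mulgI //|s _].
  by exists ((cocycle gamma)^-1 * s)%g => //=; rewrite mulVKg.
rewrite (@esum_fset_supp _ _ B) => [|r|r /w_out ->].
- by rewrite sumEFin w_norm mule1.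
- by rewrite lee_fin sqr_ge0.
by rewrite expr0n.
Qed.

End Fejer.

Section FixedVector.
Variables (B : {fset Gam}) (w : Gam -> R).
Hypothesis w_out : forall r, r \notin B -> w r = 0.
Hypothesis w_ge0 : forall r, 0 <= w r.
Hypothesis w_norm : \sum_(r <- B) w r ^+ 2 = 1.
Local Notation Fej := (Fejer B w).

Lemma FejerD S T : bounded_op S -> bounded_op T -> Fej (S + T) = Fej S + Fej T :> op.
Proof.
move=> bS bT; rewrite /Fejer -big_split /=; apply: eq_bigr => r _.
by rewrite -big_split /=; apply: eq_bigr => q _; rewrite FourierD// scalerDr.
Qed.

Lemma FejerN T : bounded_op T -> Fej (- T) = - Fej T :> op.
Proof.
move=> bT; rewrite /Fejer -[RHS]scaleN1r scaler_sumr; apply: eq_bigr => r _.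
rewrite scaler_sumr; apply: eq_bigr => q _.
by rewrite -scaleN1r FourierZ// scalerA mulrC -scalerA.
Qed.

Lemma Fejer_wshift t F : Cc_on t F ->
  Fej (wshift t F) = ((\sum_(r <- B) w r * w (t^-1 * r)%g)%:C)%C *: wshift t F :> op.
Proof.
move=> cF; have wF := Cc_on_weight cF; have sF := slice_span1 cF.
apply/funext => xi; apply: ell2_eq => gamma.
rewrite (FejerE w_out w_norm _ _ sF) opZE ell2Z (wshiftE xi gamma wF).
rewrite rmorph_sum mulr_suml; apply: eq_bigr => r _.
rewrite (wshiftE _ gamma wF).
have [tg|ntg] := pselect (dom t (pt gamma));
  last by rewrite wF.1// !mul0r !mulr0.
rewrite (dampE w_out w_norm) cocycle_gshift//.
have -> : (t^-1 * cocycle gamma * ((cocycle gamma)^-1 * r))%g = (t^-1 * r)%g.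
  by rewrite mulgA -(mulgA t^-1%g) mulgV mulg1.
by rewrite rmorphM; ring.
Qed.

Lemma Fejer_crude_opb : exists2 L : R, 0 <= L & forall T K, 0 <= K ->
  bounded_op T -> opb T K -> opb (Fej T : op) (L * K).
Proof.
exists (\sum_(r <- B) \sum_(q <- B) normc ((((w r)%:C)%C : R[i]) * ((w q)%:C)%C)).
  by rewrite sumr_ge0// => r _; rewrite sumr_ge0// => q _; exact: normc_ge0.
move=> T K K0 bT TK; rewrite /Fejer mulr_suml; apply: opb_sum => r _.
rewrite mulr_suml; apply: opb_sum => q _; apply: opbZ.
exact: Fourier_opb.
Qed.

Lemma Fejer_opb T (K : R) : cstar T -> 0 <= K -> opb T K -> opb (Fej T : op) K.
Proof.
move=> /cstarP[bT clT] K0 TK.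
have [L L0 crude] := Fejer_crude_opb.
move=> xi; apply/ler_addgt0Pr => e e0.
pose N := (1 + L) * l2norm xi + 1.
have N0 : 0 < N by rewrite ltr_wpDl// mulr_ge0 ?l2norm_ge0// addr_ge0.
pose d := e / N; have d0 : 0 < d by exact: divr_gt0.
have [S sS TS] := clT d d0;
  have bS : bounded_op S by exact: slice_span_bounded sS.
have SK : opb S (K + d).
  by have := opbD TK (opbC TS); rewrite addrC subrK.
have FS := Fejer_opb_span w_out w_ge0 w_norm sS (addr_ge0 K0 (ltW d0)) SK.
have FD := crude (T - S) d (ltW d0) (boundedB bT bS) TS.
have -> : Fej T = Fej S + Fej (T - S) :> op.
  by rewrite -FejerD//; [rewrite addrC subrK | exact: boundedB].
apply: le_trans (opbD FS FD xi) _.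
have -> : (K + d + L * d) * l2norm xi = K * l2norm xi + d * ((1 + L) * l2norm xi) by ring.
rewrite lerD2l /d mulrAC ler_pdivrMr// ler_wpM2l ?(ltW e0)//.
by rewrite /N lerDl.
Qed.

End FixedVector.

(** A slice over t is scaled by <lambda_t w, w>, close to 1 when the unit vector w
    is almost invariant under t. *)
Lemma Fejer_near_span S (e : R) : slice_span S -> 0 < e ->
  exists (T0 : {fset Gam}) (d : R), 0 < d /\
  forall (B : {fset Gam}) (w : Gam -> R), (forall r, r \notin B -> w r = 0) ->
    \sum_(r <- B) w r ^+ 2 = 1 ->
    (forall t, t \in T0 -> `|\sum_(r <- B) w r * w (t^-1 * r)%g - 1| <= d) ->
  opb (S - Fejer B w S) e.
Proof.
move=> sS; elim: sS e => [|t F S' cF sS' IH] e e0.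
  exists fset0, 1; split=> // B w wo wn _.
  rewrite (_ : Fejer B w 0 = 0) ?subr0;
    first exact: opb_le (ltW e0) (@opb0 _ _).
  rewrite /Fejer big1// => r _; rewrite big1// => q _.
  by rewrite Fourier0// scaler0.
have e2 : 0 < e / 2 by exact: divr_gt0.
have [T0 [d [d0 near]]] := IH _ e2.
have wF := Cc_on_weight cF.
have [K K0 FK] := bounded_opb (wshift_bounded wF).
have K1 : 0 < K + 1 by rewrite ltr_wpDl.
exists (t |` T0)%fset, (Num.min d (e / 2 / (K + 1))); split.
  by rewrite lt_min d0 divr_gt0.
move=> B w wo wn wt.
have bS' := slice_span_bounded sS'.
rewrite FejerD//; last exact: wshift_bounded.
rewrite opprD addrACA [e]splitr; apply: opbD; last first.
  apply: near => // u uT; apply: (le_trans (wt u _));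
    first by rewrite inE uT orbT.
  by rewrite ge_min lexx.
rewrite Fejer_wshift//; set phi := \sum_(r <- B) _.
have -> : wshift t F - (phi%:C)%C *: wshift t F = ((1 - phi)%:C)%C *: wshift t F.
  by rewrite rmorphB scalerBl scale1r.
apply: opb_le (opbZ _ FK).
rewrite (_ : normc _ = `|1 - phi|); last by rewrite /= expr0n addr0 sqrtr_sqr.
rewrite distrC; apply: (@le_trans _ _ (e / 2 / (K + 1) * K)).
  apply: ler_wpM2r => //; apply: le_trans (wt t _) _;
    first by rewrite !inE eqxx.
  by rewrite ge_min lexx orbT.
by rewrite mulrAC ler_pdivrMr// ler_wpM2l ?(ltW e2)// lerDl.
Qed.

(** Fejer operators are contractions, so their convergence to the identity passes
    from finite sums of slices to all T. *)
Lemma Fourier_approx T (e : R) : cstar T -> 0 < e ->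
  exists s : seq (C * Gam), opb (T - \sum_(k <- s) k.1 *: Fourier k.2 T) e.
Proof.
move=> /[dup] cT /cstarP[bT clT] e0.
have e3 : 0 < e / 3 by exact: divr_gt0.
have [S sS TS] := clT _ e3; have bS := slice_span_bounded sS.
have [T0 [d [d0 near]]] := Fejer_near_span sS e3.
have [B [w [w0 wo wn wt]]] := almost_invariant_vector amen T0 d0.
exists [seq ((((w k.1)%:C)%C : R[i]) * ((w k.2)%:C)%C : C, (k.1 * k.2^-1)%g) |
  k <- [seq (r, q) | r <- B, q <- B]].
rewrite big_map big_allpairs /= -/(Fejer B w T).
have cS : cstar S by exact: slice_span_cstar.
have FTS := Fejer_opb wo w0 wn (cstarB cS cT) (ltW e3) (opbC TS).
rewrite FejerD ?FejerN// in FTS; last exact: boundedN.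
have := opb_trans (opb_trans TS (near B w wo wn wt)) FTS.
by apply: opb_le; lra.
Qed.

Lemma coef_eq0 T : cstar T -> (forall gamma, coef T gamma = 0) -> T = 0.
Proof.
move=> cT T0; apply: opb_small_eq0 => e e0.
have [s] := Fourier_approx cT e0.
rewrite big1 ?subr0// => k _.
rewrite (_ : Fourier k.2 T = 0) ?scaler0//.
rewrite /Fourier -(wshift0 k.2); congr wshift; apply/funext => y.
by rewrite /scoef /slice; case: pselect.
Qed.

(** * Diagonal bimodules *)

Definition C0X F := continuous F /\
  forall e : R, 0 < e -> exists2 K : set X, compact K & forall x, ~ K x -> normc (F x) < e.

Lemma C0X_bounded F : C0X F -> exists K : R, forall x, normc (F x) <= K.
Proof.
move=> [cF F0]; have [K cK FK] := F0 1 ltr01.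
have [L L0 FL] := compact_bounded_complex cK cF; exists (L + 1) => x.
have [Kx|nKx] := pselect (K x).
  by apply: le_trans (FL x Kx) _; rewrite lerDl.
by apply: le_trans (ltW (FK x nKx)) _; rewrite lerDr.
Qed.

Lemma C0X_weight F : C0X F -> weight 1%g F.
Proof.
move=> /C0X_bounded[K FK]; split; last by exists K.
by move=> x nx; case: nx; exact: dom1.
Qed.

Lemma C0XMr F E (B : R) : C0X F -> continuous E -> (forall x, normc (E x) <= B) ->
  C0X (fun x => (F x : R[i]) * E x : C).
Proof.
move=> [cF F0] cE EB; split=> [x|e e0]; first exact: cvgM_complex (cF x) (cE x).
have B1 : 0 < `|B| + 1 by rewrite ltr_wpDl.
have [K cK FK] := F0 _ (divr_gt0 e0 B1); exists K => // x nK.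
rewrite normcM; apply: (@le_lt_trans _ _ (normc (F x) * (`|B| + 1))).
  rewrite ler_wpM2l ?normc_ge0//; apply: le_trans (EB x) _.
  by apply: le_trans (ler_norm B) _; rewrite lerDl.
by rewrite -ltr_pdivlMr//; exact: FK.
Qed.

Lemma gunitsE gamma : gunits P theta gamma <-> cocycle gamma = 1%g.
Proof.
split=> [[g _ <-]|e]; first by rewrite /cocycle val_grng.
exists gamma => //; apply: gpd_eq; first by rewrite /pt val_grng.
by rewrite e /cocycle val_grng.
Qed.

Lemma diagonal_wshift F : C0X F -> Defs.diagonal (wshift 1%g F).
Proof.
move=> /[dup] zF [cF F0]; have wF := C0X_weight zF.
exists (unslice 1%g F); last exact: regular_rep_wshift.
split.
- by apply: continuous_subspaceT; exact: unslice_continuous.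
- by move=> gamma nu; rewrite /unslice; case: eqP => // /gunitsE.
move=> e e0; have [K cK FK] := F0 e e0.
have Kdom : K `<=` dom 1%g by move=> x _; exact: dom1.
exists [set gamma | cocycle gamma = 1%g /\ K (pt gamma)]; split.
- by move=> gamma [/gunitsE].
- exact: slice_compact.
move=> gamma /gunitsE e1 nK; rewrite normcE_norm ltcR /unslice e1 eqxx.
by apply: FK => Kx; apply: nK.
Qed.

Variable M : set op.
Hypothesis dM : diagonal_bimodule M.

Lemma bim_cstar : M `<=` cstar. Proof. by case: dM. Qed.

Lemma bim_bounded : M `<=` @bounded_op R G.
Proof. by move=> T /bim_cstar; exact: cstar_bounded. Qed.

Lemma bim0 : M 0. Proof. by case: dM => _ []. Qed.

Lemma bimD S T : M S -> M T -> M (S + T).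
Proof. by move=> MS MT; case: dM => _ [_ /(_ 1 S T MS MT)];
  rewrite scale1r. Qed.

Lemma bimZ (c : C) T : M T -> M (c *: T).
Proof. by move=> MT; case: dM => _ [_ /(_ c T 0 MT bim0)]; rewrite addr0. Qed.

Lemma bim_sum (I : Type) (r : seq I) (F : I -> op) :
  (forall i, M (F i)) -> M (\sum_(i <- r) F i).
Proof.
move=> MF; elim: r => [|i r IH]; first by rewrite big_nil; exact: bim0.
by rewrite big_cons; exact: bimD.
Qed.

Lemma bim_lim T : bounded_op T ->
  (forall e : R, 0 < e -> exists2 S, M S & opb (T - S) e) -> M T.
Proof.
by move=> bT h; case: dM => _ _ + _; apply; apply/(opclosureP _ bim_bounded).
Qed.

Lemma bim_mul t F E : C0X E -> weight t F -> M (wshift t F) ->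
  M (wshift t (fun x => (E x : R[i]) * F x)).
Proof.
move=> zE wF MF; have [_ _ _ bim] := dM.
have [_] := bim _ _ MF (diagonal_wshift zE).
rewrite wshiftM//; last exact: C0X_weight.
rewrite mul1g; congr (M (wshift t _)); apply/funext => x.
by rewrite th1.
Qed.

Section Slice.
Variables (t : Gam) (T : op).
Hypothesis cT : cstar T.
Local Notation a := (scoef T t).

Lemma scoef_C0X S u : cstar S -> C0X (scoef S u).
Proof.
move=> cS; split; first exact: (scoef_C0 u cS ltr01).1.
move=> e e0; have [_ [K [cK _ FK]]] := scoef_C0 u cS e0.
by exists K.
Qed.

(** The positive elements of the ideal that M cuts out on the slice over t, tested
    against the coefficient a of T; the free factor g allows the division by
    d + rho below. *)
Definition multiplier_of (rho : X -> R) :=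
  [/\ exists L, forall x, 0 <= rho x <= L,
      continuous (fun x => ((rho x)%:C)%C : C) &
      forall (g : X -> C) (B : R), continuous g -> (forall x, normc (g x) <= B) ->
        M (wshift t (fun x => (a x : R[i]) * g x * ((rho x)%:C)%C))].

Lemma weight_multiplier rho (g : X -> C) (B : R) : multiplier_of rho ->
  (forall x, normc (g x) <= B) ->
  weight t (fun x => (a x : R[i]) * g x * ((rho x)%:C)%C : C).
Proof.
move=> [[L rL] _ _] gB; have wa := weight_scoef t (cstar_bounded cT).
rewrite (_ : (fun x => _) = fun x => ((g x : R[i]) * ((rho x)%:C)%C : C) * a x); last first.
  by apply/funext => x; rewrite -mulrA mulrC.
apply: (weightMl (K := B * L)) => // x.
have /andP[r0 rl] := rL x; rewrite normcM normc_real//.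
by apply: ler_pM => //; exact: normc_ge0.
Qed.

Lemma multiplier_of0 : multiplier_of (fun=> 0).
Proof.
split; first by exists 0 => x; rewrite lexx.
  exact: cst_continuous.
move=> g B _ _; rewrite (_ : wshift t _ = 0); first exact: bim0.
by rewrite -(wshift0 t); congr wshift; apply/funext => x; rewrite mulr0.
Qed.

Lemma multiplier_ofD rho rho' : multiplier_of rho -> multiplier_of rho' ->
  multiplier_of (fun x => rho x + rho' x).
Proof.
move=> m m'; have [[L rL] crho Mrho] := m; have [[L' rL'] crho' Mrho'] := m'.
split.
- exists (L + L') => x; have /andP[r0 rl] := rL x; have /andP[r0' rl'] := rL' x.
  by rewrite addr_ge0//= lerD.
- move=> x;
  rewrite (_ : (fun x => _) = fun x => ((rho x)%:C)%C + ((rho' x)%:C)%C : C).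
    exact: cvgD (crho x) (crho' x).
  by apply/funext => y; rewrite rmorphD.
move=> g B cg gB; have := bimD (Mrho g B cg gB) (Mrho' g B cg gB).
rewrite -wshiftD//; [|exact: weight_multiplier gB|exact: weight_multiplier gB].
congr (M (wshift t _)); apply/funext => x.
by rewrite rmorphD mulrDr.
Qed.

Hypothesis stable : forall S u, M S -> M (Fourier u S).

Lemma multiplier_of_coef S : M S -> multiplier_of (fun x => sqmod (scoef S t x)).
Proof.
move=> MS; have cS := bim_cstar MS; pose s := scoef S t.
have zs : C0X s by exact: scoef_C0X.
have sE x : (((sqmod (s x))%:C)%C : C) = (s x : R[i]) * conjc (s x).
  by rewrite -sqr_normc normcE_norm sqmodE rmorphXn.
have [K sK] := C0X_bounded zs.
split.
- exists (K ^+ 2) => x;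
  have K0 : 0 <= K by exact: le_trans (normc_ge0 _) (sK x).
  by rewrite sqmod_ge0 sqmodE ler_pXn2r ?nnegrE ?normc_ge0//; exact: sK.
- move=> x;
  rewrite (_ : (fun x => _) = fun x => (s x : R[i]) * conjc (s x) : C).
    by apply: cvgM_complex (zs.1 x) _; exact: cvg_conjc (zs.1 x).
  by apply/funext => y; exact: sE.
move=> g B cg gB.
have zE : C0X (fun x => (a x : R[i]) * ((g x : R[i]) * conjc (s x)) : C).
  apply: (C0XMr (B := B * K)); first exact: scoef_C0X.
    by move=> x; apply: cvgM_complex (cg x) _; exact: cvg_conjc (zs.1 x).
  move=> x; rewrite normcM normcJ_eq; apply: ler_pM => //; exact: normc_ge0.
have ws : weight t s by apply: weight_scoef; exact: cstar_bounded.
have := bim_mul zE ws (stable t MS).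
congr (M (wshift t _)); apply/funext => x.
by rewrite [in RHS]sE; ring.
Qed.

(** The elements of M concentrated on a slice form an ideal of functions on the
    slice, and such an ideal contains every function of C_0 that vanishes where
    it does: on a compact set a finite sum rho of squared moduli is bounded
    below, and a rho / (d + rho) is then uniformly close to a. *)
Lemma Fourier_in_bimodule : (forall gamma, ~ sigma M gamma -> coef T gamma = 0) ->
  M (Fourier t T).
Proof.
move=> T0; have bT := cstar_bounded cT.
have wa := weight_scoef t bT.
have za := scoef_C0X t cT; have [A aA] := C0X_bounded za.
have A0 : 0 <= `|A| by [].
have aA' x : normc (a x) <= `|A| by apply: le_trans (aA x) (ler_norm A).
apply: bim_lim; first exact: Fourier_bounded.
move=> e e0.
have [_ [K0 [cK0 _ K0a]]] := scoef_C0 t cT e0.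
pose K := K0 `&` [set x | e <= normc (a x)].
have Ka x : ~ K x -> normc (a x) < e.
  by move=> /not_andP[/K0a//|/negP]; rewrite -ltNge.
have cK : compact K.
  apply: compact_closedI => // x clx; rewrite /= leNgt; apply/negP => ae.
  have [y [/= h1 h2]] := clx _ (near_normc_lt (za.1 x) ae).
  by rewrite leNgt h2 in h1.
pose D : set ((X -> R) * R) := [set p | multiplier_of p.1 /\ 0 < p.2].
pose above (p : (X -> R) * R) : set ((X -> R) * R) :=
  [set q | D q /\ (forall x, p.1 x <= q.1 x) /\ q.2 <= p.2].
(* Lower bounds near each point are glued by compactness of K, along the filter
   of the pairs (rho, lam) that improve on a given one. *)
have FF : Filter (filter_from D above).
  apply: filter_from_filter.
    by exists ((fun=> 0), 1); split=> //=; exact: multiplier_of0.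
  move=> [r1 e1] [r2 e2] [m1 p1] [m2 p2] /=.
  exists ((fun x => r1 x + r2 x), Num.min e1 e2).
    by split; [exact: multiplier_ofD | rewrite /= lt_min p1 p2].
  move=> q [Dq [/= le1 le2]].
  have [[L1 h1] _ _] := m1; have [[L2 h2] _ _] := m2.
  split; (split=> //; split=> [x /=|/=]).
  - by apply: le_trans (le1 x); rewrite lerDl; have /andP[] := h2 x.
  - by apply: le_trans le2 _; rewrite ge_min lexx.
  - by apply: le_trans (le1 x); rewrite lerDr; have /andP[] := h1 x.
  - by apply: le_trans le2 _; rewrite ge_min lexx orbT.
have [rho [lam [[mrho lam0] rhoK]]] : exists rho lam, D (rho, lam) /\
    forall x, K x -> lam <= rho x.
  have := (compact_near_coveringP K).1 cK _ _ (fun p x => p.2 <= p.1 x) FF.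
  case=> [x [_ /= ax]|[rho lam] Dp h].
    have aN0 : a x != 0.
      by apply/eqP => a0; move: ax; rewrite a0 normc0 leNgt e0.
    have tx : dom t x.
      by apply: contrapT => ntx; rewrite scoef_out// eqxx in aN0.
    have [S MS sN0] : sigma M (mkG tx).
      apply: contrapT => /T0 h; case/eqP: aN0.
      by rewrite -h; exact: (scoefE T (mkG tx)).
    pose s := scoef S t.
    have ex : coef S (mkG tx) = s x by exact: esym (scoefE S (mkG tx)).
    rewrite ex in sN0.
    have sp : 0 < sqmod (s x).
      rewrite lt_neqAle sqmod_ge0 andbT eq_sym; apply: contra sN0 => /eqP.
      by rewrite sqmodE => /eqP; rewrite sqrf_eq0 => /eqP/eq0_normc ->.
    have ms := multiplier_of_coef MS.
    pose p : (X -> R) * R := ((fun x => sqmod (s x)), sqmod (s x) / 2).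
    have near_s : nbhs x [set y | sqmod (s x) / 2 < sqmod (s y)].
      have h : sqmod (s x) / 2 < normc (((sqmod (s x))%:C)%C : C).
        by rewrite normc_real ?sqmod_ge0//; move: sp; lra.
      have [_ cms _] := ms.
      have := near_normc_gt (cms x) h; apply: filterS => y hy.
      change (is_true (sqmod (s x) / 2 < normc (((sqmod (s y))%:C)%C : C))) in hy.
      by rewrite normc_real ?sqmod_ge0 in hy.
    exists ([set y | sqmod (s x) / 2 < sqmod (s y)], above p).
      split=> //=; exists p => //; split=> //=; exact: divr_gt0.
    move=> [y q] /= [hy [_ [/= h1 h2]]].
    by apply: le_trans h2 _; apply: le_trans (ltW hy) (h1 y).
  exists rho, lam; split=> // x Kx; apply: (h (rho, lam)) => //.
have [[L rL] crho Mrho] := mrho.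
have A1 : 0 < `|A| + 1 by rewrite ltr_wpDl.
pose d := e * lam / (`|A| + 1); have d0 : 0 < d by rewrite divr_gt0// mulr_gt0.
have dr x : 0 < d + rho x.
  by have /andP[r0 _] := rL x; rewrite ltr_wpDr.
pose g x : C := ((((d + rho x)^-1)%:C)%C).
have cg : continuous g.
  have gE : g = fun x => (((d%:C)%C + ((rho x)%:C)%C : R[i])^-1 : C).
    by apply/funext => x; rewrite /g fmorphV rmorphD.
  rewrite gE => x; apply: cvgV_complex.
    rewrite -rmorphD; apply/eqP => h; have := dr x.
    by move: h => /complexI ->; rewrite ltxx.
  by apply: cvgD (crho x); exact: cvg_cst.
have gB x : normc (g x) <= d^-1.
  rewrite /g normc_real ?invr_ge0 ?(ltW (dr x))// lef_pV2 ?posrE//.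
  by rewrite lerDl; have /andP[] := rL x.
exists (wshift t (fun x => (a x : R[i]) * g x * ((rho x)%:C)%C));
  first exact: Mrho gB.
have wE := weight_multiplier mrho gB.
rewrite /Fourier -wshiftB//; apply: wshift_opb => //.
- rewrite (_ : (fun x => _) = fun x =>
      a x + ((-1 : C) : R[i]) * ((a x : R[i]) * g x * ((rho x)%:C)%C) : C).
    by apply: weightD => //; exact: weightZ.
  by apply/funext => x; rewrite mulN1r.
- exact: ltW.
move=> x; have dN0 : d + rho x != 0 by rewrite gt_eqF.
have -> : a x - (a x : R[i]) * g x * ((rho x)%:C)%C =
    (a x : R[i]) * ((d / (d + rho x))%:C)%C.
  rewrite /g -mulrA -rmorphM -{1}[a x]mulr1 -mulrBr -(rmorph1 (real_complex R)) -rmorphB.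
  by congr (_ * ((_)%:C)%C); field.
have /andP[r0 _] := rL x.
rewrite normcM normc_real; last by rewrite divr_ge0 ?ltW.
rewrite mulrA ler_pdivrMr//.
have [Kx|nKx] := pselect (K x).
  apply: (@le_trans _ _ (e * lam)).
    rewrite /d mulrA ler_pdivrMr//.
    rewrite mulrC ler_wpM2l ?mulr_ge0 ?ltW//.
    by apply: le_lt_trans (aA' x) _; rewrite ltrDl.
  rewrite ler_wpM2l ?(ltW e0)//; apply: le_trans (rhoK x Kx) _.
  by rewrite lerDr ltW.
apply: ler_pM; rewrite ?normc_ge0 ?(ltW d0)//; first exact: ltW (Ka x nKx).
by rewrite lerDl.
Qed.

End Slice.

Lemma bimodule_of_Fourier T : cstar T -> (forall t, M (Fourier t T)) -> M T.
Proof.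
move=> cT MT; apply: bim_lim => //; first exact: cstar_bounded.
move=> e e0; have [s Ts] := Fourier_approx cT e0.
exists (\sum_(k <- s) k.1 *: Fourier k.2 T) => //.
by apply: bim_sum => // k; exact: bimZ.
Qed.

(** The condition that defines A(sigma M) bears on each slice separately;
    conversely the Fourier components of an element of A(sigma M) lie in M. *)
Lemma spectral_FourierP : spectral M <-> forall S t, M S -> M (Fourier t S).
Proof.
split=> [specM S t MS|stable].
  have cS := bim_cstar MS; rewrite specM; split; first exact: Fourier_cstar.
  move=> gamma ns; rewrite coef_Fourier//; last exact: cstar_bounded.
  case: ifP => // _; apply/eqP; apply: contrapT => /negP nz.
  by apply: ns; exists S.
apply/seteqP; split=> [T MT|T [cT T0]].
  split; first exact: bim_cstar MT.
  move=> gamma ns; apply/eqP; apply: contrapT => /negP nz; apply: ns;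
    by exists T.
apply: bimodule_of_Fourier => // t.
exact: (@Fourier_in_bimodule t T).
Qed.

(** * The dual action of an abelian group *)

Section Modulation.
Variable b : Gam -> C.
Hypothesis b1 : forall t, normc (b t) = 1.

Definition modulate xi : H :=
  insubd (0 : H) (fun gamma => (b (cocycle gamma) : R[i]) * xi gamma : C).

Lemma sqsum_modulate xi :
  sqsum (fun gamma => (b (cocycle gamma) : R[i]) * xi gamma : C) = sqsum xi.
Proof.
apply: eq_esum => gamma _.
by rewrite sqmodM (sqmodE (b (cocycle gamma))) b1 expr1n mul1r.
Qed.

Lemma modulateE xi gamma : modulate xi gamma = (b (cocycle gamma) : R[i]) * xi gamma.
Proof. by rewrite /modulate insub_ell2// sqsum_modulate ell2P. Qed.

Lemma modulate_norm xi : l2norm (modulate xi) = l2norm xi.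
Proof.
congr (Num.sqrt (fine _)); rewrite -(sqsum_modulate xi).
by congr sqsum; apply/funext => gamma; exact: modulateE.
Qed.

Lemma modulate_linear : linear modulate.
Proof.
move=> c u v; apply: ell2_eq => gamma.
rewrite modulateE !ell2D !ell2Z !modulateE mulrDr; congr (_ + _).
by rewrite mulrCA.
Qed.

End Modulation.

Section Character.
Variable chi : Gam -> C.
Hypothesis chiP : unitary_character chi.

Lemma normc_chi t : normc (chi t) = 1.
Proof. by apply: (@complexI R); case: chiP => /(_ t). Qed.

Lemma chiM t u : chi (t * u)%g = (chi t : R[i]) * chi u.
Proof. by case: chiP. Qed.

Lemma chi_neq0 t : chi t != 0.
Proof. by apply/eqP => e; have := normc_chi t; rewrite e normc0; lra. Qed.

Lemma chi1 : chi 1%g = 1.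
Proof.
have := chiM 1%g 1%g; rewrite mulg1 => e; apply: (mulfI (chi_neq0 1%g)).
by rewrite -e mulr1.
Qed.

Lemma chiV t : chi t^-1%g = (chi t : R[i])^-1.
Proof.
by apply: (mulfI (chi_neq0 t)); rewrite mulfV ?chi_neq0// -chiM mulgV chi1.
Qed.

Lemma normc_chiV t : normc (chi t^-1%g) = 1. Proof. exact: normc_chi. Qed.

(** The automorphism attached to chi, implemented by a unitary of l^2(G). *)
Definition dual_act T : op :=
  modulate chi \o T \o modulate (fun t => chi t^-1%g).

Lemma dual_act_opb T (K : R) : opb T K -> opb (dual_act T) K.
Proof. by move=> TK xi;
  rewrite /= (modulate_norm normc_chi) -(modulate_norm normc_chiV xi);
  exact: TK. Qed.

Lemma dual_act_bounded T : bounded_op T -> bounded_op (dual_act T).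
Proof.
move=> [lT [K TK]]; split; last by exists K; exact: dual_act_opb.
apply: linear_comp (modulate_linear normc_chiV).
exact: linear_comp (modulate_linear normc_chi) lT.
Qed.

Lemma dual_actD S T : dual_act (S + T) = dual_act S + dual_act T.
Proof. by apply/funext => xi; exact: (linD (modulate_linear normc_chi)). Qed.

Lemma dual_actB S T : dual_act (S - T) = dual_act S - dual_act T.
Proof. by apply/funext => xi; exact: (linB (modulate_linear normc_chi)). Qed.

Lemma dual_act_wshift t F : weight t F -> dual_act (wshift t F) = chi t *: wshift t F.
Proof.
move=> wF; apply/funext => xi; apply: ell2_eq => gamma.
rewrite opZE ell2Z [LHS](modulateE normc_chi) (wshiftE xi gamma wF).
rewrite (wshiftE (modulate _ xi) gamma wF) (modulateE normc_chiV).
have [tg|ntg] := pselect (dom t (pt gamma));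
  last by rewrite wF.1// !mul0r !mulr0.
rewrite cocycle_gshift// invgM invgK chiM chiV.
by field; rewrite chi_neq0.
Qed.

Lemma dual_act_slice_span S : slice_span S -> slice_span (dual_act S).
Proof.
elim=> [|t F S' cF sS' IH].
  rewrite (_ : dual_act 0 = 0); first exact: slice_span0.
  apply/funext => xi; exact: (lin0 (modulate_linear normc_chi)).
rewrite dual_actD dual_act_wshift; last exact: Cc_on_weight.
apply: slice_spanD IH; apply: slice_spanZ; exact: slice_span1.
Qed.

Lemma dual_act_cstar T : cstar T -> cstar (dual_act T).
Proof.
move=> /cstarP[bT clT]; apply/cstarP.
split=> [|e e0]; first exact: dual_act_bounded.
have [S sS TS] := clT e e0; exists (dual_act S);
  first exact: dual_act_slice_span.
by rewrite -dual_actB; exact: dual_act_opb.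
Qed.

Lemma coef_dual_act T gamma : bounded_op T ->
  coef (dual_act T) gamma = (chi (cocycle gamma) : R[i]) * coef T gamma.
Proof.
move=> bT; rewrite /coef /= (modulateE normc_chi); congr (_ * T _ _).
apply: ell2_eq => g; rewrite (modulateE normc_chiV) /=.
have [->|ne] := eqVneq g (gsrc gamma); last by rewrite mulr0.
by rewrite /cocycle val_gsrc//= invg1 chi1 mulr1.
Qed.

Lemma Fourier_dual_act t T : bounded_op T ->
  Fourier t (dual_act T) = chi t *: Fourier t T.
Proof.
move=> bT; rewrite -wshiftZ//; last exact: weight_scoef.
congr wshift; apply/funext => x; rewrite /scoef /slice.
case: pselect => h; last by rewrite mulr0.
by rewrite coef_dual_act.
Qed.

End Character.

Lemma spectral_alpha_invariant : spectral M -> alpha_invariant M.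
Proof.
move=> /spectral_FourierP stable chi chiP T MT.
have cT := bim_cstar MT; have bT := cstar_bounded cT.
exists (dual_act chi T); last by move=> gamma; exact: coef_dual_act.
apply: bimodule_of_Fourier => [|t]; first exact: dual_act_cstar.
by rewrite Fourier_dual_act//; apply: bimZ; exact: stable.
Qed.

Section AlphaInvariant.
Hypothesis inv : alpha_invariant M.
Hypothesis comm : commutative_group Gam.

(** The symbols of contractive Fourier multipliers that preserve M. *)
Definition good_multiplier (p : Gam -> C) :=
  (forall T, M T -> exists2 T', M T' &
     forall gamma, coef T' gamma = (p (cocycle gamma) : R[i]) * coef T gamma) /\
  forall T (K : R), cstar T -> 0 <= K -> opb T K -> exists2 T', cstar T' & opb T' K /\
     forall gamma, coef T' gamma = (p (cocycle gamma) : R[i]) * coef T gamma.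

Lemma good_character chi : unitary_character chi -> good_multiplier chi.
Proof.
move=> chiP; split=> [T /(inv chiP)//|T K cT K0 TK].
exists (dual_act chi T); first exact: dual_act_cstar.
split; first exact: dual_act_opb.
by move=> gamma; apply: coef_dual_act => //; exact: cstar_bounded cT.
Qed.

Lemma good_scalar (c : C) : normc c <= 1 -> good_multiplier (fun=> c).
Proof.
move=> c1; split=> [T MT|T K cT K0 TK].
  by exists (c *: T); [exact: bimZ | move=> gamma].
exists (c *: T); first exact: cstarZ.
split=> //; apply: opb_le (opbZ c TK); by rewrite ler_piMl.
Qed.

Lemma good_mul p q : good_multiplier p -> good_multiplier q ->
  good_multiplier (fun t => (p t : R[i]) * q t).
Proof.
move=> [Mp cp] [Mq cq]; split=> [T /Mq[S MS ST]|T K cT K0 TK].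
  by have [S' MS' SS'] := Mp S MS; exists S' => // gamma; rewrite SS' ST mulrA.
have [S cS [SK ST]] := cq T K cT K0 TK.
have [S' cS' [S'K SS']] := cp S K cS K0 SK.
by exists S' => //; split=> // gamma; rewrite SS' ST mulrA.
Qed.

Lemma coef_sum (I : Type) (r : seq I) (S : I -> op) gamma :
  coef (\sum_(i <- r) S i) gamma = \sum_(i <- r) coef (S i) gamma.
Proof. by rewrite /coef opsumE ell2_sum. Qed.

Lemma good_average (N : nat) (p : nat -> Gam -> C) : (0 < N)%N ->
  (forall k, good_multiplier (p k)) ->
  good_multiplier (fun t => ((N%:R : R[i])^-1) * \sum_(k < N) p k t).
Proof.
move=> N0 gp; have NN0 : (N%:R : R[i]) != 0 by rewrite pnatr_eq0 -lt0n.
have cN : normc ((N%:R : R[i])^-1) = N%:R^-1.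
  rewrite normcV -(rmorph_nat (real_complex R)) normc_real//.
split=> [T MT|T K cT K0 TK].
  have /choice[S SP] k : exists S, M S /\ forall gamma, coef S gamma =
      (p k (cocycle gamma) : R[i]) * coef T gamma.
    by have [S ? ?] := (gp k).1 T MT; exists S.
  exists (((N%:R : R[i])^-1 : C) *: \sum_(k < N) S k).
    by apply: bimZ; apply: bim_sum => k; exact: (SP k).1.
  move=> gamma;
    rewrite [coef _ _]/(((N%:R : R[i])^-1) * coef (\sum_(k < N) S k) gamma).
  rewrite coef_sum -mulrA mulr_suml; congr (_ * _).
  by apply: eq_bigr => k _; exact: (SP k).2.
have /choice[S SP] k : exists S, [/\ cstar S, opb S K & forall gamma, coef S gamma =
    (p k (cocycle gamma) : R[i]) * coef T gamma].
  by have [S ? [? ?]] := (gp k).2 T K cT K0 TK; exists S.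
exists (((N%:R : R[i])^-1 : C) *: \sum_(k < N) S k).
  apply: cstarZ; apply: cstar_sum => k.
  by have [] := SP k.
split.
  have h : opb (\sum_(k < N) S k) (\sum_(k < N) K).
    by apply: opb_sum => k _; have [] := SP k.
  apply: opb_le (opbZ _ h); rewrite sumr_const card_ord cN -[K *+ N]mulr_natl.
  by rewrite mulrA mulVf ?mul1r// pnatr_eq0 -lt0n.
move=> gamma;
  rewrite [coef _ _]/(((N%:R : R[i])^-1) * coef (\sum_(k < N) S k) gamma).
rewrite coef_sum -mulrA mulr_suml; congr (_ * _).
by apply: eq_bigr => k _; have [_ _] := SP k; exact.
Qed.

(** Averaging the powers of a character that separates u from t kills u in the
    limit and keeps t. *)
Lemma good_separate t u (e : R) : u != t -> 0 < e -> exists p,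
  [/\ good_multiplier p, forall v, normc (p v) <= 1, p t = 1 & normc (p u) <= e].
Proof.
move=> ut e0.
have ut1 : (u * t^-1)%g <> 1%g.
  by move=> h; case/eqP: ut; rewrite -[u](mulgVK t) h mul1g.
have [chi chiP chiN] := character_separates R comm ut1.
pose q v : C := (chi t^-1%g : R[i]) * chi v.
have gq : good_multiplier q.
  by apply: good_mul (good_character chiP); apply: good_scalar;
    rewrite normc_chi.
have nq v : normc (q v) = 1 by rewrite normcM !normc_chi// mulr1.
have gqk k : good_multiplier (fun v => (q v : R[i]) ^+ k).
  elim: k => [|k IH].
    under eq_fun do rewrite expr0.
    by apply: good_scalar; rewrite normc1.
  by under eq_fun do rewrite exprS; exact: good_mul.
have nqk v k : normc ((q v : R[i]) ^+ k) = 1.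
  by rewrite (normcX (q v : Cplx R)) nq expr1n.
pose z : R[i] := q u.
have z1 : 1 - z != 0.
  rewrite subr_eq0 eq_sym; apply: contra chiN => /eqP <-.
  by rewrite (chiM chiP) mulrC.
have nz : 0 < normc (1 - z).
  rewrite lt_neqAle normc_ge0 andbT eq_sym; apply/eqP => /eq0_normc h.
  by rewrite h eqxx in z1.
pose N := (Num.trunc (2 / (e * normc (1 - z)))).+1.
have hN : 2 / (e * normc (1 - z)) < N%:R by exact: truncnS_gt.
have NR0 : 0 < N%:R :> R by rewrite ltr0n.
have cN : normc ((N%:R : R[i])^-1) = N%:R^-1.
  by rewrite normcV -(rmorph_nat (real_complex R)) normc_real.
exists (fun v => ((N%:R : R[i])^-1) * \sum_(k < N) (q v : R[i]) ^+ k); split.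
- exact: (@good_average N (fun k v => (q v : R[i]) ^+ k)).
- move=> v; rewrite normcM cN mulrC ler_pdivrMr// mul1r.
  apply: le_trans (normc_sum _ _ _) _; rewrite (eq_bigr (fun=> 1));
    last by move=> k _; exact: nqk.
  by rewrite sumr_const card_ord.
- rewrite (_ : q t = 1); last by rewrite /q -(chiM chiP) mulVg (chi1 chiP).
  rewrite (eq_bigr (fun=> 1)); last by move=> k _; rewrite expr1n.
  by rewrite sumr_const card_ord mulVf// pnatr_eq0.
have geo : (1 - z) * \sum_(k < N) z ^+ k = 1 - z ^+ N.
  by rewrite -opprB mulNr -subrX1 opprB.
rewrite normcM cN mulrC ler_pdivrMr//.
rewrite -(ler_pM2l nz) -normcM geo.
apply: (@le_trans _ _ 2).
  apply: le_trans (le_normcD (1 : C) (- z ^+ N)) _.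
  by rewrite normcN normc1 nqk.
rewrite mulrCA mulrA -ler_pdivrMl ?mulr_gt0// mulrC.
exact: ltW.
Qed.

Lemma good_concentrate t (s : seq Gam) (e : R) : 0 < e -> exists p,
  [/\ good_multiplier p, forall v, normc (p v) <= 1, p t = 1 &
      forall u, u \in s -> u != t -> normc (p u) <= e].
Proof.
move=> e0; elim: s => [|u s [p [gp p1 pt1 ps]]].
  exists (fun=> 1); split=> //; first by apply: good_scalar; rewrite normc1.
  by move=> v; rewrite normc1.
have [->|ut] := eqVneq u t.
  exists p; split=> // v; rewrite inE => /orP[/eqP ->|]; first by rewrite eqxx.
  exact: ps.
have [q [gq q1 qt1 qu]] := good_separate ut e0.
exists (fun v => (p v : R[i]) * q v); split.
- exact: good_mul.
- by move=> v; rewrite normcM mulr_ile1 ?normc_ge0.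
- by rewrite pt1 qt1 mulr1.
move=> v; rewrite inE normcM => /orP[/eqP -> _|vs vt].
  by apply: le_trans qu; rewrite ler_piMl ?normc_ge0.
apply: le_trans (ps v vs vt); by rewrite ler_piMr ?normc_ge0.
Qed.

(** The slice over t is kept exactly and the finitely many others are multiplied
    by small numbers. *)
Lemma multiplier_near_Fourier t S (e : R) : slice_span S -> 0 < e ->
  exists (s : seq Gam) (d : R), 0 < d /\ forall p T', p t = 1 ->
    (forall u, u \in s -> u != t -> normc (p u) <= d) -> cstar T' ->
    (forall gamma, coef T' gamma = (p (cocycle gamma) : R[i]) * coef S gamma) ->
  opb (T' - Fourier t S) e.
Proof.
move=> sS; elim: sS e => [|u F S' cF sS' IH] e e0.
  exists [::], 1; split=> // p T' _ _ cT' T'0.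
  rewrite (_ : T' = 0).
    rewrite Fourier0// subr0; exact: opb_le (ltW e0) (@opb0 _ _).
  by apply: (coef_eq0 cT') => gamma; rewrite T'0 mulr0.
have e2 : 0 < e / 2 by exact: divr_gt0.
have [s [d [d0 near]]] := IH _ e2.
have wF := Cc_on_weight cF; have bw := wshift_bounded wF.
have [K K0 FK] := bounded_opb bw.
have K1 : 0 < K + 1 by rewrite ltr_wpDl.
exists (u :: s), (Num.min d (e / 2 / (K + 1))); split.
  by rewrite lt_min d0 divr_gt0.
move=> p T' pt1 ps cT' T'E.
have cw : cstar (wshift u F) by apply: slice_span_cstar; exact: slice_span1.
pose T'' := T' - p u *: wshift u F.
have near'' : opb (T'' - Fourier t S') (e / 2).
  apply: (near p T'' pt1).
  - by move=> v vs vt; apply: le_trans (ps v _ vt) _;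
    rewrite ?inE ?vs ?orbT// ge_min lexx.
  - exact: (cstarB cT' (cstarZ _ cw)).
  move=> gamma.
  have e1 : coef T'' gamma =
      (coef T' gamma : R[i]) - (p u : R[i]) * coef (wshift u F) gamma.
    by [].
  have e3 : coef (wshift u F + S') gamma = (coef (wshift u F) gamma : R[i]) + coef S' gamma.
    by [].
  rewrite e1 T'E e3 coef_wshift// /unslice.
  by have [->|_] := eqVneq (cocycle gamma) u; ring.
have -> : T' - Fourier t (wshift u F + S') =
    (p u *: wshift u F - Fourier t (wshift u F)) + (T'' - Fourier t S').
  rewrite FourierD//; last exact: slice_span_bounded sS'.
  by rewrite /T'' addrACA (addrC (p u *: _)) subrK opprD.
rewrite [e]splitr; apply: opbD near''.
rewrite Fourier_wshift//; have [<-|tu] := eqVneq t u.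
  by rewrite pt1 scale1r subrr; exact: opb_le (ltW e2) (@opb0 _ _).
rewrite subr0; apply: opb_le (opbZ (p u) FK).
apply: (@le_trans _ _ (e / 2 / (K + 1) * K)).
  apply: ler_wpM2r => //; apply: le_trans (ps u _ _) _.
  - by rewrite inE eqxx.
  - by rewrite eq_sym.
  by rewrite ge_min lexx orbT.
by rewrite mulrAC ler_pdivrMr// ler_wpM2l ?(ltW e2)// lerDl.
Qed.

(** The multiplier concentrated at t moves S inside M; it is contractive, so it
    suffices that it be close to the projection on a finite sum near S. *)
Lemma alpha_invariant_Fourier S t : M S -> M (Fourier t S).
Proof.
move=> MS; have cS := bim_cstar MS; have bS := cstar_bounded cS.
apply: bim_lim; first exact: Fourier_bounded.
move=> e e0; have e3 : 0 < e / 3 by exact: divr_gt0.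
have [_ /(_ _ e3)[S0 sS0 SS0]] := (cstarP S).1 cS.
have bS0 := slice_span_bounded sS0.
have cS0 := slice_span_cstar sS0.
have [s [d [d0 near]]] := multiplier_near_Fourier t sS0 e3.
have [p [[Mp cp] p1 pt1 ps]] := good_concentrate t s d0.
have [S' MS' S'E] := Mp S MS; have cS' := bim_cstar MS'.
have [D cD [De DE]] := cp (S - S0) (e / 3) (cstarB cS cS0) (ltW e3) SS0.
exists S' => //; apply: opbC.
have nearS0 : opb ((S' - D) - Fourier t S0) (e / 3).
  apply: (near p _ pt1 ps (cstarB cS' cD)).
  move=> gamma.
  have e1 : coef (S' - D) gamma = (coef S' gamma : R[i]) - coef D gamma by [].
  have e2 : coef (S - S0) gamma = (coef S gamma : R[i]) - coef S0 gamma by [].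
  by rewrite e1 S'E DE e2; ring.
have nearS : opb (Fourier t S0 - Fourier t S) (e / 3).
  by apply: opbC; rewrite -FourierB//; apply: Fourier_opb => //;
    [exact: ltW|exact: boundedB].
have := opbD De (opb_trans nearS0 nearS).
rewrite addrA (addrC D) subrK.
by apply: opb_le; lra.
Qed.

End AlphaInvariant.

(** * Coactions *)

Section Coaction.

Local Notation HH := (ell2 R (G * Gam)%type).
Variable delta : op -> (HH -> HH).
Hypothesis isd : is_delta delta.

Lemma delta_bounded T : cstar T -> bounded_op (delta T).
Proof. by case: isd => -[+ _] _ _ _ _ cT => /(_ T cT)[]. Qed.

Lemma delta0 : delta 0 = 0.
Proof.
case: isd => -[_ +] _ _ _ _ => /(_ (-1) 0 0 cstar0 cstar0).
by rewrite scaler0 addr0 scaleN1r addNr.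
Qed.

Lemma deltaD S T : cstar S -> cstar T -> delta (S + T) = delta S + delta T.
Proof.
move=> cS cT; case: isd => -[_ +] _ _ _ _ => /(_ 1 S T cS cT).
by rewrite !scale1r.
Qed.

Lemma deltaZ (c : C) T : cstar T -> delta (c *: T) = c *: delta T.
Proof.
move=> cT; case: isd => -[_ +] _ _ _ _ => /(_ c T 0 cT cstar0).
by rewrite delta0 !addr0.
Qed.

Lemma deltaB S T : cstar S -> cstar T -> delta (S - T) = delta S - delta T.
Proof.
move=> cS cT; rewrite -(scaleN1r T) (deltaD cS (cstarZ (-1) cT)).
by rewrite (deltaZ _ cT) scaleN1r.
Qed.

Lemma delta_sum (I : Type) (r : seq I) (S : I -> op) : (forall i, cstar (S i)) ->
  delta (\sum_(i <- r) S i) = \sum_(i <- r) delta (S i).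
Proof.
move=> cS; elim: r => [|i r IH]; first by rewrite !big_nil delta0.
by rewrite !big_cons (deltaD (cS i) (cstar_sum r cS)) IH.
Qed.

Lemma half_normc : normc ((2 : R[i])^-1) = 2^-1 :> R.
Proof. by rewrite normcV -(rmorph_nat (real_complex R)) normc_real. Qed.

(** For h of norm at most 1/4 the iteration c |-> (h + c^2) / 2 converges, to a
    solution of 2 c - c^2 = h, that is (1 - c)^2 = 1 - h. *)
Lemma sqrt_one_minus h : cstar h -> adjoint_ops h h -> opb h (4^-1) ->
  exists c, [/\ cstar c, adjoint_ops c c & c + c = h + (c \o c)].
Proof.
move=> ch hh h4.
pose step (c : op) : op := ((2 : R[i])^-1 : C) *: (h + (c \o c)).
pose c_ n : op := iter n step 0.
have c_cstar n : cstar (c_ n).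
  elim: n => [|n IH]; first exact: cstar0.
  by apply: cstarZ; apply: (cstarD ch); exact: cstar_comp.
have c_lin n : linear (c_ n) by apply: bounded_linear;
  exact: cstar_bounded (c_cstar n).
have c_half n : opb (c_ n) (2^-1).
  elim: n => [|n IH]; first by apply: opb_le (@opb0 _ _).
  have := opbZ ((2 : R[i])^-1 : C) (opbD h4 (opb_comp _ IH IH)).
  by rewrite half_normc => /(_ ltac:(lra)); apply: opb_le; lra.
have c_adj n : adjoint_ops (c_ n) (c_ n).
  elim: n => [|n IH].
    move=> xi eta; change (inner (0 : H) eta = inner xi 0).
    by rewrite -(scale0r (0 : H)) innerZl innerZr conjc0 !mul0r.
  have e : (((2 : R[i])^-1)^*)%C = (2 : R[i])^-1.
    by rewrite conjc_inv conjc_nat.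
  have := adjoint_opsZ ((2 : R[i])^-1 : C) (adjoint_opsD hh (adjoint_ops_comp IH IH)).
  by rewrite e.
pose e n : R := 2^-1 ^+ n.
have e0 n : 0 <= e n by rewrite exprn_ge0.
have stepB n m : c_ n.+1 - c_ m.+1 = ((2 : R[i])^-1 : C) *:
    ((c_ n \o (c_ n - c_ m)) + ((c_ n - c_ m) \o c_ m)).
  rewrite [c_ n.+1]/(step (c_ n)) [c_ m.+1]/(step (c_ m)) /step -scalerBr.
  congr (_ *: _); rewrite opprD addrACA subrr add0r.
  apply/funext => xi; change (c_ n (c_ n xi) - c_ m (c_ m xi) =
    c_ n (c_ n xi - c_ m xi) + (c_ n (c_ m xi) - c_ m (c_ m xi))).
  by rewrite (linB (c_lin n)) addrA subrK.
have c_step n : opb (c_ n.+1 - c_ n) (e n.+2).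
  elim: n => [|n IH].
    rewrite [c_ 0%N]/(0 : op) subr0;
      have := opbZ ((2 : R[i])^-1 : C) (opbD h4 (@opb0 R G)).
    rewrite half_normc [c_ 1%N]/(((2 : R[i])^-1 : C) *: (h + 0)).
    by apply: opb_le; rewrite /e; lra.
  rewrite stepB.
  have := opbZ ((2 : R[i])^-1 : C) (opbD (opb_comp _ (c_half n.+1) IH)
    (opb_comp (e0 _) IH (c_half n))).
  rewrite half_normc => /(_ ltac:(lra)); apply: opb_le.
  by rewrite [e n.+3]exprS -/(e n.+2); lra.
have c_cauchy n m : (n <= m)%N -> opb (c_ m - c_ n) (e n.+1).
  move=> nm; rewrite -(subnK nm); move: (m - n)%N => k {nm m}.
  suff : opb (c_ (k + n)%N - c_ n) (e n.+1 - e (k + n).+1).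
    by apply: opb_le; rewrite gerBl.
  elim: k => [|k IH].
    by rewrite add0n !subrr; exact: opb0.
  have := opb_trans (c_step (k + n)%N) IH; apply: opb_le.
  by rewrite addSn /e !exprS; lra.
have e_small d : 0 < d -> exists n, e n.+1 < d.
  move=> d0; have [n hn] := inv_small d0; exists n; apply: le_lt_trans hn.
  rewrite /e exprVn lef_pV2 ?posrE ?exprn_gt0// -natrX ler_nat.
  by rewrite ltnW// ltn_expl.
have [c cc cP] := cstar_cauchy e_small (fun n => e0 n.+1) c_cstar c_cauchy.
have c1 : opb c 1.
  have := opbD (cP 0%N) (c_half 0%N); rewrite subrK; apply: opb_le.
  by rewrite /e expr1; lra.
have lc : linear c by apply: bounded_linear; exact: cstar_bounded cc.
exists c; split=> //.
  apply: adjoint_ops_lim => d /e_small[n en]; exists (c_ n), (c_ n).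
  by split=> //; exact: opb_le (ltW en) (cP n).
apply/eqP; rewrite -subr_eq0; apply/eqP/opb_small_eq0 => d d0.
have [n en] := e_small (d / 4) (divr_gt0 d0 (ltr0Sn R 3)).
have two : c_ n.+1 + c_ n.+1 = h + (c_ n \o c_ n).
  rewrite -mulr2n -scaler_nat [c_ n.+1]/(step (c_ n)) /step scalerA.
  by rewrite mulfV ?scale1r// pnatr_eq0.
have -> : c + c - (h + (c \o c)) = ((c - c_ n.+1) + (c - c_ n.+1)) +
    (((c_ n - c) \o c_ n) + (c \o (c_ n - c))).
  rewrite [X in _ = X + _]addrACA -opprD two.
  apply/funext => xi; change (c xi + c xi - (h xi + c (c xi)) =
    c xi + c xi - (h xi + c_ n (c_ n xi)) +
    (c_ n (c_ n xi) - c (c_ n xi) + c (c_ n xi - c xi))).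
  have -> : c_ n (c_ n xi) - c (c_ n xi) + c (c_ n xi - c xi) =
      c_ n (c_ n xi) - c (c xi) by rewrite (linB lc) addrA subrK.
  by rewrite -[RHS]addrA; congr (_ + _); rewrite !opprD -addrA addKr.
have n1 : opb (c - c_ n.+1) (d / 4).
  by apply: opb_le (cP n.+1); apply: le_trans (ltW en);
    rewrite /e [leLHS]exprS; have := e0 n.+1; rewrite /e; lra.
have nn := opb_le (ltW en) (cP n).
have d4 : 0 <= d / 4 by rewrite divr_ge0 ?ltW.
have := opbD (opbD n1 n1) (opbD (opb_comp d4 (opbC nn) (c_half n))
  (opb_comp ler01 c1 (opbC nn))).
by apply: opb_le; lra.
Qed.

(** A *-homomorphism between C*-algebras is bounded: with h = a^* a small and c
    as above, 1 - delta(h) = (1 - delta(c))^2 is positive. *)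
Lemma delta_small_opb a : cstar a -> opb a (2^-1) -> opb (delta a) 1.
Proof.
move=> ca a2; have [b cb ab] := cstar_adjoint ca.
have half0 : 0 <= 2^-1 :> R by lra.
have b2 := adjoint_opb ab half0 a2.
have ch : cstar (b \o a) by exact: cstar_comp.
have hh : adjoint_ops (b \o a) (b \o a) by apply: adjoint_ops_comp => //;
  exact: adjoint_opsC.
have h4 : opb (b \o a) (4^-1).
  by apply: opb_le (opb_comp half0 b2 a2); lra.
have [c [cc cadj ccE]] := sqrt_one_minus ch hh h4.
have [[_ _] dmul dA _ _] := isd.
have dab := dA _ _ ca cb ab; have dcc := dA _ _ cc cc cadj.
have ccc : cstar (c \o c) by exact: cstar_comp.
have eq : delta c + delta c = (delta b \o delta a) + (delta c \o delta c).
  by rewrite -(deltaD cc cc) ccE (deltaD ch ccc) (dmul _ _ cb ca) (dmul _ _ cc cc).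
move=> xi; rewrite mul1r.
rewrite -(@ler_pXn2r _ 2)// ?nnegrE ?l2norm_ge0// -subr_ge0.
suff -> : l2norm xi ^+ 2 - l2norm (delta a xi) ^+ 2 = l2norm (xi - delta c xi) ^+ 2.
  exact: sqr_ge0.
have realB (x y : R) : ((x - y)%:C)%C = (x%:C)%C - (y%:C)%C :> R[i] by exact: rmorphB.
apply: (@complexI R); rewrite realB -!innerxx.
have eqx : delta c xi + delta c xi = delta b (delta a xi) + delta c (delta c xi).
  exact: (congr1 (fun U : HH -> HH => U xi) eq).
rewrite innerDl !innerDr !innerNl !innerNr (dcc xi xi) (dcc xi (delta c xi)).
rewrite (dab xi (delta a xi)).
have := congr1 (inner xi) eqx; rewrite !innerDr => e.
have -> : inner xi (delta b (delta a xi)) =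
  inner xi (delta c xi) + inner xi (delta c xi) - inner xi (delta c (delta c xi)).
  by rewrite e addrK.
by ring.
Qed.

(** By rescaling; the value of the constant does not matter for continuity. *)
Lemma delta_opb T (K : R) : cstar T -> 0 <= K -> opb T K -> opb (delta T) (2 * K).
Proof.
move=> cT K0 TK.
have pos L : 0 < L -> opb T L -> opb (delta T) (2 * L).
  move=> L0 TL; pose s : C := ((((2 * L)^-1)%:C)%C).
  have L20 : 0 < 2 * L by rewrite mulr_gt0.
  have ns : normc s = (2 * L)^-1 by rewrite normc_real// invr_ge0 ltW.
  have sT : opb (s *: T) (2^-1).
    apply: opb_le (opbZ s TL); rewrite ns invfM -mulrA mulVf ?mulr1//.
    by rewrite gt_eqF.
  have := delta_small_opb (cstarZ s cT) sT; rewrite (deltaZ s cT) => h xi.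
  have := h xi; rewrite [l2norm _]l2normZ ns mul1r.
  by rewrite mulrC ler_pdivrMr// mulrC.
move=> xi; apply/ler_addgt0Pr => e e0.
have N0 : 0 < 2 * l2norm xi + 1 by rewrite ltr_wpDl// mulr_ge0 ?l2norm_ge0.
pose d := e / (2 * l2norm xi + 1); have d0 : 0 < d by exact: divr_gt0.
have := pos (K + d) (ltr_wpDl K0 d0) (opb_le _ TK) xi.
rewrite lerDl ltW// => /(_ isT) h; apply: le_trans h _.
have -> : 2 * (K + d) * l2norm xi = 2 * K * l2norm xi + d * (2 * l2norm xi) by ring.
by rewrite lerD2l /d mulrAC ler_pdivrMr// ler_wpM2l ?(ltW e0)// lerDl.
Qed.

Local Notation lambda := (@left_regular R Gam).
Implicit Types (U V : HH -> HH).

(** ** The slice map *)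

(** The compression of U by the isometries xi |-> xi (x) e_1 and xi |-> xi (x) e_t:
    it takes S (x) V to the multiple <V e_1, e_t> S of S. *)
Definition slice_map t U : op := fun xi =>
  insubd (0 : H) (fun gamma => U (tensor_vec xi (basis_vec 1%g)) (gamma, t)).

Lemma sqsum_slice_map t U xi :
  (sqsum (fun gamma => U (tensor_vec xi (basis_vec 1%g)) (gamma, t)) <=
   sqsum (U (tensor_vec xi (basis_vec 1%g))))%E.
Proof.
set v := U _; rewrite /sqsum.
rewrite -(@esum_image _ _ _ [set: G] (fun gamma => (gamma, t)) (fun k => (sqmod (v k))%:E)).
  rewrite esum_mkcond; apply: le_esum => k _.
  by case: ifP => // _; exact: sqmodE_ge0.
by move=> g g' _ _ [].
Qed.

Lemma slice_mapE t U xi gamma :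
  slice_map t U xi gamma = U (tensor_vec xi (basis_vec 1%g)) (gamma, t).
Proof.
rewrite /slice_map insub_ell2//.
by apply: le_lt_trans (sqsum_slice_map _ _ _) _; exact: ell2P.
Qed.

Lemma slice_mapB t U V : slice_map t (U - V) = slice_map t U - slice_map t V.
Proof.
by apply/funext => xi; apply: ell2_eq => gamma; rewrite opBE ell2B !slice_mapE.
Qed.

Lemma slice_map_opb t U (K : R) : 0 <= K -> opb U K -> opb (slice_map t U) K.
Proof.
move=> K0 UK xi; rewrite l2norm_leP ?mulr_ge0 ?l2norm_ge0//.
apply: (@le_trans _ _ (sqsum (U (tensor_vec xi (basis_vec 1%g))))).
  apply: le_trans (sqsum_slice_map t U xi).
  rewrite le_eqVlt; apply/orP; left; apply/eqP; congr sqsum.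
  by apply/funext => gamma; exact: slice_mapE.
rewrite -l2norm_sqr lee_fin ler_pXn2r ?nnegrE ?mulr_ge0 ?l2norm_ge0//.
by apply: le_trans (UK _) _; rewrite l2norm_tensor l2norm_basis mulr1.
Qed.

Lemma slice_map_tensor t S (V : ell2 R Gam -> ell2 R Gam) U : is_tensor S V U ->
  slice_map t U = V (basis_vec 1%g) t *: S.
Proof.
move=> [_ UE]; apply/funext => xi; apply: ell2_eq => gamma.
by rewrite slice_mapE UE tensor_vecE opZE ell2Z mulrC.
Qed.

Lemma slice_map_sum t (I : Type) (r : seq I) (c : I -> C) (U : I -> HH -> HH) :
  slice_map t (\sum_(i <- r) c i *: U i) = \sum_(i <- r) c i *: slice_map t (U i).
Proof.
apply/funext => xi; apply: ell2_eq => gamma.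
rewrite slice_mapE !opsumE !ell2_sum; apply: eq_bigr => i _.
by rewrite !opZE !ell2Z slice_mapE.
Qed.

Lemma unslice_supp t F : supp (unslice t F) `<=` [set gamma | cocycle gamma = t].
Proof.
move=> gamma clg; have [g' [/= nz e]] := clg _ (near_cocycle gamma).
rewrite -e; apply/eqP; apply: contraNT nz => nt.
by rewrite /unslice (negPf nt).
Qed.

Lemma delta_wshift t F : Cc_on t F ->
  is_tensor (wshift t F) (lambda t) (delta (wshift t F)).
Proof.
move=> cF; have [_ _ _ _ h] := isd.
apply: (h t (unslice t F)); [exact: Cc_unslice | exact: unslice_supp |].
by apply: regular_rep_wshift; exact: Cc_on_weight.
Qed.

(** The defining property of delta on C_c of the slice extends to C_0 of the slice
    by continuity of delta. *)
Lemma delta_Fourier t T : cstar T ->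
  is_tensor (Fourier t T) (lambda t) (delta (Fourier t T)).
Proof.
move=> cT; have cE := Fourier_cstar t cT.
split=> [|xi zeta]; first exact: delta_bounded.
apply: ell2_eq => k; rewrite tensor_vecE.
apply/eqP; rewrite -subr_eq0; apply/eqP/normc_small_eq0 => e e0.
pose N := 2 * l2norm (tensor_vec xi zeta) + l2norm xi * normc (lambda t zeta k.2) + 1.
have N0 : 0 < N by rewrite ltr_wpDl// addr_ge0 ?mulr_ge0 ?l2norm_ge0 ?normc_ge0.
pose d := e / N; have d0 : 0 < d by exact: divr_gt0.
have [bT /(_ _ d0)[S sS TS]] := (cstarP T).1 cT.
have bS := slice_span_bounded sS.
have FTS : opb (Fourier t T - Fourier t S) d.
  by rewrite -FourierB//; apply: Fourier_opb (ltW d0) (boundedB bT bS) TS.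
have cFS : cstar (Fourier t S).
  exact: (Fourier_cstar t (slice_span_cstar sS)).
have [_ dS] := delta_wshift (Cc_on_scoef t sS).
have dTS := delta_opb (cstarB cE cFS) (ltW d0) FTS.
rewrite (deltaB cE cFS) in dTS.
have dSk : delta (Fourier t S) (tensor_vec xi zeta) k =
    (Fourier t S xi k.1 : R[i]) * lambda t zeta k.2.
  by rewrite -/(Fourier t S) in dS *; rewrite dS tensor_vecE.
have -> : delta (Fourier t T) (tensor_vec xi zeta) k -
    (Fourier t T xi k.1 : R[i]) * lambda t zeta k.2 =
  (delta (Fourier t T) - delta (Fourier t S)) (tensor_vec xi zeta) k -
    ((Fourier t T - Fourier t S) xi k.1 : R[i]) * lambda t zeta k.2.
  rewrite [in RHS]opBE [in RHS]ell2B dSk.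
  rewrite [((Fourier t T - Fourier t S) xi k.1)]/(Fourier t T xi k.1 - Fourier t S xi k.1).
  by rewrite mulrBl; ring.
apply: le_trans (le_normcD _ _) _; rewrite normcN normcM.
apply: (@le_trans _ _ (d * (N - 1))); last first.
  by rewrite /d mulrAC ler_pdivrMr// ler_wpM2l ?(ltW e0)// gerBl.
rewrite /N addrK mulrDr; apply: lerD.
  apply: le_trans (normc_le_l2norm _ _) _; apply: le_trans (dTS _) _.
  by rewrite (mulrC 2) mulrA.
rewrite mulrA ler_wpM2r ?normc_ge0//.
exact: le_trans (normc_le_l2norm _ _) (FTS xi).
Qed.

(** On a slice over u both sides are <lambda_u e_1, e_t> times that slice, and both
    are continuous. *)
Lemma slice_map_delta t T : cstar T -> slice_map t (delta T) = Fourier t T.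
Proof.
have span S : slice_span S -> slice_map t (delta S) = Fourier t S.
  elim=> [|u F S' cF sS' IH].
    rewrite delta0 Fourier0//.
    by apply/funext => xi; apply: ell2_eq => gamma; rewrite slice_mapE.
  have cS' := slice_span_cstar sS'.
  have wF := Cc_on_weight cF.
  have cw : cstar (wshift u F) by apply: slice_span_cstar; exact: slice_span1.
  rewrite (deltaD cw cS') FourierD//;
    [|exact: wshift_bounded|exact: cstar_bounded cS'].
  have -> : slice_map t (delta (wshift u F) + delta S') =
      slice_map t (delta (wshift u F)) + slice_map t (delta S').
    by apply/funext => xi; apply: ell2_eq => gamma;
      rewrite opDE ell2D !slice_mapE.
  rewrite IH; congr (_ + _).
  rewrite (slice_map_tensor t (delta_wshift cF)) Fourier_wshift// left_regularE /=.
  have -> : ((u^-1 * t)%g == 1%g) = (t == u).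
    apply/eqP/eqP => [h|->]; last by rewrite mulVg.
    by rewrite -(mulVKg u t) h mulg1.
  by case: eqP => _; rewrite ?scale1r ?scale0r.
move=> cT; apply/eqP; rewrite -subr_eq0; apply/eqP/opb_small_eq0 => e e0.
have e3 : 0 < e / 3 by exact: divr_gt0.
have [bT /(_ _ e3)[S sS TS]] := (cstarP T).1 cT.
have bS := slice_span_bounded sS.
have cS := slice_span_cstar sS.
have dTS := delta_opb (cstarB cT cS) (ltW e3) TS.
rewrite (deltaB cT cS) in dTS.
have e6 : 0 <= 2 * (e / 3) by rewrite mulr_ge0 ?(ltW e3).
have sTS := slice_map_opb t e6 dTS.
rewrite slice_mapB (span S sS) in sTS.
have FTS : opb (Fourier t S - Fourier t T) (e / 3).
  by apply: opbC; rewrite -FourierB//;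
    apply: Fourier_opb (ltW e3) (boundedB bT bS) TS.
by apply: opb_le (opb_trans sTS FTS); lra.
Qed.

Let tensors := [set U : HH -> HH | exists S (V : ell2 R Gam -> ell2 R Gam),
  [/\ M S, @group_cstar R Gam V & is_tensor S V U]].

Lemma tensors_bounded : opspan tensors `<=` @bounded_op R (G * Gam)%type.
Proof. by apply: opspan_bounded => U [S [V [_ _ []]]]. Qed.

Lemma delta_invariant_Fourier S t : delta_invariant delta M -> M S -> M (Fourier t S).
Proof.
move=> inv MS; have cS := bim_cstar MS.
apply: bim_lim; first by apply: Fourier_bounded => //; exact: cstar_bounded cS.
move=> e e0;
  have /(opclosureP _ tensors_bounded)[_ /(_ _ e0)[V [n [c [W [WM ->]]]] dV]] := inv S MS.
exists (slice_map t (\sum_(k < n) c k *: W k)); last first.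
  by rewrite -(slice_map_delta t cS) -slice_mapB;
    exact: slice_map_opb (ltW e0) dV.
rewrite slice_map_sum; apply: bim_sum => k; apply: bimZ.
have [S' [V' [MS' _ tS']]] := WM k.
by rewrite (slice_map_tensor t tS'); exact: bimZ.
Qed.

Lemma Fourier_delta_invariant : (forall S t, M S -> M (Fourier t S)) ->
  delta_invariant delta M.
Proof.
move=> stable T MT; have cT := bim_cstar MT.
apply/(opclosureP _ tensors_bounded); split=> [|e e0];
  first exact: delta_bounded.
have e2 : 0 < e / 2 by exact: divr_gt0.
have [s Ts] := Fourier_approx cT e2.
have cF k : cstar (k.1 *: Fourier k.2 T : op).
  by apply: cstarZ; exact: Fourier_cstar.
pose Q := \sum_(k <- s) k.1 *: Fourier k.2 T.
have cQ : cstar Q by exact: cstar_sum.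
exists (delta Q); last first.
  rewrite -(deltaB cT cQ).
  have := delta_opb (cstarB cT cQ) (ltW e2) Ts.
  by apply: opb_le; lra.
rewrite /Q (delta_sum s cF).
exists (size s), (fun i => (nth (0, 1%g) s i).1),
  (fun i => delta (Fourier (nth (0, 1%g) s i).2 T)); split.
  move=> i; set t := (nth _ s i).2; exists (Fourier t T), (lambda t).
  by split; [exact: stable | exact: left_regular_cstar | exact: delta_Fourier].
rewrite (big_nth (0, 1%g)) big_mkord; apply: eq_bigr => i _.
by rewrite (deltaZ _ (Fourier_cstar _ cT)).
Qed.

End Coaction.

End Groupoid.

Theorem corollary4p15 (R : realType) (X : topologicalType) (Gam : groupType)
    (P : set Gam) (theta : Gam -> X -> X)
    (M : set (ell2 R (tgpd P theta) -> ell2 R (tgpd P theta))) :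
  @second_countable X -> locally_compact [set: X] -> hausdorff_space X ->
  countable [set: Gam] -> amenable_group R Gam ->
  ore_semigroup P -> injective_action P theta -> diagonal_bimodule M ->
  (commutative_group Gam -> (spectral M <-> alpha_invariant M)) /\
  (~ commutative_group Gam -> forall delta, is_delta delta ->
     (spectral M <-> delta_invariant delta M)).
Proof.
move=> _ _ hX _ amen Pore actP dM.
have specP := spectral_FourierP hX Pore actP amen dM.
split=> [comm|_ delta isd]; split.
- exact: (spectral_alpha_invariant hX Pore actP amen dM).
- move=> inv; apply/specP => S t MS.
  exact: (alpha_invariant_Fourier hX Pore actP amen dM inv comm).
- by move=> /specP; exact: (Fourier_delta_invariant hX Pore actP amen dM isd).
- move=> inv; apply/specP => S t MS.
  exact: (delta_invariant_Fourier hX Pore actP dM isd).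
Qed.
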